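(* Let $d\ge1$ and $s_0>d/2$. There exist $\varepsilon_0\in(0,1)$ and a constant $\mathtt{M}>0$ (an absolute constant in the sense explained in the context) such that for every integer $p\ge1$, every real $s_1\ge s_0$, every $0<\varepsilon\le\varepsilon_0$ and every $u_0\in H^{s_1}(\mathbb{T}^d;\mathbb{C})$ satisfying \[ \|u_0\|_{H^{s_1}}\le\varepsilon,\qquad (2\mathtt{M})^{s_1}\|u_0\|_{L^2}\le\varepsilon, \] the following holds. There exist a time $T=T(u_0,\mathtt{M},s_1)>0$ and a unique solution $u(t)$ of \[ \mathrm{i}u_t-\Delta u\pm|u|^{2p}u=0,\qquad x\in\mathbb{T}^d, \] (for either choice of the sign) with $u(0)=u_0$ and \[ u\in C^0([0,T];H^{s_1}(\mathbb{T}^d;\mathbb{C}))\cap C^1([0,T];H^{s_1-2}(\mathbb{T}^d;\mathbb{C})), \qquad T\ge T_{good}:=\frac{1}{\varepsilon^{2p}}\,\frac{1}{2^{4(2p+2)}}\,\frac{2^{2p(s_1-s_0)}}{\mathtt{M}^{2ps_0}}, \] satisfying \[ \sup_{t\in[0,T]}\|u(t)\|_{H^{s_1}}\le 6\Big(\|u_0\|_{H^{s_1}}+(2\mathtt{M})^{s_1}\|u_0\|_{L^2}\Big). \] If in addition, for some $s\ge s_1$, one has $u_0\in H^s(\mathbb{T}^d;\mathbb{C})$, then the solution $u(t)$ evolving from $u_0$ satisfies $u\in C^0([0,T];H^{s}(\mathbb{T}^d;\mathbb{C}))\cap C^1([0,T];H^{s-2}(\mathbb{T}^d;\mathbb{C}))$,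 with $T\ge T_{good}$, and \[ \|u(t)\|_{H^s}\le 3\Big(\|u_0\|_{H^s}+(2\mathtt{M})^s\|u_0\|_{L^2}\Big)\exp\Big(\mathtt{M}^{2p(s-s_1)}\frac{2^{4p+1}\mathtt{M}^{2ps_0}}{2^{2p(s_1-s_0)}}\,\varepsilon^{2p}t\Big),\qquad\forall\,t\in[0,T]. \] As a consequence, for every $\widetilde{T}\le T_{good}$, \[ \sup_{t\in[0,\widetilde{T}]}\|u(t)\|_{H^s}\le 3\Big(\|u_0\|_{H^s}+(2\mathtt{M})^s\|u_0\|_{L^2}\Big)\exp\big\{\mathtt{M}^{2p(s-s_1)}\big\}. \]
   Context: $\mathbb{T}^d=(\mathbb{R}/2\pi\mathbb{Z})^d$. The Laplacian acts by $\Delta e^{\mathrm{i}j\cdot x}=-|j|^2e^{\mathrm{i}j\cdot x}$, $j\in\mathbb{Z}^d$, with $|j|$ the Euclidean norm. The Sobolev norm is $\|u\|_{H^s}:=\|u\|_{L^2}+\|(\sqrt{-\Delta})^su\|_{L^2}$, where $(\sqrt{-\Delta})^se^{\mathrm{i}j\cdot x}=|j|^se^{\mathrm{i}j\cdot x}$. ''Absolute constant'' means a constant depending at most on the fixed parameters $d$ and $s_0$; in particular not on $\varepsilon,p,s_1,s,u_0$. *)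

(* Defs.v *)
From HB Require Import structures.
From mathcomp Require Import all_boot all_order all_algebra.
From mathcomp Require Import all_classical all_reals all_analysis.
From mathcomp Require Import complex.
Set Implicit Arguments.
Unset Strict Implicit.
Unset Printing Implicit Defensive.
Import Order.TTheory GRing.Theory Num.Theory.
Import numFieldNormedType.Exports.
Local Open Scope classical_set_scope.
Local Open Scope ring_scope.
Local Open Scope complex_scope.

(* A point of the torus (R/2piZ)^d is given by a d-tuple of reals.  The measure
   torus_measure is d-dimensional Lebesgue measure restricted to the fundamental
   domain [0, 2 pi]^d, so functions on the torus, taken up to almost-everywhere
   equality, are functions on tuples taken up to torus_measure-a.e. equality. *)
Notation torus R d := (d.-tuple (measurableTypeR R)).

Section TorusMeasure.
Variable R : realType.

Definition circle_measure : set (measurableTypeR R) -> \bar R :=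
  mrestr (@lebesgue_measure R) (measurable_itv `[(0 : R), 2 * pi]).

HB.instance Definition _ := Measure.on circle_measure.

Let circle_fin : fin_num_fun circle_measure.
Proof.
move=> A mA; rewrite ge0_fin_numE ?measure_ge0//.
apply: (@le_lt_trans _ _ (circle_measure setT)).
  by apply: le_measure; rewrite ?inE//.
rewrite /circle_measure /mrestr setTI /= lebesgue_measure_itv /=.
by case: ifP => _; rewrite -?EFinB ltry.
Qed.

HB.instance Definition _ :=
  Measure_isFinite.Build _ _ _ circle_measure circle_fin.

Definition torus_cons d (z : measurableTypeR R * torus R d) : torus R d.+1 :=
  [tuple of z.1 :: z.2].

Lemma measurable_torus_cons d :
  measurable_fun [set: measurableTypeR R * torus R d] (@torus_cons d).
Proof. exact: measurable_cons. Qed.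

Section Step.
Variables (d : nat) (m : {finite_measure set (torus R d) -> \bar R}).

Definition torus_step : set (torus R d.+1) -> \bar R :=
  pushforward (circle_measure \x m)%E (@torus_cons d).


HB.instance Definition _ := Measure.copy torus_step
  (measure_function_pushforward__canonical__measure_function_Measure
     (circle_measure \x m)%E (@measurable_torus_cons d)).

Let torus_step_fin : fin_num_fun torus_step.
Proof.
move=> A mA; rewrite ge0_fin_numE ?measure_ge0//.
apply: (@le_lt_trans _ _ (torus_step setT)).
  by apply: le_measure; rewrite ?inE//.
rewrite /torus_step /pushforward preimage_setT -setXTT product_measure1E//.
by rewrite lte_mul_pinfty ?measure_ge0// ?fin_num_measure// ltey_eq fin_num_measure.
Qed.

HB.instance Definition _ :=
  Measure_isFinite.Build _ _ _ torus_step torus_step_fin.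
End Step.

Fixpoint torus_measure d : {finite_measure set (torus R d) -> \bar R} :=
  if d is d'.+1 then torus_step (torus_measure d') else \d_([tuple]).

End TorusMeasure.

Section Sobolev.
Context {R : realType} {d : nat}.
Implicit Types (f g : torus R d -> R[i]) (j : d.-tuple int) (r s T : R).

Local Notation mu := (torus_measure R d).

Definition cintegral f : R[i] :=
  (\int[mu]_x complex.Re (f x))%R +i* (\int[mu]_x complex.Im (f x))%R.

Definition L2norm f : \bar R := 'N[mu]_2%:E [EFin \o (@Normc.normc R \o f)].

Definition in_L2 f : Prop :=
  [/\ measurable_fun setT (fun x => complex.Re (f x)),
      measurable_fun setT (fun x => complex.Im (f x)) &
      (L2norm f < +oo)%E].

Definition freq_dot j (x : torus R d) : R :=
  \sum_(i < d) (tnth j i)%:~R * (tnth x i : R).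

Definition freq_norm j : R := Num.sqrt (\sum_(i < d) (tnth j i)%:~R ^+ 2).

(* A periodic distribution is given by the family of its Fourier coefficients.
   The families met below lie in some H^r, hence grow at most polynomially and
   are the coefficients of a unique distribution. *)
Definition distrib : Type := d.-tuple int -> R[i].
Implicit Types v w : distrib.

(* coefficient of e^{ij.x} *)
Definition fourier f : distrib := fun j =>
  (((2 * pi) ^+ d)^-1)%:C *
  cintegral (fun x => f x * (cos (freq_dot j x) -i* sin (freq_dot j x))).

Definition multiplier (m : d.-tuple int -> R) v : distrib :=
  fun j => (m j)%:C * v j.

Definition laplacian : distrib -> distrib :=
  multiplier (fun j => - freq_norm j ^+ 2).

(* (sqrt (- Delta))^s *)
Definition frac_laplacian s : distrib -> distrib :=
  multiplier (fun j => freq_norm j `^ s).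

(* (1 - Delta)^(s/2) *)
Definition bessel s : distrib -> distrib :=
  multiplier (fun j => (1 + freq_norm j ^+ 2) `^ (s / 2)).

(* L^2 norm of a distribution: the norm of the L^2 function, unique up to a.e.
   equality, that has these Fourier coefficients, and +oo if there is none. *)
Definition distrib_L2norm v : \bar R :=
  ereal_inf [set L2norm g | g in [set g | in_L2 g /\ fourier g = v]].

(* ||f||_{L^2} + ||(sqrt (- Delta))^s f||_{L^2} *)
Definition Hnorm s f : \bar R :=
  (L2norm f + distrib_L2norm (frac_laplacian s (fourier f)))%E.

Definition in_H s f : Prop := in_L2 f /\ (Hnorm s f < +oo)%E.

(* H^r norm of a distribution.  The exponent r may be negative, and H^r is then
   the usual space of distributions v with (1 - Delta)^(r/2) v in L^2. *)
Definition distrib_Hnorm r v : \bar R :=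
  if 0 <= r then (distrib_L2norm v + distrib_L2norm (frac_laplacian r v))%E
  else distrib_L2norm (bessel r v).

Definition in_distrib_H r v : Prop := (distrib_Hnorm r v < +oo)%E.

(* u in C^0([0, T]; H^s) *)
Definition C0_H s T (u : R -> torus R d -> R[i]) : Prop :=
  forall t, t \in `[0, T] -> in_H s (u t) /\
    Hnorm s (fun x => u t' x - u t x) @[t' --> within `[0, T]%classic (nbhs t)] --> 0%E.

(* w in C^0([0, T]; H^r), for a distribution-valued curve *)
Definition C0_distrib_H r T (w : R -> distrib) : Prop :=
  forall t, t \in `[0, T] -> in_distrib_H r (w t) /\
    distrib_Hnorm r (fun j => w t' j - w t j) @[t' --> within `[0, T]%classic (nbhs t)]
      --> 0%E.

(* w in C^1([0, T]; H^r) with derivative w', one-sided at the end points *)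
Definition C1_distrib_H r T (w w' : R -> distrib) : Prop :=
  [/\ C0_distrib_H r T w, C0_distrib_H r T w' &
      forall t, t \in `[0, T] ->
        distrib_Hnorm r
          (fun j => ((t' - t)^-1)%:C * (w t' j - w t j) - w' t j)
          @[t' --> within `[0, T]%classic t^'] --> 0%E].

(* u in C^0([0, T]; H^s) and in C^1([0, T]; H^(s-2)) with derivative ut *)
Definition solution_class s T (u : R -> torus R d -> R[i]) (ut : R -> distrib)
    : Prop :=
  C0_H s T u /\ C1_distrib_H (s - 2) T (fun t => fourier (u t)) ut.

Definition power_nonlinearity (p : nat) f : torus R d -> R[i] :=
  fun x => (Normc.normc (f x) ^+ (2 * p))%:C * f x.

(* i u_t - Delta u +- |u|^{2p} u = 0 in the sense of distributions, for t in
   [0, T], with u(0) = u0; the sign is (-1)^sgn. *)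
Definition NLS_solution (p : nat) (sgn : bool) s T (u0 : torus R d -> R[i])
    (u : R -> torus R d -> R[i]) : Prop :=
  {ae mu, forall x, u 0 x = u0 x} /\
  exists2 ut : R -> distrib, solution_class s T u ut &
    forall t, t \in `[0, T] -> forall j,
      ('i)%C * ut t j - laplacian (fourier (u t)) j
      + (-1) ^+ sgn * fourier (power_nonlinearity p (u t)) j = 0.

Definition T_good (p : nat) (s0 s1 eps M : R) : R :=
  1 / eps ^+ (2 * p) * (1 / 2 ^+ (4 * (2 * p + 2))) *
  (2 `^ ((2 * p)%:R * (s1 - s0)) / M `^ ((2 * p)%:R * s0)).

End Sobolev.

(* Main.v *)
(* For the Fourier coefficients c_j the equation reads c_j' = i |j|^2 c_j + N(c)_j.
   The free flow is a multiplication by phases and preserves every weighted l^2 norm,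
   so only N matters.  If the l^1 norm of c is at most B, Young's inequality for
   convolutions shows that N is Lipschitz in l^2 with constant (2p+1) B^(2p), and,
   because |j+k|^s <= 2^s (|j|^s + |k|^s), that it maps H^s to itself with norm
   (2p+1) 2^(2ps) B^(2p).  Smallness of the low frequencies comes from
     (2M)^(s1) + |j|^(s1) >= (2M)^(s1-s0) max(1, |j|)^(s0):
   since max(1, |j|)^(-s0) is square summable, Cauchy-Schwarz bounds the l^1 norm by
   a multiple of eps (2M)^(s0-s1) as long as the weighted H^(s1) norm is at most
   4 eps.  Gronwall's inequality shows that this norm at most doubles on
   [0, T_good], which closes the argument; a Picard iteration, contracting by a
   factor 2 in l^2 with weight exp(-2Lt), gives existence, and the same contraction
   gives uniqueness. *)

Require Import Defs.
From HB Require Import structures.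
From mathcomp Require Import all_boot all_order all_algebra.
From mathcomp Require Import all_classical all_reals all_analysis.
From mathcomp Require Import complex.
From mathcomp Require Import measurable_realfun.
From mathcomp Require Import ring lra.
Set Implicit Arguments.
Unset Strict Implicit.
Unset Printing Implicit Defensive.
Import Order.TTheory GRing.Theory Num.Theory.
Import numFieldNormedType.Exports.
Local Open Scope classical_set_scope.
Local Open Scope ring_scope.

(** * Characters on the torus *)

(** The nonlinearity is Lipschitz only on an [l^1] ball, so the iteration must never leave that
    ball. This is built into the class in which it runs: [grows_as] demands the bound X e^(K t) for
    every weight of known growth at once, and solving the equation with a curve of this class frozen
    in the nonlinearity returns a curve of the same class. Persistence of H^s on the same interval
    for all s >= s1 then comes with the construction. The term i |j|^2 c_j is unbounded over
    frequencies. Hence derivatives are taken one coefficient at a time, on rotated coefficients, and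
    norm bounds are recovered by testing against finite sums. The dictionary between functions and
    coefficients needs completeness of the characters for uniqueness almost everywhere, and
    Riesz-Fischer for existence. As products cost 2^s, [M] is twice a number M1 with M1^s0 >= 4 sqrt
    C, where C bounds the sums of max(1, |j|)^(-2 s0); then 2^s times 4 sqrt C is at most M^s for
    all s >= s0. The 4 stands for two data terms of size eps, each doubled. *)

Lemma finite_bounded_integrable {R : realType} {dd : measure_display}
    {X : measurableType dd} (mu : {measure set X -> \bar R}) (f : X -> R) (K : R) :
  (mu setT < +oo)%E -> measurable_fun setT f -> (forall x, `|f x| <= K) ->
  mu.-integrable setT (EFin \o f).
Proof.
move=> fmu mf fK; apply: measurable_bounded_integrable => //.
exists K; split; first by rewrite num_real.
by move=> M KM x _ /=; rewrite (le_trans (fK x))// ltW.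
Qed.

Lemma bounded_integrable {R : realType} {dd : measure_display}
    {X : measurableType dd} (mu : {finite_measure set X -> \bar R}) (f : X -> R) (K : R) :
  measurable_fun setT f -> (forall x, `|f x| <= K) ->
  mu.-integrable setT (EFin \o f).
Proof.
apply: finite_bounded_integrable.
by rewrite -ge0_fin_numE// fin_num_measure.
Qed.

Section CircleIntegral.
Context {R : realType}.
Local Notation circle := (@circle_measure R).

Lemma circle_measure_setC : circle (~` `[0, 2 * pi]) = 0%E.
Proof. by rewrite /circle_measure /mrestr setICl measure0. Qed.

Lemma circle_measure_set1 (a : R) : circle [set a] = 0%E.
Proof.
apply/eqP; rewrite eq_le measure_ge0 andbT.
rewrite -(lebesgue_measure_set1 a); apply: le_measure; rewrite ?inE//=.
exact: measurableI.
Qed.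

(** Off the interval [circle] has no mass, so that part of the domain may be dropped; inside it the
    restricted measure and Lebesgue measure agree on every measurable set. *)
Lemma circle_integral (f : R -> R) (K : R) :
  measurable_fun setT f -> (forall x, `|f x| <= K) ->
  (\int[circle]_x (f x)%:E = \int[lebesgue_measure]_(x in `[0%R, (2 * pi)%R]) (f x)%:E)%E.
Proof.
move=> mf fK.
have intf := bounded_integrable circle mf fK.
have mC : measurable (~` (`[0, 2 * pi] : set (measurableTypeR R))).
  by apply: measurableC; exact: measurable_itv.
transitivity (\int[circle]_(x in setT `\` ~` `[0%R, (2 * pi)%R]) (f x)%:E)%E.
  exact: (negligible_integral mC measurableT intf circle_measure_setC).
rewrite setDE setTI setCK; apply: eq_measure_integral => A mA AI.
by rewrite /= /circle_measure /mrestr setIidl.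
Qed.

Lemma pi2_gt0 : 0 < 2 * pi :> R.
Proof. by rewrite mulr_gt0 ?pi_gt0. Qed.

Lemma circle_integral_FTC (f F : R -> R) (K : R) :
  continuous f -> (forall x, `|f x| <= K) ->
  (forall x : R, is_derive x 1 F (f x)) ->
  (\int[circle]_x f x = F (2 * pi) - F 0)%R.
Proof.
move=> cf fK dF; have mf : measurable_fun setT f.
  exact: continuous_measurable_fun.
rewrite /Rintegral (circle_integral mf fK) (continuous_FTC2 (F := F) pi2_gt0)//.
- exact: continuous_subspaceT.
- have cF : continuous F.
    by move=> x; apply: differentiable_continuous; apply/derivable1_diffP; have [] := dF x.
  split.
  + by move=> x _; have [] := dF x.
  + by apply: cvg_at_right_filter; exact: cF.
  + by apply: cvg_at_left_filter; exact: cF.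
- by move=> x _; rewrite derive1E; apply: derive_val.
Qed.

Lemma sin_int2pi (k : int) : sin (k%:~R * (2 * pi)) = 0 :> R.
Proof.
have sinn n : sin (n%:R * (2 * pi)) = 0 :> R.
  by rewrite !mulr_natl -[RHS]sin0 -(periodicn (@sinD2pi R) n 0) add0r.
by case: k => n; [exact: sinn|rewrite NegzE mulrNz mulNr sinN sinn oppr0].
Qed.

Lemma cos_int2pi (k : int) : cos (k%:~R * (2 * pi)) = 1 :> R.
Proof.
have cosn n : cos (n%:R * (2 * pi)) = 1 :> R.
  by rewrite !mulr_natl -[RHS]cos0 -(periodicn (@cosD2pi R) n 0) add0r.
by case: k => n; [exact: cosn|rewrite NegzE mulrNz mulNr cosN cosn].
Qed.

Lemma continuous_cosZ (a : R) : continuous (fun x : R => cos (a * x)).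
Proof.
move=> x; apply: continuous_comp; last exact: continuous_cos.
by apply: continuousM; [exact: cvg_cst|exact: cvg_id].
Qed.

Lemma continuous_sinZ (a : R) : continuous (fun x : R => sin (a * x)).
Proof.
move=> x; apply: continuous_comp; last exact: continuous_sin.
by apply: continuousM; [exact: cvg_cst|exact: cvg_id].
Qed.

Lemma normr_cos_le1 (x : R) : `|cos x| <= 1.
Proof. by rewrite ler_norml cos_geN1 cos_le1. Qed.

Lemma normr_sin_le1 (x : R) : `|sin x| <= 1.
Proof. by rewrite ler_norml sin_geN1 sin_le1. Qed.

Lemma circle_integral_cos (k : int) :
  (\int[circle]_x cos (k%:~R * x) = if k == 0 then 2 * pi else 0)%R.
Proof.
have bcos (a x : R) : `|cos (a * x)| <= 1 by exact: normr_cos_le1.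
have [->|k0] := eqVneq k 0.
  have dF (x : R) : is_derive x 1 (id : R -> R) (cos (0%:~R * x)).
    by rewrite mul0r cos0; exact: is_derive_id.
  by rewrite (circle_integral_FTC (@continuous_cosZ _) (bcos _) dF) subr0.
have k0R : k%:~R != 0 :> R by rewrite intr_eq0.
have dF (x : R) :
    is_derive x 1 (fun x : R => k%:~R^-1 * sin (k%:~R * x)) (cos (k%:~R * x)).
  apply: is_derive_eq.
  by rewrite /GRing.scale /= ?mulr0 ?addr0 ?add0r !mulr1; field.
rewrite (circle_integral_FTC (@continuous_cosZ _) (bcos _) dF).
by rewrite mulr0 sin0 mulr0 subr0 sin_int2pi mulr0.
Qed.

Lemma circle_integral_sin (k : int) : (\int[circle]_x sin (k%:~R * x) = 0)%R.
Proof.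
have bsin (a x : R) : `|sin (a * x)| <= 1 by exact: normr_sin_le1.
have [->|k0] := eqVneq k 0.
  have dF (x : R) : is_derive x 1 (cst 0 : R -> R) (sin (0%:~R * x)).
    by rewrite mul0r sin0; exact: is_derive_cst.
  by rewrite (circle_integral_FTC (@continuous_sinZ _) (bsin _) dF) subr0.
have k0R : k%:~R != 0 :> R by rewrite intr_eq0.
have dF (x : R) :
    is_derive x 1 (fun x : R => - k%:~R^-1 * cos (k%:~R * x)) (sin (k%:~R * x)).
  apply: is_derive_eq.
  by rewrite /GRing.scale /= ?mulr0 ?addr0 ?add0r !mulr1; field.
rewrite (circle_integral_FTC (@continuous_sinZ _) (bsin _) dF).
by rewrite mulr0 cos0 cos_int2pi subrr.
Qed.

End CircleIntegral.

(** * Fubini one coordinate at a time, and orthogonality of characters *)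

Section TorusIntegral.
Context {R : realType}.
Local Notation circle := (@circle_measure R).

(** [torus_measure] in dimension d + 1 is the image of a product measure under [torus_cons], so a
    change of variables and Fubini separate the first coordinate. The bounds on [g] and [h] supply
    all the integrability, the measures being finite. *)
Lemma torus_integral_cons d (g : R -> R) (h : torus R d -> R) (K L : R) :
  measurable_fun setT g -> (forall x, `|g x| <= K) ->
  measurable_fun setT h -> (forall x, `|h x| <= L) ->
  (\int[torus_measure R d.+1]_x (g (thead x) * h [tuple of behead x]) =
   (\int[circle]_x g x) * (\int[torus_measure R d]_x h x))%R.
Proof.
move=> mg gK mh hL.
have mF : measurable_fun setT
    (fun x : torus R d.+1 => g (thead x) * h [tuple of behead x]).
  apply: measurable_funM.
    by apply: (measurableT_comp mg); exact: measurable_tnth.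
  by apply: (measurableT_comp mh); exact: measurable_behead.
have FK x : `|g (thead x) * h [tuple of behead x]| <= K * L.
  by rewrite normrM ler_pM.
have mG : measurable_fun setT (fun z : measurableTypeR R * torus R d => g z.1 * h z.2).
  by apply: measurable_funM; [exact: (measurableT_comp mg)|exact: (measurableT_comp mh)].
have GK (z : measurableTypeR R * torus R d) : `|g z.1 * h z.2| <= K * L.
  by rewrite normrM ler_pM.
have prod_fin : ((circle \x torus_measure R d)%E setT < +oo)%E.
  rewrite -setXTT product_measure1E//.
  by rewrite lte_mul_pinfty ?measure_ge0// ?fin_num_measure// ltey_eq fin_num_measure.
rewrite /Rintegral /=.
transitivity (fine (\int[circle \x torus_measure R d]_z (g z.1 * h z.2)%:E)%E).
  congr fine.
  transitivity (\int[pushforward (circle \x torus_measure R d)%E (@torus_cons R d)]_x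
    (g (thead x) * h [tuple of behead x])%:E)%E; first by [].
  have mc := @measurable_torus_cons R d.
  rewrite (integral_pushforward mc)//=.
  - apply: eq_integral => z _ /=; congr (_ * h _)%:E.
    by apply: val_inj.
  - exact/measurable_EFinP.
  - rewrite preimage_setT.
    exact: (finite_bounded_integrable prod_fin
      (measurableT_comp mF mc) (fun x => FK (torus_cons x))).
rewrite -integral12_prod_meas1; last exact: (finite_bounded_integrable prod_fin mG GK).
rewrite /fubini_F.
transitivity (fine (\int[circle]_x ((\int[torus_measure R d]_y h y)%R * g x)%:E)%E).
  congr fine; apply: eq_integral => x _ /=.
  under eq_integral do rewrite EFinM.
  have intH := bounded_integrable (torus_measure R d) mh hL.
  rewrite integralZl// mulrC EFinM fineK//.
  exact: integrable_fin_num.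
rewrite -/(Rintegral _ _ _) RintegralZl//; first exact: mulrC.
exact: (bounded_integrable circle mg gK).
Qed.


Lemma freq_dot_cons d (j : d.+1.-tuple int) (x : torus R d.+1) :
  freq_dot j x = (thead j)%:~R * thead x
    + freq_dot [tuple of behead j] [tuple of behead x].
Proof.
rewrite /freq_dot big_ord_recl; congr (_ + _); apply: eq_bigr => i _.
rewrite !tnth_behead; congr ((tnth j _)%:~R * (tnth x _ : R)).
  by apply/val_inj; rewrite /= inordK// ltnS.
by apply/val_inj; rewrite /= inordK// ltnS.
Qed.

Lemma measurable_freq_dot d (j : d.-tuple int) :
  measurable_fun setT (@freq_dot R d j).
Proof.
apply: measurable_sum => i; apply: measurable_funM => //.
exact: measurable_tnth.
Qed.

Lemma measurable_cos_freq_dot d (j : d.-tuple int) :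
  measurable_fun setT (fun x : torus R d => cos (freq_dot j x)).
Proof.
apply: (measurableT_comp _ (measurable_freq_dot j)).
by apply: continuous_measurable_fun; exact: continuous_cos.
Qed.

Lemma measurable_sin_freq_dot d (j : d.-tuple int) :
  measurable_fun setT (fun x : torus R d => sin (freq_dot j x)).
Proof.
apply: (measurableT_comp _ (measurable_freq_dot j)).
by apply: continuous_measurable_fun; exact: continuous_sin.
Qed.

(** The addition formulas mix cosine and sine, so the induction on the dimension carries both
    integrals. It starts from the Dirac mass at the empty tuple, whose total mass 1 is the empty
    product of lengths. *)
Lemma torus_integral_cos_sin d (j : d.-tuple int) :
  (\int[torus_measure R d]_x cos (freq_dot j x) =
     if j == nseq_tuple d 0 then (2 * pi) ^+ d else 0)%R /\
  (\int[torus_measure R d]_x sin (freq_dot j x) = 0)%R.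
Proof.
elim: d j => [j|d IH j].
  have fj x : freq_dot j x = 0 :> R by rewrite /freq_dot big_ord0.
  have -> : j == nseq_tuple 0 0 by apply/eqP; rewrite [j]tuple0 [RHS]tuple0.
  split; rewrite /Rintegral; under eq_integral do rewrite fj.
    by rewrite cos0 integral_dirac// diracT mul1e expr0.
  by rewrite sin0 integral0.
have mcos := @measurable_cos_freq_dot d [tuple of behead j].
have msin := @measurable_sin_freq_dot d [tuple of behead j].
have mC (k : int) : measurable_fun setT (fun x : R => cos (k%:~R * x)).
  by apply: continuous_measurable_fun; exact: continuous_cosZ.
have mS (k : int) : measurable_fun setT (fun x : R => sin (k%:~R * x)).
  by apply: continuous_measurable_fun; exact: continuous_sinZ.
have bC (k : int) (x : R) : `|cos (k%:~R * x)| <= 1 by exact: normr_cos_le1.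
have bS (k : int) (x : R) : `|sin (k%:~R * x)| <= 1 by exact: normr_sin_le1.
have bc (x : torus R d) : `|cos (freq_dot [tuple of behead j] x)| <= 1.
  exact: normr_cos_le1.
have bs (x : torus R d) : `|sin (freq_dot [tuple of behead j] x)| <= 1.
  exact: normr_sin_le1.
have [IHc IHs] := IH [tuple of behead j].
have mp (g : R -> R) (h : torus R d -> R) : measurable_fun setT g -> measurable_fun setT h ->
   measurable_fun setT (fun x : torus R d.+1 => g (thead x) * h [tuple of behead x]).
  move=> mg mh; apply: measurable_funM.
    by apply: (measurableT_comp mg); exact: measurable_tnth.
  by apply: (measurableT_comp mh); exact: measurable_behead.
have ip (g : R -> R) (h : torus R d -> R) : measurable_fun setT g -> measurable_fun setT h ->
    (forall x, `|g x| <= 1) -> (forall x, `|h x| <= 1) ->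
   (torus_measure R d.+1).-integrable setT
     (EFin \o (fun x : torus R d.+1 => g (thead x) * h [tuple of behead x])).
  move=> mg mh bg bh; apply: (bounded_integrable (torus_measure R d.+1) (mp _ _ mg mh) (K := 1)).
  by move=> x; rewrite normrM mulr_ile1.
have prodE := fun g mg bg h mh bh => @torus_integral_cons d g h 1 1 mg bg mh bh.
split.
  transitivity (\int[torus_measure R d.+1]_x
    (cos ((thead j)%:~R * thead x) * cos (freq_dot [tuple of behead j] [tuple of behead x])
    - sin ((thead j)%:~R * thead x) * sin (freq_dot [tuple of behead j] [tuple of behead x])))%R.
    by apply: eq_Rintegral => x _; rewrite freq_dot_cons cosD.
  rewrite RintegralB//; [|exact: (ip _ _ (mC _) mcos)|exact: (ip _ _ (mS _) msin)].
  rewrite (prodE _ (mC _) (bC _) _ mcos bc) (prodE _ (mS _) (bS _) _ msin bs).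
  rewrite circle_integral_cos circle_integral_sin mul0r subr0 IHc.
  have -> : (j == nseq_tuple d.+1 0) =
      (thead j == 0) && ([tuple of behead j] == nseq_tuple d 0).
    case/tupleP: j {IHc IHs mcos msin bc bs} => a t.
    have -> : [tuple of behead [tuple of a :: t]] = t by apply: val_inj.
    by rewrite theadE -!val_eqE /= eqseq_cons.
  case: (thead j == 0) => /=; last by rewrite mul0r.
  by case: ifP => _; rewrite ?mulr0 ?exprS.
transitivity (\int[torus_measure R d.+1]_x
    (sin ((thead j)%:~R * thead x) * cos (freq_dot [tuple of behead j] [tuple of behead x])
    + cos ((thead j)%:~R * thead x) * sin (freq_dot [tuple of behead j] [tuple of behead x])))%R.
  by apply: eq_Rintegral => x _; rewrite freq_dot_cons sinD.
rewrite RintegralD//; [|exact: (ip _ _ (mS _) mcos)|exact: (ip _ _ (mC _) msin)].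
rewrite (prodE _ (mS _) (bS _) _ mcos bc) (prodE _ (mC _) (bC _) _ msin bs).
by rewrite circle_integral_sin IHs mul0r mulr0 addr0.
Qed.

(** Allows a coordinate to be taken in [0, 2 pi[ when functions on the torus are compared almost
    everywhere. *)
Lemma torus_measure_null_coord d (i : 'I_d) (N : set (measurableTypeR R)) :
  measurable N -> circle N = 0%E ->
  torus_measure R d ((fun x => tnth x i) @^-1` N) = 0%E.
Proof.
move=> mN N0; elim: d i => [[]//|d IH i].
transitivity ((circle \x torus_measure R d)%E
    (@torus_cons R d @^-1` ((fun x => tnth x i) @^-1` N))); first by [].
have [->|i0] := eqVneq i ord0.
  rewrite (_ : _ @^-1` _ = N `*` setT); first
    by rewrite product_measure1E// [X in (X * _)%E]N0 mul0e.
  by apply/seteqP; split=> [z Nz|z [Nz _]] //; split.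
have [k ->] : exists k : 'I_d, i = lift ord0 k.
  by case: (unliftP ord0 i) i0 => [k ->|->]; [exists k|rewrite eqxx].
rewrite (_ : _ @^-1` _ = setT `*` ((fun x => tnth x k) @^-1` N)).
  rewrite product_measure1E//; first by rewrite [X in (_ * X)%E](IH k) mule0.
  by rewrite -[X in measurable X]setTI; exact: (measurable_tnth k).
by apply/seteqP; split=> [z|z []]; rewrite /= /torus_cons ?tnthS.
Qed.

End TorusIntegral.

(** * Integrable functions with zero Fourier coefficients vanish *)

Section ArcLimit.
Context {R : realType}.
Implicit Types (a r y : R) (n : nat).

Lemma onem_expr_ge a n : 0 <= a -> a <= 1 -> 1 - n%:R * a <= (1 - a) ^+ n.
Proof.
move=> a0 a1; elim: n => [|n IH]; first by rewrite expr0 mul0r subr0.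
rewrite exprS (le_trans _ (ler_wpM2l _ IH)) ?subr_ge0//.
have : 0 <= n%:R * (a * a) by rewrite !mulr_ge0.
by rewrite -natr1; nra.
Qed.

(** A division-free form of (1 - a)^n <= 1 / (1 + n a): each new factor 1 - a more than pays for the
    growth of the second factor. *)
Lemma onem_expr_le a n : 0 <= a -> a <= 1 -> (1 - a) ^+ n * (1 + n%:R * a) <= 1.
Proof.
move=> a0 a1; elim: n => [|n IH]; first by rewrite expr0 mul0r addr0 mul1r.
apply: le_trans IH; rewrite exprSr -mulrA ler_wpM2l ?exprn_ge0 ?subr_ge0//.
have : 0 <= n%:R * (a * a) by rewrite !mulr_ge0.
by rewrite -natr1; nra.
Qed.

(** With q the square root of r, the preceding inequality keeps n q^n bounded, and the spare factor
    q^n tends to 0. *)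
Lemma cvg_natM_expr r : 0 <= r -> r < 1 -> (fun n => n%:R * r ^+ n) @ \oo --> (0 : R).
Proof.
move=> r0 r1; set q := Num.sqrt r.
have q0 : 0 <= q by exact: sqrtr_ge0.
have q1 : q < 1 by rewrite -sqrtr1 ltr_sqrt.
have qq : q ^+ 2 = r by rewrite sqr_sqrtr.
have q1' : 0 < 1 - q by rewrite subr_gt0.
have bnd n : n%:R * q ^+ n <= (1 - q)^-1.
  rewrite -[leRHS]mul1r ler_pdivlMr// mulrAC.
  have := @onem_expr_le (1 - q) n (ltW q1').
  rewrite gerBl q0 subKr => /(_ isT); rewrite mulrDr mulr1 => H.
  have : 0 <= q ^+ n by rewrite exprn_ge0.
  by move: H; lra.
apply: (squeeze_cvgr (f := fun=> 0) (h := fun n => (1 - q)^-1 * q ^+ n)).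
- near=> n; rewrite mulr_ge0//= ?exprn_ge0//=.
  by rewrite -qq -exprM mulnC exprM expr2 mulrA ler_wpM2r// exprn_ge0.
- exact: cvg_cst.
- rewrite -[X in _ --> X](mulr0 (1 - q)^-1); apply: cvgMr.
  by apply: cvg_expr; rewrite ger0_norm.
Unshelve. all: by end_near. Qed.

(* If [y] is an affine function of [cos (x_i - c)], this limit is the indicator of
   an arc of the [i]-th circle, approximated by trigonometric polynomials. *)
Lemma arc_limit y : 0 <= y -> y <= 1 ->
  (fun n => (1 - y ^+ n) ^+ (n * 2 ^ n)) @ \oo --> ((y < 2^-1)%R%:R : R).
Proof.
move=> y0 y1; have yn0 n : 0 <= y ^+ n by rewrite exprn_ge0.
have yn1 n : y ^+ n <= 1 by rewrite exprn_ile1.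
(* By the two Bernoulli bounds everything depends on n 2^n y^n = n (2 y)^n: it tends to 0 when y <
   1/2 and is at least n otherwise. *)
have [ylt|yge] := ltP y 2^-1 => /=.
  apply: (squeeze_cvgr (f := fun n => 1 - n%:R * (2 * y) ^+ n) (h := fun=> 1)).
  - near=> n; rewrite exprn_ile1 ?subr_ge0 ?gerBl// andbT.
    apply: le_trans (onem_expr_ge _ (yn0 n) (yn1 n)).
    by rewrite natrM natrX exprMn mulrA.
  - rewrite -[X in _ --> X](subr0 1); apply: cvgB; first exact: cvg_cst.
    by apply: cvg_natM_expr; lra.
  - exact: cvg_cst.
apply: (squeeze_cvgr (f := fun=> 0) (h := harmonic)).
- near=> n; rewrite exprn_ge0 ?subr_ge0//=.
  rewrite -[leRHS]mul1r ler_pdivlMr//.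
  apply: le_trans (onem_expr_le (n * 2 ^ n) (yn0 n) (yn1 n)).
  rewrite ler_wpM2l ?exprn_ge0 ?subr_ge0// -natr1 addrC lerD2l.
  rewrite natrM natrX -mulrA -exprMn ler_peMr// exprn_ege1//; lra.
- exact: cvg_cst.
- exact: cvg_harmonic.
Unshelve. all: by end_near. Qed.

End ArcLimit.

Section FrequencyGroup.
Context {d : nat}.
Implicit Types (j k : d.-tuple int).

Definition freq_opp j : d.-tuple int := [tuple - tnth j i | i < d].
Definition freq_add j k : d.-tuple int := [tuple tnth j i + tnth k i | i < d].

Lemma freq_addC : commutative freq_add.
Proof. by move=> j k; apply: eq_from_tnth => i; rewrite !tnth_mktuple addrC. Qed.

Lemma freq_oppK : involutive freq_opp.
Proof. by move=> j; apply: eq_from_tnth => i; rewrite !tnth_mktuple opprK. Qed.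

Lemma freq_addK j k : freq_add (freq_add j k) (freq_opp k) = j.
Proof. by apply: eq_from_tnth => i; rewrite !tnth_mktuple addrK. Qed.

Lemma freq_subK j k : freq_add (freq_add j (freq_opp k)) k = j.
Proof. by apply: eq_from_tnth => i; rewrite !tnth_mktuple subrK. Qed.

Lemma freq_sub_eq0 j k : (freq_add j (freq_opp k) == nseq_tuple d 0) = (j == k).
Proof.
apply/eqP/eqP => [E|->].
  apply: eq_from_tnth => i; apply/eqP; rewrite -subr_eq0.
  have /(congr1 (fun t => tnth t i)) := E.
  by rewrite !tnth_mktuple tnth_nseq => ->.
by apply: eq_from_tnth => i; rewrite !tnth_mktuple tnth_nseq subrr.
Qed.

Context {R : realType}.

Lemma freq_dotD j k (x : torus R d) :
  freq_dot (freq_add j k) x = freq_dot j x + freq_dot k x.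
Proof.
rewrite /freq_dot -big_split; apply: eq_bigr => i _ /=.
by rewrite tnth_mktuple intrD mulrDl.
Qed.

Lemma freq_dotN j (x : torus R d) : freq_dot (freq_opp j) x = - freq_dot j x.
Proof.
rewrite /freq_dot -sumrN; apply: eq_bigr => i _ /=.
by rewrite tnth_mktuple mulrNz mulNr.
Qed.

End FrequencyGroup.

Section Annihilator.
Context {R : realType} {d : nat}.
Local Notation mu := (torus_measure R d).
Variable f : torus R d -> R.
Hypothesis intf : mu.-integrable setT (EFin \o f).

(* [g] is annihilated when [f g] is orthogonal to every character.  Multiplication
   by [h] preserves this when [h] is a trigonometric polynomial, hence when it is a
   bounded limit of such, hence when it is the indicator of a Borel set; as [g = 1]
   is annihilated, the integral of [f] over every Borel set vanishes. *)
Definition bounded_measurable (g : torus R d -> R) :=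
  measurable_fun setT g /\ exists K, forall x, `|g x| <= K.

Definition annihilated (g : torus R d -> R) := bounded_measurable g /\
  forall j, (\int[mu]_x (f x * (g x * cos (freq_dot j x))) = 0)%R /\
            (\int[mu]_x (f x * (g x * sin (freq_dot j x))) = 0)%R.

Definition multiplies (h : torus R d -> R) :=
  forall g, annihilated g -> annihilated (fun x => g x * h x).

Lemma integrableM_bounded g : bounded_measurable g ->
  mu.-integrable setT (EFin \o (fun x => f x * g x)).
Proof.
move=> [mg [K gK]].
rewrite (_ : _ \o _ = (EFin \o g) \* (EFin \o f))%E; last first.
  by apply/funext => x /=; rewrite mulrC EFinM.
apply: integrableMr => //.
exists K; split; first by rewrite num_real.
by move=> M KM x _ /=; rewrite (le_trans (gK x))// ltW.
Qed.

Lemma bounded_measurableM g h : bounded_measurable g -> bounded_measurable h ->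
  bounded_measurable (fun x => g x * h x).
Proof.
move=> [mg [K gK]] [mh [L hL]]; split; first exact: measurable_funM.
by exists (K * L) => x; rewrite normrM ler_pM.
Qed.

Lemma bounded_measurableD g h : bounded_measurable g -> bounded_measurable h ->
  bounded_measurable (fun x => g x + h x).
Proof.
move=> [mg [K gK]] [mh [L hL]]; split; first exact: measurable_funD.
by exists (K + L) => x; rewrite (le_trans (ler_normD _ _))// lerD.
Qed.

Lemma bounded_measurable_cst (c : R) : bounded_measurable (fun=> c).
Proof. by split; [exact: measurable_cst|exists `|c|]. Qed.

Lemma bounded_measurable_cos j : bounded_measurable (fun x => cos (freq_dot j x)).
Proof.
split; first exact: measurable_cos_freq_dot.
by exists 1 => x; exact: normr_cos_le1.
Qed.

Lemma bounded_measurable_sin j : bounded_measurable (fun x => sin (freq_dot j x)).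
Proof.
split; first exact: measurable_sin_freq_dot.
by exists 1 => x; exact: normr_sin_le1.
Qed.

Lemma integrableZM_bounded c g h : bounded_measurable g -> bounded_measurable h ->
  mu.-integrable setT (EFin \o (fun x => c * (f x * (g x * h x)))).
Proof.
move=> bg bh; rewrite (_ : (fun x => _) = (fun x => f x * (g x * h x * c))); last first.
  by apply/funext => x; ring.
apply: integrableM_bounded; apply: bounded_measurableM (bounded_measurable_cst c).
exact: bounded_measurableM.
Qed.

Lemma annihilatedD g h : annihilated g -> annihilated h ->
  annihilated (fun x => g x + h x).
Proof.
move=> [bg ag] [bh ah]; split; first exact: bounded_measurableD.
have D (e : torus R d -> R) : bounded_measurable e ->
    (\int[mu]_x (f x * ((g x + h x) * e x)) =
     \int[mu]_x (f x * (g x * e x)) + \int[mu]_x (f x * (h x * e x)))%R.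
  move=> be; rewrite -RintegralD//; [|exact/integrableM_bounded/bounded_measurableM..].
  by apply: eq_Rintegral => x _; ring.
move=> j; rewrite !D; [|exact: bounded_measurable_sin|exact: bounded_measurable_cos].
by have [-> ->] := ag j; have [-> ->] := ah j; rewrite addr0.
Qed.

Lemma annihilatedZ (c : R) g : annihilated g -> annihilated (fun x => g x * c).
Proof.
move=> [bg ag]; split.
  exact: bounded_measurableM (bounded_measurable_cst c).
have D (e : torus R d -> R) : bounded_measurable e ->
    (\int[mu]_x (f x * ((g x * c) * e x)) = c * \int[mu]_x (f x * (g x * e x)))%R.
  move=> be; rewrite -RintegralZl//; [|exact/integrableM_bounded/bounded_measurableM].
  by apply: eq_Rintegral => x _; ring.
move=> j; rewrite !D; [|exact: bounded_measurable_sin|exact: bounded_measurable_cos].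
by have [-> ->] := ag j; rewrite mulr0.
Qed.

Lemma eq_annihilated g h : g =1 h -> annihilated g -> annihilated h.
Proof. by move=> /funext ->. Qed.

Lemma eq_multiplies g h : g =1 h -> multiplies g -> multiplies h.
Proof. by move=> /funext ->. Qed.

(** Product-to-sum formulas: multiplying by this cosine only moves the test frequency j to j + k and
    j - k, and all test frequencies are allowed. *)
Lemma multiplies_cos k : multiplies (fun x => cos (freq_dot k x)).
Proof.
move=> g [bg ag]; have bc := bounded_measurable_cos; have bs := bounded_measurable_sin.
split; first exact: bounded_measurableM (bc k).
have I c (e : torus R d -> R) : bounded_measurable e ->
   mu.-integrable setT (EFin \o (fun x => c * (f x * (g x * e x)))).
  exact: integrableZM_bounded.
have I' (e : torus R d -> R) : bounded_measurable e ->
   mu.-integrable setT (EFin \o (fun x => f x * (g x * e x))).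
  by move=> be; apply/integrableM_bounded/bounded_measurableM.
move=> j; split.
  transitivity (\int[mu]_x (2^-1 * (f x * (g x * cos (freq_dot (freq_add j k) x)))
    + 2^-1 * (f x * (g x * cos (freq_dot (freq_add j (freq_opp k)) x)))))%R.
    apply: eq_Rintegral => x _; rewrite !freq_dotD freq_dotN !cosD cosN sinN; by field.
  rewrite RintegralD//; [|exact/I|exact/I].
  rewrite !RintegralZl//; [|exact/I'|exact/I'].
  by rewrite !(ag _).1 mulr0 addr0.
transitivity (\int[mu]_x (2^-1 * (f x * (g x * sin (freq_dot (freq_add j k) x)))
    + 2^-1 * (f x * (g x * sin (freq_dot (freq_add j (freq_opp k)) x)))))%R.
  apply: eq_Rintegral => x _; rewrite !freq_dotD freq_dotN !sinD cosN sinN; by field.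
rewrite RintegralD//; [|exact/I|exact/I].
rewrite !RintegralZl//; [|exact/I'|exact/I'].
by rewrite !(ag _).2 mulr0 addr0.
Qed.

Lemma multiplies_sin k : multiplies (fun x => sin (freq_dot k x)).
Proof.
move=> g [bg ag]; have bc := bounded_measurable_cos; have bs := bounded_measurable_sin.
split; first exact: bounded_measurableM (bs k).
have I c (e : torus R d -> R) : bounded_measurable e ->
   mu.-integrable setT (EFin \o (fun x => c * (f x * (g x * e x)))).
  exact: integrableZM_bounded.
have I' (e : torus R d -> R) : bounded_measurable e ->
   mu.-integrable setT (EFin \o (fun x => f x * (g x * e x))).
  by move=> be; apply/integrableM_bounded/bounded_measurableM.
move=> j; split.
  transitivity (\int[mu]_x (2^-1 * (f x * (g x * sin (freq_dot (freq_add j k) x)))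
    + (- 2^-1) * (f x * (g x * sin (freq_dot (freq_add j (freq_opp k)) x)))))%R.
    apply: eq_Rintegral => x _; rewrite !freq_dotD freq_dotN !sinD cosN sinN; by field.
  rewrite RintegralD//; [|exact/I|exact/I].
  rewrite !RintegralZl//; [|exact/I'|exact/I'].
  by rewrite !(ag _).2 !mulr0 addr0.
transitivity (\int[mu]_x ((- 2^-1) * (f x * (g x * cos (freq_dot (freq_add j k) x)))
    + 2^-1 * (f x * (g x * cos (freq_dot (freq_add j (freq_opp k)) x)))))%R.
  apply: eq_Rintegral => x _; rewrite !freq_dotD freq_dotN !cosD cosN sinN; by field.
rewrite RintegralD//; [|exact/I|exact/I].
rewrite !RintegralZl//; [|exact/I'|exact/I'].
by rewrite !(ag _).1 !mulr0 addr0.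
Qed.

Lemma multiplies_cst (c : R) : multiplies (fun=> c).
Proof. by move=> g; exact: annihilatedZ. Qed.

Lemma multipliesD h h' : multiplies h -> multiplies h' ->
  multiplies (fun x => h x + h' x).
Proof.
move=> mh mh' g ag; apply: eq_annihilated (annihilatedD (mh _ ag) (mh' _ ag)) => x.
by rewrite mulrDr.
Qed.

Lemma multipliesM h h' : multiplies h -> multiplies h' ->
  multiplies (fun x => h x * h' x).
Proof.
move=> mh mh' g ag; apply: eq_annihilated (mh' _ (mh _ ag)) => x.
by rewrite mulrA.
Qed.

Lemma multipliesX h n : multiplies h -> multiplies (fun x => h x ^+ n).
Proof.
move=> mh; elim: n => [|n IH]; first exact: multiplies_cst.
rewrite (_ : (fun x => _) = (fun x => h x * h x ^+ n)); first exact: multipliesM.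
by apply/funext => x; rewrite exprS.
Qed.

(** Needed because a ray in one coordinate agrees with an arc of the circle only off a null set. *)
Lemma multiplies_ae h h' (N : set (torus R d)) : measurable N -> mu N = 0%E ->
  (forall x, ~ N x -> h x = h' x) -> bounded_measurable h' ->
  multiplies h -> multiplies h'.
Proof.
move=> mN N0 hh' bh' mh g ag; have [[bg _]] := (ag, mh _ ag).
have [bgh agh] := mh _ ag => _.
have bgh' := bounded_measurableM bg bh'.
split => // j.
have E (e : torus R d -> R) : bounded_measurable e ->
    (\int[mu]_x (f x * (g x * h' x * e x)) = \int[mu]_x (f x * (g x * h x * e x)))%R.
  move=> be; congr fine; apply: ae_eq_integral => //.
  - exact: (measurable_int mu (integrableM_bounded (bounded_measurableM bgh' be))).
  - exact: (measurable_int mu (integrableM_bounded (bounded_measurableM bgh be))).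
  - exists N; split=> // x /= nE; apply: contrapT => Nx; apply: nE => _.
    by rewrite hh'.
rewrite !E; [exact: agh|exact: bounded_measurable_sin|exact: bounded_measurable_cos].
Qed.

(** Dominated convergence: the uniform bound [K] provides an integrable majorant, and the limit
    inherits both measurability and the bound. *)
Lemma multiplies_lim (h_ : nat -> torus R d -> R) h (K : R) :
  (forall n, multiplies (h_ n)) -> (forall n, measurable_fun setT (h_ n)) ->
  (forall n x, `|h_ n x| <= K) -> (forall x, h_ ^~ x @ \oo --> h x) ->
  multiplies h.
Proof.
move=> mh mf_ bK cvgh g ag; have [bg _] := ag.
have mh_ : measurable_fun setT h by apply: (measurable_fun_cvg mf_) => x _; exact: cvgh.
have bh : bounded_measurable h.
  split => //; exists K => x.
  have cn : (fun n => `|h_ n x|) @ \oo --> `|h x|.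
    by apply: cvg_norm; exact: cvgh.
  rewrite -(cvg_lim (@Rhausdorff R) cn); apply: limr_le; first by apply/cvg_ex; exists `|h x|.
  exact: nearW.
have bgh := bounded_measurableM bg bh.
split => // j.
have E (e : torus R d -> R) : bounded_measurable e ->
    (forall n, \int[mu]_x (f x * (g x * h_ n x * e x)) = 0)%R ->
    (\int[mu]_x (f x * (g x * h x * e x)) = 0)%R.
  move=> be zn.
  have bge := bounded_measurableM bg be.
  have bn n : bounded_measurable (h_ n) by split => //; exists K.
  have int_n n : mu.-integrable setT (EFin \o (fun x => f x * (g x * h_ n x * e x))).
    by apply: integrableM_bounded; do 2! apply: bounded_measurableM => //.
  have intl : mu.-integrable setT (EFin \o (fun x => f x * (g x * h x * e x))).
    by apply: integrableM_bounded; apply: bounded_measurableM.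
  have intd : mu.-integrable setT (fun x => `| (f x * (g x * e x * K))%:E |)%E.
    apply: integrable_abse; apply: integrableM_bounded.
    by apply: bounded_measurableM => //; exact: bounded_measurable_cst.
  have [||_ _] := @dominated_convergence _ _ _ mu setT measurableT
    (fun n => EFin \o (fun x => f x * (g x * h_ n x * e x)))
    (EFin \o (fun x => f x * (g x * h x * e x)))
    (fun x => `| (f x * (g x * e x * K))%:E |)%E
    (fun n => measurable_int mu (int_n n)) (measurable_int mu intl) _ intd.
  - apply: aeW => x _ /=; apply: cvg_EFin; first exact: nearW.
    apply: cvgMr; apply: cvgMl; apply: cvgMr; exact: cvgh.
  - apply: aeW => x n _ /=; rewrite lee_fin !normrM.
    rewrite -!mulrA; apply: ler_wpM2l => //; apply: ler_wpM2l => //.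
    rewrite mulrC; apply: ler_wpM2l => //.
    by rewrite (le_trans (bK n x))// ler_norm.
  - have S : (fun n => (\int[mu]_x (f x * (g x * h_ n x * e x))%:E)%E) = (fun=> 0%E).
      apply/funext => n /=; rewrite -[LHS]fineK; first by rewrite [fine _]zn.
      exact: (integrable_fin_num measurableT (int_n n)).
    rewrite /= S => c0; have E := cvg_unique _ c0 (cvg_cst 0%E).
    by rewrite /Rintegral E.
have zn := fun n => (mh n _ ag).2 j.
split; apply: E.
- exact: bounded_measurable_cos.
- by move=> n; exact: (zn n).1.
- exact: bounded_measurable_sin.
- by move=> n; exact: (zn n).2.
Qed.

Hypothesis f_cos : forall j, (\int[mu]_x (f x * cos (freq_dot j x)) = 0)%R.
Hypothesis f_sin : forall j, (\int[mu]_x (f x * sin (freq_dot j x)) = 0)%R.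

Lemma annihilated1 : annihilated (fun=> 1).
Proof.
split=> [|j]; first exact: bounded_measurable_cst.
by split; under eq_Rintegral do rewrite mul1r.
Qed.

Lemma freq_dot_delta (i : 'I_d) (x : torus R d) :
  freq_dot [tuple (k == i)%:Z | k < d] x = tnth x i.
Proof.
rewrite /freq_dot (bigD1 i)//= tnth_mktuple eqxx mul1r big1 ?addr0// => k ki.
by rewrite tnth_mktuple (negbTE ki) mul0r.
Qed.

Lemma multiplies_arc (i : 'I_d) (c h : R) :
  multiplies (fun x => ((cos h < cos (tnth x i - c))%R%:R : R)).
Proof.
(* For h in [0, pi], [y] is below 1/2 exactly on the open arc with centre c and half-width h; the
   factor 1/4 keeps it in [0, 1], as two cosines differ by at most 2. *)
pose y (x : torus R d) : R := 2^-1 - (cos (tnth x i - c) - cos h) * 4^-1.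
have yE : y = fun x => (2^-1 + cos h * 4^-1)
    + (- (cos c * 4^-1) * cos (freq_dot [tuple (k == i)%:Z | k < d] x)
    + - (sin c * 4^-1) * sin (freq_dot [tuple (k == i)%:Z | k < d] x)).
  by apply/funext => x; rewrite freq_dot_delta /y cosB; ring.
have by_ : bounded_measurable y.
  rewrite yE; apply: bounded_measurableD; first exact: bounded_measurable_cst.
  apply: bounded_measurableD; apply: bounded_measurableM;
    first [exact: bounded_measurable_cst|exact: bounded_measurable_cos
      |exact: bounded_measurable_sin].
have my : multiplies y.
  rewrite yE; apply: multipliesD; first exact: multiplies_cst.
  apply: multipliesD; apply: multipliesM;
    first [exact: multiplies_cst|exact: multiplies_cos|exact: multiplies_sin].
have cb (t : R) := conj (cos_geN1 t) (cos_le1 t).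
have y0 x : 0 <= y x by have := cb (tnth x i - c); have := cb h; rewrite /y; lra.
have y1 x : y x <= 1 by have := cb (tnth x i - c); have := cb h; rewrite /y; lra.
have yn0 x n : 0 <= y x ^+ n by rewrite exprn_ge0.
have yn1 x n : y x ^+ n <= 1 by rewrite exprn_ile1.
apply: (@multiplies_lim (fun n x => (1 - y x ^+ n) ^+ (n * 2 ^ n)) _ 1).
- move=> n; apply: multipliesX.
  rewrite (_ : (fun x => _) = (fun x => 1 + y x ^+ n * (-1))); last first.
    by apply/funext => x; rewrite mulrN1.
  apply: multipliesD; first exact: multiplies_cst.
  apply: multipliesM; [exact: multipliesX|exact: multiplies_cst].
- move=> n; apply: measurable_funX; apply: measurable_funB => //.
  by apply: measurable_funX; exact: by_.1.
- move=> n x; rewrite ger0_norm ?exprn_ge0 ?subr_ge0//.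
  by rewrite exprn_ile1// ?subr_ge0// gerBl.
- move=> x; have := arc_limit (y0 x) (y1 x).
  by rewrite (_ : (y x < 2^-1) = (cos h < cos (tnth x i - c)))// /y; lra.
Qed.

Definition multiplier_set (A : set (torus R d)) :=
  measurable A /\ multiplies (\1_A : torus R d -> R).

Lemma bounded_measurable_indic (A : set (torus R d)) :
  measurable A -> bounded_measurable (\1_A : torus R d -> R).
Proof.
move=> mA; split; first exact: measurable_indic.
by exists 1 => x; rewrite indicE; case: (_ \in _); rewrite ?normr1 ?normr0.
Qed.

(** Complements correspond to 1 minus the indicator. For a countable union, the indicator of its
    complement is the limit of the finite products of the indicators of the complements, all bounded
    by 1, so [multiplies_lim] applies. *)
Lemma sigma_algebra_multiplier_set : sigma_algebra setT multiplier_set.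
Proof.
have mC A : multiplier_set A -> multiplier_set (setT `\` A).
  move=> [mA mulA]; split; first exact: measurableD.
  rewrite (_ : \1_(_) = (fun x => 1 + \1_A x * (-1))).
    by apply: multipliesD; [|apply: multipliesM => //]; exact: multiplies_cst.
  apply/funext => x; rewrite !indicE in_setD in_setT /=.
  by case: (x \in A); rewrite mulrN1 ?subrr ?subr0.
split=> [| |F mF].
- by split => //; rewrite indic0; exact: multiplies_cst.
- exact: mC.
have mU : measurable (\bigcup_k F k) by apply: bigcupT_measurable => k; exact: (mF k).1.
suff mI : multiplies (\1_(setT `\` \bigcup_k F k) : torus R d -> R).
  rewrite -[X in multiplier_set X]setCK -!setTD; apply: mC; split => //.
  exact: measurableD.
apply: (@multiplies_lim (fun n x => \prod_(i < n) (\1_(setT `\` F i) x : R)) _ 1).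
- elim=> [|n IH].
    by apply: (eq_multiplies (g := fun=> 1)); [move=> x; rewrite big_ord0|exact: multiplies_cst].
  apply: (eq_multiplies (g := fun x => \prod_(i < n) (\1_(setT `\` F i) x : R)
     * \1_(setT `\` F n) x)); first by move=> x; rewrite big_ord_recr.
  by apply: multipliesM => //; have [] := mC _ (mF n).
- move=> n; apply: measurable_prod => i _; apply: measurable_indic.
  by have [] := mC _ (mF i).
- move=> n x; rewrite normr_prod.
  suff /andP[_ ->] : 0 <= \prod_(i < n) `|\1_(setT `\` F i) x : R| <= 1 by [].
  apply: (big_ind (fun r : R => 0 <= r <= 1)) => [|a b /andP[a0 a1] /andP[b0 b1]|i _].
  + by rewrite ler01 lexx.
  + by rewrite mulr_ge0//= mulr_ile1.
  + by rewrite indicE; case: (_ \in _); rewrite ?normr1 ?normr0 ?lexx ?ler01.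
- move=> x; apply: cvg_near_cst.
  have [[k _ Fk]|nF] := pselect ((\bigcup_k F k) x).
    near=> n; have kn : (k < n)%N by near: n; exact: nbhs_infty_gt.
    rewrite (bigD1 (Ordinal kn))//= !indicE !in_setD !in_setT /=.
    by rewrite (mem_set Fk) mul0r mem_set//; exists k.
  near=> n; rewrite big1 => [|i _].
    by rewrite indicE mem_set//; split.
  by rewrite indicE mem_set//; split => // Fi; apply: nF; exists i.
Unshelve. all: by end_near. Qed.

(** Up to a null set the coordinate runs over [0, 2 pi[, where the ray is everything, empty, or the
    arc from a to 2 pi, which has centre (2 pi + a) / 2 and half-width (2 pi - a) / 2. *)
Lemma multiplier_set_ray (i : 'I_d) (a : R) :
  multiplier_set ((fun x => tnth x i) @^-1` `]a, +oo[).
Proof.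
have mA : measurable ((fun x : torus R d => tnth x i) @^-1` `]a, +oo[).
  by rewrite -[X in measurable X]setTI; apply: (measurable_tnth i).
split => //.
pose N : set (measurableTypeR R) := ~` `[0, 2 * pi] `|` [set 2 * pi].
have mN : measurable N.
  by apply: measurableU => //; apply: measurableC; exact: measurable_itv.
have N0 : circle_measure N = 0%E.
  apply/eqP; rewrite eq_le measure_ge0 andbT.
  rewrite (le_trans (measureU2 _ _ _))//; first by apply: measurableC; exact: measurable_itv.
  by rewrite [X in (X + _)%E]circle_measure_setC [X in (_ + X)%E]circle_measure_set1 adde0.
have mNi : measurable ((fun x : torus R d => tnth x i) @^-1` N).
  by rewrite -[X in measurable X]setTI; exact: (measurable_tnth i).
have muNi := torus_measure_null_coord i mN N0.
have NE (t : R) : ~ N t -> 0 <= t < 2 * pi.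
  move=> /not_orP[/contrapT /= t02 /eqP t2]; move: t02.
  by rewrite in_itv/= => /andP[-> tle]; rewrite lt_neqAle t2.
pose h : R := (2 * pi - a) / 2; pose c : R := (2 * pi + a) / 2.
have [a0|a0] := ltP a 0.
  apply: (multiplies_ae (h := fun=> 1) mNi muNi _ (bounded_measurable_indic mA)).
    move=> x /NE /andP[x0 _]; rewrite indicE mem_set//= in_itv/= andbT.
    exact: lt_le_trans a0 x0.
  exact: multiplies_cst.
have [a2|a2] := leP (2 * pi) a.
  apply: (multiplies_ae (h := fun=> 0) mNi muNi _ (bounded_measurable_indic mA)).
    move=> x /NE /andP[_ x2]; rewrite indicE memNset//= in_itv/= andbT.
    by apply/negP; rewrite -leNgt (le_trans (ltW x2)).
  exact: multiplies_cst.
apply: (multiplies_ae mNi muNi _ (bounded_measurable_indic mA) (multiplies_arc i c h)).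
move=> x /NE /andP[x0 x2]; rewrite indicE; congr ((nat_of_bool _)%:R : R).
have -> : (x \in (fun x : torus R d => tnth x i) @^-1` `]a, +oo[) = (a < tnth x i).
  by apply/idP/idP; rewrite inE /= in_itv/= andbT.
move: (tnth x i : R) x0 x2 => t x0 x2.
have hI : h \in `[0, pi] by rewrite in_itv/= /h; lra.
have [at_|ta] := ltP a t.
  have tI : `|t - c| \in `[0, pi].
    by rewrite in_itv/= normr_ge0/= ler_norml /c; lra.
  have -> : cos (t - c) = cos `|t - c|.
    have [tc|tc] := leP 0 (t - c); first by rewrite ger0_norm.
    by rewrite ltr0_norm// cosN.
  by apply/idP; rewrite ltr_cos// ltr_norml /c /h; lra.
apply/negbTE; rewrite -[cos (t - c)]cosN opprB.
have [le_pi|gt_pi] := leP (c - t) pi.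
  have cI : c - t \in `[0, pi] by move: le_pi; rewrite in_itv/= /c => ?; lra.
  by rewrite ltr_cos// -leNgt /c /h; lra.
(* Cosine is monotone only on [0, pi], so a distance c - t beyond pi is replaced by the
   complementary distance around the circle. *)
have <- : cos (2 * pi - (c - t)) = cos (c - t).
  by rewrite -cosN opprB -(cosD2pi (c - t - 2 * pi)) -[pi *+ 2]mulr_natl subrK.
have cI : 2 * pi - (c - t) \in `[0, pi] by move: gt_pi; rewrite in_itv/= /c => ?; lra.
by rewrite ltr_cos// -leNgt /c /h; lra.
Qed.

(** Two layers of generation: measurable sets of tuples are generated by preimages under the
    coordinates, and Borel sets of the line by open rays. *)
Lemma multiplier_set_measurable (A : set (torus R d)) :
  measurable A -> multiplier_set A.
Proof.
move=> mA; have sM := sigma_algebra_multiplier_set.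
move: A mA; apply: smallest_sub => //.
move=> A; rewrite -bigcup_seq /= => -[i _ [B mB <-]].
have {}mB : (@RGenOInfty.G R).-sigma.-measurable B.
  by rewrite -RGenOInfty.measurableE; exact: mB.
pose G := [set B : set R | multiplier_set (setT `&` (fun x => tnth x i) @^-1` B)].
have sG : sigma_algebra setT G.
  have [s0 sC sU] := sM; split.
  - by rewrite /G/= setTI preimage_set0.
  - move=> C; rewrite /G /= !setTI => /sC; rewrite !setTD.
    by rewrite preimage_setC.
  - move=> F mF; rewrite /G/= setTI preimage_bigcup; apply: sU => n.
    by have := mF n; rewrite /G/= setTI.
move: B mB; apply: smallest_sub => // _ [a ->].
by rewrite /G/= setTI; exact: multiplier_set_ray.
Qed.

Lemma orthogonal_to_characters_ae0 : {ae mu, forall x, f x = 0}.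
Proof.
have A0 A : measurable A -> (\int[mu]_(x in A) (f x)%:E = 0)%E.
  move=> mA; have [_ mulA] := multiplier_set_measurable mA.
  (* At frequency 0 the cosine is 1, so the annihilation of the indicator of [A] is the vanishing of
     the integral of [f] over [A]. *)
  have [bA /(_ (nseq_tuple d 0))[]] := mulA _ annihilated1.
  have f0 (x : torus R d) : freq_dot (nseq_tuple d 0) x = 0.
    by rewrite /freq_dot big1// => i _; rewrite tnth_nseq mul0r.
  under eq_Rintegral do rewrite f0 cos0 mulr1 mul1r.
  move=> E _; rewrite integral_mkcond.
  rewrite -[LHS]fineK; last first.
    rewrite -integral_mkcond; apply: integrable_fin_num => //.
    exact: integrableS intf.
  congr EFin; rewrite -[RHS]E; congr fine; apply: eq_integral => x _.
  by rewrite patchE indicE; case: ifP => _; rewrite ?mulr1 ?mulr0.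
have := @integral_ae_eq _ _ _ mu setT measurableT (cst 0%E) (EFin \o f) intf
  (measurable_cst _).
case=> [E _ mE|N [mN N0 sN]].
  by rewrite A0// integral0.
exists N; split => // x /= nfx; apply: sN => /= fE; apply: nfx.
by have /= [] := fE I.
Qed.

End Annihilator.

(** * Complex-valued square integrable functions *)

Local Open Scope complex_scope.

Notation Re := complex.Re.
Notation Im := complex.Im.
Notation normc := Normc.normc.

Section ComplexNumbers.
Context {R : realType}.
Implicit Types z w : R[i].

Lemma ReM z w : Re (z * w) = Re z * Re w - Im z * Im w.
Proof. by case: z w => [a b] [c e]. Qed.

Lemma ImM z w : Im (z * w) = Re z * Im w + Im z * Re w.
Proof. by case: z w => [a b] [c e]. Qed.

Lemma ReD z w : Re (z + w) = Re z + Re w.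
Proof. by case: z w => [a b] [c e]. Qed.

Lemma ImD z w : Im (z + w) = Im z + Im w.
Proof. by case: z w => [a b] [c e]. Qed.

Lemma ReN z : Re (- z) = - Re z.
Proof. by case: z. Qed.

Lemma ImN z : Im (- z) = - Im z.
Proof. by case: z. Qed.

Lemma Re_conj z : Re (conjc z) = Re z.
Proof. by case: z. Qed.

Lemma Im_conj z : Im (conjc z) = - Im z.
Proof. by case: z. Qed.

Definition ReImE := (ReM, ImM, ReD, ImD, ReN, ImN, Re_conj, Im_conj).

Lemma eq_ReIm z w : Re z = Re w -> Im z = Im w -> z = w.
Proof. by case: z w => [a b] [c e] /= -> ->. Qed.

Lemma sqr_normcE z : normc z ^+ 2 = Re z ^+ 2 + Im z ^+ 2.
Proof. by case: z => a b; rewrite /= sqr_sqrtr// addr_ge0 ?sqr_ge0. Qed.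

Lemma normc_ge0 z : 0 <= normc z.
Proof. by case: z => a b; exact: sqrtr_ge0. Qed.

Lemma normc_le z (B : R) : 0 <= B -> Re z ^+ 2 + Im z ^+ 2 <= B ^+ 2 -> normc z <= B.
Proof.
move=> B0; rewrite -sqr_normcE.
by rewrite ler_sqr ?nnegrE ?normc_ge0.
Qed.

Lemma normr_Re_le z : `|Re z| <= normc z.
Proof.
rewrite -ler_sqr ?nnegrE ?normc_ge0// sqr_normcE real_normK ?num_real//.
by rewrite lerDl sqr_ge0.
Qed.

Lemma normr_Im_le z : `|Im z| <= normc z.
Proof.
rewrite -ler_sqr ?nnegrE ?normc_ge0// sqr_normcE real_normK ?num_real//.
by rewrite lerDr sqr_ge0.
Qed.

Lemma Re_le_normc z : Re z <= normc z.
Proof. exact: le_trans (ler_norm _) (normr_Re_le z). Qed.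

Lemma normc_conj z : normc (conjc z) = normc z.
Proof. by case: z => a b /=; rewrite sqrrN. Qed.

Lemma normc_real (a : R) : normc (a%:C) = `|a|.
Proof. by rewrite /= expr0n addr0 sqrtr_sqr. Qed.

Lemma normcB_le z w : normc (z - w) <= normc z + normc w.
Proof. by rewrite (le_trans (le_normcD _ _))// normcN. Qed.

Lemma normc_sum I (r : seq I) (F : I -> R[i]) :
  normc (\sum_(i <- r) F i) <= \sum_(i <- r) normc (F i).
Proof.
elim: r => [|i r IH]; first by rewrite !big_nil Normc.normc0.
by rewrite !big_cons (le_trans (le_normcD _ _))// lerD2l.
Qed.

Lemma Re_sum I (r : seq I) (F : I -> R[i]) :
  Re (\sum_(i <- r) F i) = \sum_(i <- r) Re (F i).
Proof. by apply: (big_morph (@complex.Re R)) => //; exact: ReD. Qed.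

Lemma conj_sum I (r : seq I) (F : I -> R[i]) :
  (conjc (\sum_(i <- r) F i)) = \sum_(i <- r) (conjc (F i)).
Proof. exact: rmorph_sum. Qed.

Lemma conjM z w : (conjc (z * w)) = (conjc z) * (conjc w).
Proof. by apply: eq_ReIm; rewrite !ReImE; ring. Qed.

Lemma sqr_normcB z w :
  normc (z - w) ^+ 2 = normc z ^+ 2 - 2 * Re (conjc w * z) + normc w ^+ 2.
Proof. by rewrite !sqr_normcE !ReImE; ring. Qed.

Lemma mul_conj z : z * (conjc z) = (normc z ^+ 2)%:C.
Proof.
apply: eq_ReIm; rewrite ?ReImE/= ?sqr_normcE; ring.
Qed.

End ComplexNumbers.

Section ComplexIntegral.
Context {R : realType} {d : nat}.
Local Notation mu := (torus_measure R d).
Implicit Types (f g : torus R d -> R[i]) (j k : d.-tuple int).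

Definition cmeasurable f := measurable_fun setT (fun x => Re (f x)) /\
  measurable_fun setT (fun x => Im (f x)).

Definition cintegrable f := mu.-integrable setT (EFin \o (fun x => Re (f x))) /\
  mu.-integrable setT (EFin \o (fun x => Im (f x))).

Lemma cintegrable_measurable f : cintegrable f -> cmeasurable f.
Proof.
by move=> [iR iI]; split; apply/measurable_EFinP;
  [exact: measurable_int iR|exact: measurable_int iI].
Qed.

Lemma cmeasurableD f g : cmeasurable f -> cmeasurable g -> cmeasurable (fun x => f x + g x).
Proof.
move=> [fR fI] [gR gI]; split; under eq_fun do rewrite ?ReImE; exact: measurable_funD.
Qed.

Lemma cmeasurableN f : cmeasurable f -> cmeasurable (fun x => - f x).
Proof.
move=> [fR fI]; split; under eq_fun do rewrite ?ReImE; exact: measurableT_comp.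
Qed.

Lemma cmeasurableB f g : cmeasurable f -> cmeasurable g -> cmeasurable (fun x => f x - g x).
Proof. by move=> mf mg; apply: cmeasurableD => //; exact: cmeasurableN. Qed.

Lemma cmeasurableM f g : cmeasurable f -> cmeasurable g -> cmeasurable (fun x => f x * g x).
Proof.
move=> [fR fI] [gR gI]; split; under eq_fun do rewrite ?ReImE.
  by apply: measurable_funB; exact: measurable_funM.
by apply: measurable_funD; exact: measurable_funM.
Qed.

Lemma cmeasurable_conj f : cmeasurable f -> cmeasurable (fun x => (conjc (f x))).
Proof.
move=> [fR fI]; split; under eq_fun do rewrite ReImE; first exact: fR.
exact: measurableT_comp.
Qed.

Lemma cmeasurable_cst (c : R[i]) : cmeasurable (fun=> c).
Proof. by split; exact: measurable_cst. Qed.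

Lemma measurable_sqr_normc f : cmeasurable f ->
  measurable_fun setT (fun x => normc (f x) ^+ 2).
Proof.
move=> [fR fI]; under eq_fun do rewrite sqr_normcE.
by apply: measurable_funD; exact: measurable_funX.
Qed.

Lemma cintegrable_dominated f (h : torus R d -> R) : cmeasurable f ->
  mu.-integrable setT (EFin \o h) -> (forall x, normc (f x) <= h x) -> cintegrable f.
Proof.
move=> [fR fI] ih fh.
have D (e : torus R d -> R) : measurable_fun setT e -> (forall x, `|e x| <= normc (f x)) ->
    mu.-integrable setT (EFin \o e).
  move=> me ef; apply: (le_integrable measurableT _ _ ih); first exact/measurable_EFinP.
  move=> x _; rewrite /= lee_fin (le_trans (ef x))// (le_trans (fh x))//.
  exact: ler_norm.
by split; apply: D => // x; [exact: normr_Re_le|exact: normr_Im_le].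
Qed.

Lemma integrable_addR (g h : torus R d -> R) :
  mu.-integrable setT (EFin \o g) -> mu.-integrable setT (EFin \o h) ->
  mu.-integrable setT (EFin \o (fun x => g x + h x)).
Proof. exact: integrableD. Qed.

Lemma integrable_subR (g h : torus R d -> R) :
  mu.-integrable setT (EFin \o g) -> mu.-integrable setT (EFin \o h) ->
  mu.-integrable setT (EFin \o (fun x => g x - h x)).
Proof. exact: integrableB. Qed.

Lemma integrable_mulR (a : R) (h : torus R d -> R) :
  mu.-integrable setT (EFin \o h) ->
  mu.-integrable setT (EFin \o (fun x => a * h x)).
Proof. exact: integrableZl. Qed.

Lemma cintegrableD f g : cintegrable f -> cintegrable g -> cintegrable (fun x => f x + g x).
Proof.
move=> [fR fI] [gR gI]; split; under [X in EFin \o X]eq_fun do rewrite ReImE;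
  exact: integrable_addR.
Qed.

Lemma cintegrableZ (c : R[i]) f : cintegrable f -> cintegrable (fun x => c * f x).
Proof.
move=> [fR fI]; split; under [X in EFin \o X]eq_fun do rewrite ReImE.
  by apply: integrable_subR; exact: integrable_mulR.
by apply: integrable_addR; exact: integrable_mulR.
Qed.

Lemma cintegralD f g : cintegrable f -> cintegrable g ->
  cintegral (fun x => f x + g x) = cintegral f + cintegral g.
Proof.
move=> [fR fI] [gR gI]; apply: eq_ReIm; rewrite ?ReImE /cintegral /= -RintegralD//;
  by apply: eq_Rintegral => x _; rewrite ReImE.
Qed.

Lemma cintegralZ (c : R[i]) f : cintegrable f ->
  cintegral (fun x => c * f x) = c * cintegral f.
Proof.
move=> [fR fI]; have Z := integrable_mulR.
apply: eq_ReIm; rewrite ?ReImE /cintegral /= -!RintegralZl//.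
  by rewrite -RintegralB ?Z//; apply: eq_Rintegral => x _; rewrite ReImE.
by rewrite -RintegralD ?Z//; apply: eq_Rintegral => x _; rewrite ReImE.
Qed.

Lemma cintegrable_sum I (r : seq I) (F : I -> torus R d -> R[i]) :
  (forall i, cintegrable (F i)) -> cintegrable (fun x => \sum_(i <- r) F i x).
Proof.
move=> iF; elim: r => [|i r IH].
  under eq_fun do rewrite big_nil; split; exact: integrable0.
by under eq_fun do rewrite big_cons; exact: cintegrableD.
Qed.

Lemma cintegral_sum I (r : seq I) (F : I -> torus R d -> R[i]) :
  (forall i, cintegrable (F i)) ->
  cintegral (fun x => \sum_(i <- r) F i x) = \sum_(i <- r) cintegral (F i).
Proof.
move=> iF; elim: r => [|i r IH].
  under eq_fun do rewrite big_nil; rewrite big_nil /cintegral /=.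
  by apply: eq_ReIm; rewrite /= /Rintegral integral0.
under eq_fun do rewrite big_cons.
by rewrite cintegralD ?IH ?big_cons//; exact: cintegrable_sum.
Qed.

End ComplexIntegral.

Section SquareIntegrable.
Context {R : realType} {d : nat}.
Local Notation mu := (torus_measure R d).
Implicit Types (f g : torus R d -> R[i]) (j k : d.-tuple int).

(** A real number, hence the squared norm only under [in_L2]: an infinite integral would be read as
    0. *)
Definition sqnorm f : R := (\int[mu]_x normc (f x) ^+ 2)%R.

Lemma L2normE f :
  L2norm f = ((\int[mu]_x (normc (f x) ^+ 2)%:E) `^ (2^-1))%E.
Proof.
rewrite /L2norm unlock; congr (_ `^ _)%E; apply: eq_integral => x _ /=.
by rewrite ger0_norm ?normc_ge0// powR_mulrn ?normc_ge0.
Qed.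

Lemma in_L2P f : in_L2 f <-> cmeasurable f /\
  mu.-integrable setT (EFin \o (fun x => normc (f x) ^+ 2)).
Proof.
have E : cmeasurable f -> (L2norm f < +oo)%E <->
    mu.-integrable setT (EFin \o (fun x => normc (f x) ^+ 2)).
  move=> mf; have I0 : (0 <= \int[mu]_x (normc (f x) ^+ 2)%:E)%E.
    by apply: integral_ge0 => x _; rewrite lee_fin sqr_ge0.
  rewrite L2normE; split=> [H|/integrableP[_ H]].
    apply/integrableP; split.
      by apply/measurable_EFinP; exact: measurable_sqr_normc.
    rewrite (_ : integral _ _ _ = (\int[mu]_x (normc (f x) ^+ 2)%:E)%E); last first.
      by apply: eq_integral => x _ /=; rewrite ger0_norm ?sqr_ge0.
    exact: lty_poweRy H.
  rewrite (_ : (\int[mu]_x _)%E = (\int[mu]_x `|(normc (f x) ^+ 2)%:E|)%E); last first.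
    by apply: eq_integral => x _ /=; rewrite ger0_norm ?sqr_ge0.
  by rewrite poweR_lty.
split=> [[mR mI]|[mf]]; first by rewrite E//; split.
by rewrite -E// => L; split => //; [exact: mf.1|exact: mf.2].
Qed.

Lemma sqnorm_ge0 f : 0 <= sqnorm f.
Proof. by apply: Rintegral_ge0 => x _; exact: sqr_ge0. Qed.

Lemma L2norm_sqnorm f : in_L2 f -> L2norm f = (Num.sqrt (sqnorm f))%:E.
Proof.
move=> /in_L2P[mf iF]; rewrite L2normE.
rewrite -[X in (X `^ _)%E]fineK; last exact: integrable_fin_num iF.
by rewrite poweR_EFin powR12_sqrt// sqnorm_ge0.
Qed.

Lemma in_L2_cmeasurable f : in_L2 f -> cmeasurable f.
Proof. by move=> /in_L2P[]. Qed.

Lemma in_L2_integrable f : in_L2 f ->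
  mu.-integrable setT (EFin \o (fun x => normc (f x) ^+ 2)).
Proof. by move=> /in_L2P[]. Qed.

Lemma in_L2_dominated f (h : torus R d -> R) : cmeasurable f ->
  mu.-integrable setT (EFin \o h) -> (forall x, normc (f x) ^+ 2 <= h x) -> in_L2 f.
Proof.
move=> mf ih fh; apply/in_L2P; split => //.
apply: (le_integrable measurableT _ _ ih).
  by apply/measurable_EFinP; exact: measurable_sqr_normc.
move=> x _; rewrite /= lee_fin ger0_norm ?sqr_ge0// (le_trans (fh x))//.
exact: ler_norm.
Qed.

Lemma in_L2Z (c : R[i]) f : in_L2 f -> in_L2 (fun x => c * f x).
Proof.
move=> /in_L2P[mf iF].
apply: (in_L2_dominated _ (integrable_mulR (normc c ^+ 2) iF)).
  by apply: cmeasurableM => //; exact: cmeasurable_cst.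
by move=> x; rewrite Normc.normcM exprMn.
Qed.

Lemma in_L2D f g : in_L2 f -> in_L2 g -> in_L2 (fun x => f x + g x).
Proof.
move=> /in_L2P[mf iF] /in_L2P[mg iG].
apply: (in_L2_dominated _ (integrable_mulR 2 (integrable_addR iF iG))).
  exact: cmeasurableD.
move=> x; apply: (@le_trans _ _ ((normc (f x) + normc (g x)) ^+ 2)).
  by rewrite ler_sqr ?nnegrE ?addr_ge0 ?normc_ge0// le_normcD.
by have := sqr_ge0 (normc (f x) - normc (g x)); lra.
Qed.

Lemma in_L2N f : in_L2 f -> in_L2 (fun x => - f x).
Proof. by move=> /(in_L2Z (-1)); under eq_fun do rewrite mulN1r. Qed.

Lemma in_L2B f g : in_L2 f -> in_L2 g -> in_L2 (fun x => f x - g x).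
Proof. by move=> f2 g2; apply: in_L2D => //; exact: in_L2N. Qed.

Lemma in_L2_conj f : in_L2 f -> in_L2 (fun x => conjc (f x)).
Proof.
move=> /in_L2P[mf iF]; apply/in_L2P; split; first exact: cmeasurable_conj.
by under [X in EFin \o X]eq_fun do rewrite normc_conj.
Qed.

Lemma in_L2_0 : in_L2 (fun _ : torus R d => 0 : R[i]).
Proof.
apply/in_L2P; split; first exact: cmeasurable_cst.
under [X in EFin \o X]eq_fun do rewrite Normc.normc0 expr0n.
exact: integrable0.
Qed.

Lemma in_L2_sum I (r : seq I) (F : I -> torus R d -> R[i]) :
  (forall i, in_L2 (F i)) -> in_L2 (fun x => \sum_(i <- r) F i x).
Proof.
move=> iF; elim: r => [|i r IH].
  by under eq_fun do rewrite big_nil; exact: in_L2_0.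
by under eq_fun do rewrite big_cons; exact: in_L2D.
Qed.

Lemma in_L2_bounded f (K : R) : cmeasurable f -> (forall x, normc (f x) <= K) -> in_L2 f.
Proof.
move=> mf fK; apply/in_L2P; split => //.
apply: (bounded_integrable mu (K := K ^+ 2)); first exact: measurable_sqr_normc.
move=> x; rewrite ger0_norm ?sqr_ge0// ler_sqr ?nnegrE ?normc_ge0//.
exact: le_trans (normc_ge0 _) (fK x).
Qed.

Lemma cintegrableM f g : in_L2 f -> in_L2 g -> cintegrable (fun x => f x * g x).
Proof.
move=> /in_L2P[mf iF] /in_L2P[mg iG].
apply: (cintegrable_dominated (cmeasurableM mf mg) (integrable_addR iF iG)).
move=> x; rewrite Normc.normcM.
have := sqr_ge0 (normc (f x) - normc (g x)); have := sqr_ge0 (normc (f x) + normc (g x)).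
lra.
Qed.

Lemma in_L2_cintegrable f : in_L2 f -> cintegrable f.
Proof.
move=> f2; have f1 : in_L2 (fun _ : torus R d => 1 : R[i]).
  apply: (@in_L2_bounded _ 1); first exact: cmeasurable_cst.
  by move=> x; rewrite Normc.normc1.
by have := cintegrableM f2 f1; under eq_fun do rewrite mulr1.
Qed.

End SquareIntegrable.

Section Characters.
Context {R : realType} {d : nat}.
Local Notation mu := (torus_measure R d).
Local Notation vol := ((2 * pi : R) ^+ d).
Implicit Types (f g : torus R d -> R[i]) (j k : d.-tuple int).

Definition char j (x : torus R d) : R[i] := cos (freq_dot j x) +i* sin (freq_dot j x).

Lemma fourierE f j : fourier f j = (vol^-1)%:C * cintegral (fun x => f x * conjc (char j x)).
Proof. by []. Qed.

Lemma vol_gt0 : 0 < vol.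
Proof. by rewrite exprn_gt0// pi2_gt0. Qed.

Lemma cmeasurable_char j : cmeasurable (char j).
Proof. by split; [exact: measurable_cos_freq_dot|exact: measurable_sin_freq_dot]. Qed.

Lemma normc_char j x : normc (char j x) = 1.
Proof. by rewrite /= cos2Dsin2 sqrtr1. Qed.

Lemma in_L2_char j : in_L2 (char j).
Proof.
apply: (@in_L2_bounded _ _ _ 1); first exact: cmeasurable_char.
by move=> x; rewrite normc_char.
Qed.

Lemma cintegrableM_char f j : cintegrable f -> cintegrable (fun x => f x * conjc (char j x)).
Proof.
move=> [fR fI]; have mf := cintegrable_measurable (conj fR fI).
have abs (h : torus R d -> R) : mu.-integrable setT (EFin \o h) ->
    mu.-integrable setT (EFin \o (fun x => `|h x|)).
  by move=> ih; exact: (integrable_norm ih).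
apply: (cintegrable_dominated _ (integrable_addR (abs _ fR) (abs _ fI))).
  by apply: cmeasurableM => //; apply: cmeasurable_conj; exact: cmeasurable_char.
move=> x; rewrite Normc.normcM normc_conj normc_char mulr1.
apply: normc_le; first by rewrite addr_ge0.
rewrite -[Re _ ^+ 2]real_normK ?num_real// -[Im _ ^+ 2]real_normK ?num_real//.
have := mulr_ge0 (normr_ge0 (Re (f x))) (normr_ge0 (Im (f x))).
by rewrite sqrrD; lra.
Qed.

Lemma fourierD f g j : cintegrable f -> cintegrable g ->
  fourier (fun x => f x + g x) j = fourier f j + fourier g j.
Proof.
move=> fi gi; rewrite !fourierE -mulrDr -cintegralD; [|exact: cintegrableM_char..].
by congr (_ * cintegral _); apply/funext => x; rewrite mulrDl.
Qed.

Lemma fourierZ (c : R[i]) f j : cintegrable f ->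
  fourier (fun x => c * f x) j = c * fourier f j.
Proof.
move=> fi; rewrite !fourierE [RHS]mulrCA -[c * cintegral _]cintegralZ; last
  exact: cintegrableM_char.
by congr (_ * cintegral _); apply/funext => x; rewrite mulrA.
Qed.

Lemma fourierB f g j : cintegrable f -> cintegrable g ->
  fourier (fun x => f x - g x) j = fourier f j - fourier g j.
Proof.
move=> fi gi; rewrite -[- fourier g j]mulN1r -fourierZ// -fourierD//.
  by under [in RHS]eq_fun do rewrite mulN1r.
exact: cintegrableZ.
Qed.

Lemma fourier_sum I (r : seq I) (F : I -> torus R d -> R[i]) j :
  (forall i, cintegrable (F i)) ->
  fourier (fun x => \sum_(i <- r) F i x) j = \sum_(i <- r) fourier (F i) j.
Proof.
move=> iF; rewrite fourierE; under eq_fun do rewrite mulr_suml.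
rewrite cintegral_sum ?mulr_sumr// => i; exact: cintegrableM_char.
Qed.

Lemma cintegral_conj f : cintegrable f -> cintegral (fun x => conjc (f x)) = conjc (cintegral f).
Proof.
move=> [fR fI]; apply: eq_ReIm; rewrite ?ReImE /cintegral /=.
  by apply: eq_Rintegral => x _; rewrite ReImE.
rewrite -mulN1r -RintegralZl//.
by apply: eq_Rintegral => x _; rewrite ReImE mulN1r.
Qed.

Lemma fourier_conj f j : cintegrable f ->
  fourier (fun x => conjc (f x)) j = (conjc (fourier f (freq_opp j))).
Proof.
move=> fi; rewrite !fourierE conjM conjc_real; congr (_ * _).
rewrite -cintegral_conj; last exact: cintegrableM_char.
congr (cintegral _); apply/funext => x; rewrite conjM; congr (_ * _).
by rewrite /char freq_dotN cosN sinN /= opprK.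
Qed.

Lemma char_mul_conj j k x : char j x * conjc (char k x) = char (freq_add j (freq_opp k)) x.
Proof.
rewrite /char freq_dotD freq_dotN cosD sinD cosN sinN; apply: eq_ReIm; rewrite /=; ring.
Qed.

Lemma fourier_mul_char f j k :
  fourier (fun x => char k x * f x) j = fourier f (freq_add j (freq_opp k)).
Proof.
rewrite !fourierE; congr (_ * cintegral _); apply/funext => x.
by rewrite -char_mul_conj conjM conjcK; ring.
Qed.

Lemma cintegral_char j : cintegral (char j) = (if j == nseq_tuple d 0 then vol else 0)%:C.
Proof.
have [c s] := @torus_integral_cos_sin R d j.
by rewrite /cintegral c s.
Qed.

Lemma fourier_char j k : fourier (char k) j = (k == j)%:R.
Proof.
rewrite fourierE; under eq_fun do rewrite char_mul_conj.
rewrite cintegral_char freq_sub_eq0; case: eqP => _; last by rewrite mulr0.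
by rewrite -rmorphM/= mulVf ?gt_eqF// vol_gt0.
Qed.

End Characters.

Arguments Normc.normc : simpl never.

(** * Bessel inequality and Riesz-Fischer theorem *)

Section Bessel.
Context {R : realType} {d : nat}.
Local Notation mu := (torus_measure R d).
Local Notation vol := ((2 * pi : R) ^+ d).
Implicit Types (f g : torus R d -> R[i]) (j k : d.-tuple int) (r : seq (d.-tuple int))
  (v w : d.-tuple int -> R[i]).

Definition trigpoly r v (x : torus R d) : R[i] := \sum_(k <- r) v k * char k x.

(** Parseval's form of the bound [B] on an L^2 norm; the factor [vol] compensates the normalisation
    of [fourier]. Finite lists without repetition stand for the infinite sum, so no convergence is
    presupposed. *)
Definition l2le v (B : R) :=
  0 <= B /\ forall r, uniq r -> vol * \sum_(k <- r) normc (v k) ^+ 2 <= B ^+ 2.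

Lemma in_L2_trigpoly r v : in_L2 (trigpoly r v).
Proof. by apply: in_L2_sum => k; apply: in_L2Z; exact: in_L2_char. Qed.

Lemma fourier_trigpoly r v j : uniq r ->
  fourier (trigpoly r v) j = if j \in r then v j else 0.
Proof.
move=> ur; rewrite fourier_sum => [|k]; last exact/cintegrableZ/in_L2_cintegrable/in_L2_char.
under eq_bigr => k _.
  rewrite fourierZ; last exact/in_L2_cintegrable/in_L2_char.
  rewrite fourier_char.
over.
case: ifPn => jr.
  rewrite (bigD1_seq j)//= eqxx mulr1 big1 ?addr0// => k /negPf kj.
  by rewrite kj mulr0.
rewrite big_seq big1// => k kr; case: eqP => [kj|_]; last by rewrite mulr0.
by rewrite -kj kr in jr.
Qed.

Lemma sqnormB f g : in_L2 f -> in_L2 g ->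
  sqnorm (fun x => f x - g x) =
  sqnorm f - 2 * Re (cintegral (fun x => f x * conjc (g x))) + sqnorm g.
Proof.
move=> f2 g2; have [fg _] := cintegrableM f2 (in_L2_conj g2).
have iF := in_L2_integrable f2; have iG := in_L2_integrable g2.
rewrite /cintegral /= -RintegralZl// -RintegralB//; last exact: integrable_mulR.
rewrite -RintegralD//; last by apply: integrable_subR => //; exact: integrable_mulR.
by apply: eq_Rintegral => x _; rewrite !sqr_normcE !ReImE; ring.
Qed.

Lemma cintegral_mul_conj_trigpoly f r v : in_L2 f ->
  cintegral (fun x => f x * conjc (trigpoly r v x)) =
  vol%:C * \sum_(k <- r) conjc (v k) * fourier f k.
Proof.
move=> f2; under eq_fun do rewrite /trigpoly conj_sum mulr_sumr.
rewrite cintegral_sum => [|k]; last first.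
  by apply: cintegrableM => //; apply: in_L2_conj; apply: in_L2Z; exact: in_L2_char.
rewrite mulr_sumr; apply: eq_bigr => k _.
have fk := cintegrableM_char k (in_L2_cintegrable f2).
rewrite fourierE -[LHS]/(cintegral _) (_ : (fun x => _) =
    (fun x => conjc (v k) * (f x * conjc (char k x)))).
  rewrite cintegralZ// [RHS]mulrCA; congr (_ * _).
  by rewrite mulrA -rmorphM /= divff ?mul1r// gt_eqF// vol_gt0.
by apply/funext => x; rewrite conjM; ring.
Qed.

Lemma sqnorm_trigpoly r v : uniq r ->
  sqnorm (trigpoly r v) = vol * \sum_(k <- r) normc (v k) ^+ 2.
Proof.
move=> ur; have := cintegral_mul_conj_trigpoly r v (in_L2_trigpoly r v).
move=> /(congr1 (@complex.Re R)) E.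
transitivity (Re (cintegral (fun x => trigpoly r v x * conjc (trigpoly r v x)))).
  by rewrite /cintegral /=; apply: eq_Rintegral => x _; rewrite mul_conj.
rewrite E ReM /= mul0r subr0 Re_sum; congr (_ * _).
rewrite big_seq [RHS]big_seq; apply: eq_bigr => k kr.
by rewrite fourier_trigpoly// kr mulrC mul_conj.
Qed.

(** The best approximation identity. The last sum vanishes when v is [fourier f], and positivity of
    the left side is then Bessel's inequality. *)
Lemma sqnormB_trigpoly f r v : in_L2 f -> uniq r ->
  sqnorm (fun x => f x - trigpoly r v x) =
  sqnorm f - vol * \sum_(k <- r) normc (fourier f k) ^+ 2
  + vol * \sum_(k <- r) normc (fourier f k - v k) ^+ 2.
Proof.
move=> f2 ur; rewrite sqnormB//; last exact: in_L2_trigpoly.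
rewrite cintegral_mul_conj_trigpoly// sqnorm_trigpoly//.
move: (fourier f) => F; rewrite ReM /= mul0r subr0 Re_sum.
have -> : \sum_(k <- r) normc (F k - v k) ^+ 2 =
    \sum_(k <- r) normc (F k) ^+ 2
    - 2 * (\sum_(k <- r) Re (conjc (v k) * F k))
    + \sum_(k <- r) normc (v k) ^+ 2.
  rewrite mulr_sumr -sumrB -big_split /=; apply: eq_bigr => k _.
  by rewrite sqr_normcB.
ring.
Qed.

Lemma bessel_le f r : in_L2 f -> uniq r ->
  vol * \sum_(k <- r) normc (fourier f k) ^+ 2 <= sqnorm f.
Proof.
move=> f2 ur; rewrite -subr_ge0.
have := sqnorm_ge0 (fun x => f x - trigpoly r (fourier f) x).
rewrite sqnormB_trigpoly//.
rewrite (_ : \sum_(k <- r) normc (fourier f k - fourier f k) ^+ 2 = 0).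
  by rewrite mulr0 addr0.
by apply: big1 => k _; rewrite subrr Normc.normc0 expr0n.
Qed.

Lemma l2le_fourier f (B : R) : in_L2 f -> 0 <= B -> sqnorm f <= B ^+ 2 ->
  l2le (fourier f) B.
Proof. by move=> f2 B0 fB; split => // r ur; rewrite (le_trans (bessel_le f2 ur)). Qed.

(** A vanishing complex coefficient only kills combinations of integrals of the real and imaginary
    parts. Cosine is even and sine odd, so the coefficients at j and [freq_opp j] together separate
    the four real integrals, and the real result applies to each part. *)
Lemma fourier_eq0_ae f : cintegrable f -> (forall j, fourier f j = 0) ->
  {ae mu, forall x, f x = 0}.
Proof.
move=> fi f0; have fj0 j : cintegral (fun x => f x * conjc (char j x)) = 0.
  have := f0 j; rewrite fourierE => /eqP; rewrite mulf_eq0 => /orP[|/eqP//].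
  by rewrite eq_complex /= eqxx andbT invr_eq0 gt_eqF// vol_gt0.
have [fR fI] := fi.
have B (h : torus R d -> R) (e : torus R d -> R) : mu.-integrable setT (EFin \o h) ->
    bounded_measurable e -> mu.-integrable setT (EFin \o (fun x => h x * e x)).
  by move=> ih be; exact: integrableM_bounded.
have bc := @bounded_measurable_cos R d; have bs := @bounded_measurable_sin R d.
have E j : [/\ (\int[mu]_x (Re (f x) * cos (freq_dot j x)) = 0)%R,
     (\int[mu]_x (Re (f x) * sin (freq_dot j x)) = 0)%R,
     (\int[mu]_x (Im (f x) * cos (freq_dot j x)) = 0)%R &
     (\int[mu]_x (Im (f x) * sin (freq_dot j x)) = 0)%R].
  have P k : (\int[mu]_x (Re (f x) * cos (freq_dot k x)) +
      \int[mu]_x (Im (f x) * sin (freq_dot k x)) = 0)%R /\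
     (\int[mu]_x (Im (f x) * cos (freq_dot k x)) -
      \int[mu]_x (Re (f x) * sin (freq_dot k x)) = 0)%R.
    have := fj0 k; rewrite /cintegral => -[E1 E2].
    rewrite -RintegralD ?B// -RintegralB ?B//; split; [rewrite -[RHS]E1|rewrite -[RHS]E2].
      by apply: eq_Rintegral => x _; rewrite ReImE /=; ring.
    by apply: eq_Rintegral => x _; rewrite ReImE /=; ring.
  have c (h : torus R d -> R) : mu.-integrable setT (EFin \o h) ->
      (\int[mu]_x (h x * cos (freq_dot (freq_opp j) x)) =
       \int[mu]_x (h x * cos (freq_dot j x)))%R.
    by move=> _; apply: eq_Rintegral => x _; rewrite freq_dotN cosN.
  have s (h : torus R d -> R) : mu.-integrable setT (EFin \o h) ->
      (\int[mu]_x (h x * sin (freq_dot (freq_opp j) x)) =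
       - \int[mu]_x (h x * sin (freq_dot j x)))%R.
    move=> ih; rewrite -mulN1r -RintegralZl ?B//.
    by apply: eq_Rintegral => x _; rewrite freq_dotN sinN; ring.
  have [P1 P2] := P j; have [] := P (freq_opp j).
  rewrite !c// !s// => P3 P4.
  by split; lra.
have aR : {ae mu, forall x, Re (f x) = 0}.
  by apply: (orthogonal_to_characters_ae0 fR) => j; have [] := E j.
have aI : {ae mu, forall x, Im (f x) = 0}.
  by apply: (orthogonal_to_characters_ae0 fI) => j; have [] := E j.
apply: filterS2 aR aI => x fR0 fI0; exact: eq_ReIm.
Qed.

Lemma fourier_inj_ae f g : cintegrable f -> cintegrable g -> fourier f =1 fourier g ->
  {ae mu, forall x, f x = g x}.
Proof.
move=> fi gi fg.
have Ng : cintegrable (fun x => - g x).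
  by have := cintegrableZ (-1) gi; under eq_fun do rewrite mulN1r.
have : {ae mu, forall x, f x - g x = 0}.
  apply: fourier_eq0_ae; first exact: cintegrableD.
  by move=> j; rewrite fourierB// fg subrr.
by apply: filterS => x /eqP; rewrite subr_eq0 => /eqP.
Qed.

Lemma eq_fourier_ae f g : cintegrable f -> cintegrable g ->
  {ae mu, forall x, f x = g x} -> fourier f = fourier g.
Proof.
move=> fi gi fg; apply/funext => j; rewrite !fourierE; congr (_ * _).
have [fR fI] := cintegrableM_char j fi; have [gR gI] := cintegrableM_char j gi.
apply: eq_ReIm; rewrite /cintegral /=; congr fine; apply: ae_eq_integral => //.
- exact: measurable_int fR.
- exact: measurable_int gR.
- by apply: filterS fg => x /= -> _.
- exact: measurable_int fI.
- exact: measurable_int gI.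
- by apply: filterS fg => x /= -> _.
Qed.

Lemma eq_sqnorm_ae f g : in_L2 f -> in_L2 g ->
  {ae mu, forall x, f x = g x} -> sqnorm f = sqnorm g.
Proof.
move=> /in_L2_integrable f2 /in_L2_integrable g2 fg.
congr fine; apply: ae_eq_integral => //.
- exact: measurable_int f2.
- exact: measurable_int g2.
- by apply: filterS fg => x /= -> _.
Qed.

End Bessel.

(** * Almost everywhere limits of functions with summable increments *)

Section AlmostEverywhereLimits.
Context {R : realType} {dd : measure_display} {X : measurableType dd}.
Variable mu : {measure set X -> \bar R}.

(** Fatou's lemma for an almost everywhere limit: off a null set the lower limit is the limit, and
    the null set does not affect the integral. *)
Lemma fatou_real (F : nat -> X -> R) (F0 : X -> R) (C : R) :
  (forall n, measurable_fun setT (F n)) -> measurable_fun setT F0 ->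
  (forall n x, 0 <= F n x) -> (forall x, 0 <= F0 x) ->
  {ae mu, forall x, F ^~ x @ \oo --> F0 x} ->
  (forall n, (\int[mu]_x (F n x)%:E <= C%:E)%E) ->
  (\int[mu]_x (F0 x)%:E <= C%:E)%E.
Proof.
move=> mF mF0 F_ge0 F0_ge0 cF intF.
have mEF n : measurable_fun setT (EFin \o F n) by exact/measurable_EFinP.
have := @fatou _ _ _ mu setT measurableT (fun n => EFin \o F n) mEF.
move=> /(_ (fun n x _ => F_ge0 n x)) fat.
apply: le_trans (le_trans fat _).
  rewrite le_eqVlt; apply/orP; left; apply/eqP; apply: ge0_ae_eq_integral => //.
  - exact/measurable_EFinP.
  - rewrite (_ : (fun x => _) = (fun x => - limn_esup (fun n => - (F n x)%:E))%E).
      apply: measurableT_comp => //; apply: measurable_fun_limn_esup => n.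
      by apply: measurableT_comp => //; exact: mEF.
    apply/funext => x; rewrite -limn_einfN; congr limn_einf.
    by apply/funext => n /=; rewrite opprK.
  - by move=> x _; rewrite lee_fin.
  - move=> x _; rewrite limn_einf_lim; apply: lime_ge; first exact: is_cvg_einfs.
    apply: nearW => n; apply: le_ereal_inf_tmp => _ [k _ <-].
    by rewrite /= lee_fin.
  - apply: filterS cF => x cx _.
    have /cvg_limn_einf_sup[-> _] // : (EFin \o F ^~ x) @ \oo --> (F0 x)%:E.
    by apply: cvg_EFin => //; exact: nearW.
rewrite limn_einf_lim; apply: lime_le; first exact: is_cvg_einfs.
apply: nearW => n; apply: (@le_trans _ _ (\int[mu]_x (F n x)%:E)%E) => //.
by apply: ereal_inf_lbound; exists n => /=.
Qed.

(** The sum of the [D n] has integral at most 2 C, hence is finite almost everywhere; at such a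
    point the telescoping series of [S n] converges absolutely. *)
Lemma ae_cvg_of_summable (S : nat -> X -> R[i]) (D : nat -> X -> R) (C : R) :
  (forall n, measurable_fun setT (D n)) ->
  (forall n x, normc (S n.+1 x - S n x) <= D n x) ->
  (forall n, (\int[mu]_x (D n x)%:E <= (C / 2 ^+ n)%:E)%E) ->
  {ae mu, forall x, cvgn (fun n => Re (S n x)) /\ cvgn (fun n => Im (S n x))}.
Proof.
move=> mD SD intD.
have D0 n x : 0 <= D n x by apply: le_trans (SD n x); exact: normc_ge0.
have intS : (\int[mu]_x (\sum_(0 <= n <oo) (D n x)%:E) < +oo)%E.
  rewrite integral_nneseries//; last 2 first.
  - by move=> n; exact/measurable_EFinP.
  - by move=> n x _; rewrite lee_fin.
  apply: (@le_lt_trans _ _ (2 * C)%:E); last by rewrite ltry.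
  apply: lime_le.
    by apply: is_cvg_nneseries => n _ _; apply: integral_ge0 => x _; rewrite lee_fin.
  (* The exact geometric partial sum is kept because the weaker bound 2 C would not carry the
     induction. *)
  apply: nearW => n; apply: (@le_trans _ _ (2 * C - 2 * C / 2 ^+ n)%:E).
    elim: n => [|n IH].
      by rewrite big_geq// expr0 divr1 subrr.
    rewrite big_nat_recr//=; apply: le_trans (leeD IH (intD n)) _.
    rewrite -EFinD lee_fin exprSr; have : (2:R) ^+ n != 0 by rewrite expf_neq0.
    by move=> ?; rewrite le_eqVlt; apply/orP; left; apply/eqP; field.
  have C0 : 0 <= C.
    have := intD 0%N; rewrite expr0 divr1 -lee_fin; apply: le_trans.
    by apply: integral_ge0 => x _; rewrite lee_fin.
  by rewrite lee_fin lerBlDr lerDl divr_ge0 ?mulr_ge0// exprn_ge0.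
have mS : measurable_fun setT (fun x => \sum_(0 <= n <oo) (D n x)%:E)%E.
  by apply: ge0_emeasurable_sum => // n;
    [move=> x _ _; rewrite lee_fin|move=> _; exact/measurable_EFinP].
have S0 x : (0 <= \sum_(0 <= n <oo) (D n x)%:E)%E.
  by apply: nneseries_ge0 => n _ _; rewrite lee_fin.
have iS : mu.-integrable setT (fun x => \sum_(0 <= n <oo) (D n x)%:E)%E.
  by apply/integrableP; split => //; under eq_integral do rewrite gee0_abs//.
have := integrable_ae measurableT iS; apply: filterS => x /(_ I) fx.
have cD : cvgn (series (D ^~ x)).
  by apply: nnseries_is_cvg => //; rewrite ltey_eq fx.
have cvgu (u : nat -> R) : (forall n, `|u n.+1 - u n| <= D n x) -> cvgn u.
  move=> uD; have ct : cvgn (series (telescope u)).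
    apply: normed_cvg.
    exact: (@series_le_cvg _ (fun n => `|u n.+1 - u n|) (D ^~ x)
      (fun=> normr_ge0 _) (fun n => D0 n x) uD cD).
  have -> : u = (fun n => u 0%N + series (telescope u) n).
    by apply/funext => n; rewrite -eq_sum_telescope.
  by apply: is_cvgD => //; exact: is_cvg_cst.
split; apply: cvgu => n.
  by rewrite -ReN -ReD (le_trans (normr_Re_le _)).
by rewrite -ImN -ImD (le_trans (normr_Im_le _)).
Qed.

End AlmostEverywhereLimits.

Section CountEnumeration.
Context {T : countType}.

Definition count_enum n : seq T := pmap pickle_inv (iota 0 n).

Lemma count_enum_uniq n : uniq (count_enum n).
Proof. by apply: (pmap_uniq (@pickle_invK T)); exact: iota_uniq. Qed.

Lemma mem_count_enum n x : (x \in count_enum n) = (pickle x < n)%N.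
Proof.
rewrite mem_pmap; apply/mapP/idP => [[k]|xn].
  by rewrite mem_iota add0n /= => kn xk; have := @pickle_invK T k; rewrite -xk /= => ->.
by exists (pickle x); [rewrite mem_iota|rewrite pickleK_inv].
Qed.

Lemma count_enum_sub (r : seq T) : exists n, {subset r <= count_enum n}.
Proof.
elim: r => [|x r [n rn]]; first by exists 0%N.
exists (maxn (pickle x).+1 n) => y; rewrite inE => /predU1P[->|/rn].
  by rewrite mem_count_enum leq_max ltnSn.
by rewrite !mem_count_enum => yn; rewrite leq_max yn orbT.
Qed.

End CountEnumeration.

Section FiniteSums.
Context {R : realType} {T : eqType}.
Implicit Types (r : seq T) (x : T -> R).

Lemma ler_sum_subset r r' x : uniq r -> uniq r' -> {subset r <= r'} ->
  (forall j, 0 <= x j) -> \sum_(j <- r) x j <= \sum_(j <- r') x j.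
Proof.
move=> ur ur' rr' x0.
have pE : perm_eq r [seq j <- r' | j \in r].
  apply: uniq_perm => //; first exact: filter_uniq.
  by move=> j; rewrite mem_filter; case: (boolP (j \in r)) => //= /rr' ->.
rewrite (perm_big _ pE) big_filter [leRHS](bigID (mem r))/= lerDl.
exact: sumr_ge0.
Qed.

(** A list nearly attaining the supremum of the finite sums leaves at most [e] to any list disjoint
    from it. This plays the role of the tail of a convergent series. *)
Lemma sum_bounded_approx x (B e : R) : (forall j, 0 <= x j) ->
  (forall r, uniq r -> \sum_(j <- r) x j <= B) -> 0 < e ->
  exists2 r0, uniq r0 & forall r, uniq r -> (forall j, j \in r -> j \notin r0) ->
    \sum_(j <- r) x j <= e.
Proof.
move=> x0 xB e0.
pose A := [set \sum_(j <- r) x j | r in [set r | uniq r]].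
have sA : has_sup A.
  split; first by exists 0; exists [::] => //; rewrite big_nil.
  by exists B => _ [r ur <-]; exact: xB.
have [_ [r0 ur0 <-] supA] := sup_adherent e0 sA.
exists r0 => // r ur rr0.
have : \sum_(j <- r0 ++ r) x j <= sup A.
  apply: ub_le_sup; first by case: sA.
  exists (r0 ++ r) => //=; rewrite cat_uniq ur0 ur andbT /=.
  by apply/hasPn => j jr; exact: rr0.
rewrite big_cat/=; lra.
Qed.

End FiniteSums.

Section RieszFischer.
Context {R : realType} {d : nat}.
Local Notation mu := (torus_measure R d).
Local Notation vol := ((2 * pi : R) ^+ d).
Implicit Types (f g : torus R d -> R[i]) (j : d.-tuple int) (r : seq (d.-tuple int))
  (v w : d.-tuple int -> R[i]).

Lemma trigpolyB r r' v x : uniq r -> uniq r' -> {subset r' <= r} ->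
  trigpoly r v x - trigpoly r' v x = trigpoly [seq j <- r | j \notin r'] v x.
Proof.
move=> ur ur' rr'; rewrite /trigpoly big_filter (bigID (mem r') predT)/=.
rewrite (_ : \sum_(k <- r') _ = \sum_(k <- r | k \in r') v k * char k x).
  by rewrite addrC addrK.
rewrite -[RHS]big_filter; apply: perm_big; apply: uniq_perm => //.
  exact: filter_uniq.
by move=> j; rewrite mem_filter; case: (boolP (j \in r')) => //= /rr' ->.
Qed.

Lemma l2le_tail v (B e : R) : l2le v B -> 0 < e ->
  exists2 r0, uniq r0 & forall r, uniq r -> (forall j, j \in r -> j \notin r0) ->
    vol * \sum_(j <- r) normc (v j) ^+ 2 <= e.
Proof.
move=> [B0 vB] e0; have x0 j : 0 <= vol * normc (v j) ^+ 2.
  by rewrite mulr_ge0 ?sqr_ge0// ltW// vol_gt0.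
have xB r : uniq r -> \sum_(j <- r) vol * normc (v j) ^+ 2 <= B ^+ 2.
  by rewrite -mulr_sumr; exact: vB.
have [r0 ur0 H] := sum_bounded_approx x0 xB e0.
by exists r0 => // r ur rr0; rewrite mulr_sumr; exact: H.
Qed.

Lemma Rintegral_EFin (h : torus R d -> R) : mu.-integrable setT (EFin \o h) ->
  (\int[mu]_x (h x)%:E = (\int[mu]_x h x)%R%:E)%E.
Proof. by move=> ih; rewrite /Rintegral fineK//; exact: integrable_fin_num ih. Qed.

(** Partial sums along a fast subsequence converge almost everywhere, and Fatou's lemma carries L^2
    bounds to the limit function; Bessel's inequality then identifies its coefficients. *)
Lemma riesz_fischer v (B : R) : l2le v B ->
  exists g, [/\ in_L2 g, fourier g = v & sqnorm g <= B ^+ 2].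
Proof.
move=> vB; have [B0 vB'] := vB.
pose S n := trigpoly (count_enum n) v.
have S2 n : in_L2 (S n) by exact: in_L2_trigpoly.
have /choice[N NP] : forall k : nat, exists N : nat, forall r, uniq r ->
    (forall j, j \in r -> j \notin count_enum N) ->
    vol * \sum_(j <- r) normc (v j) ^+ 2 <= 4^-1 ^+ k.
  move=> k; have e0 : 0 < 4^-1 ^+ k :> R by rewrite exprn_gt0.
  have [r0 ur0 H] := l2le_tail vB e0; have [n r0n] := count_enum_sub r0.
  exists n => r ur rn; apply: H => // j jr.
  by apply: contra (rn _ jr) => /r0n.
have SB (k n m : nat) : (N k <= n)%N -> (n <= m)%N ->
    sqnorm (fun x => S m x - S n x) <= 4^-1 ^+ k.
  move=> kn nm.
  have -> : (fun x => S m x - S n x) = trigpoly [seq j <- count_enum m | j \notin count_enum n] v.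
    apply/funext => x; apply: trigpolyB; rewrite ?count_enum_uniq// => j.
    by rewrite !mem_count_enum => /leq_trans; apply.
  rewrite sqnorm_trigpoly; last exact/filter_uniq/count_enum_uniq.
  apply: NP; first exact/filter_uniq/count_enum_uniq.
  move=> j; rewrite mem_filter => /andP[jn _]; apply: contra jn.
  by rewrite !mem_count_enum => /leq_trans; apply.
(* Summing the thresholds makes [psi] monotone and at least [N k]; the successors make [psi k]
   larger than k. *)
pose psi (k : nat) := (\sum_(i < k.+1) (N i).+1)%N.
have psi_ge (k : nat) : (k < psi k)%N.
  rewrite /psi; elim: k => [|k IH]; first by rewrite big_ord_recr /= addnS.
  by rewrite big_ord_recr/= -addn1 leq_add.
have psiN (k : nat) : (N k <= psi k)%N.
  by rewrite /psi big_ord_recr /= (leq_trans (leqnSn _))// leq_addl.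
have psiS (k : nat) : (psi k <= psi k.+1)%N.
  by rewrite /psi [X in (_ <= X)%N]big_ord_recr /= leq_addr.
(* AM-GM: [a <= (2^k a^2 + 2^-k) / 2] makes the increments summable in L^1. *)
pose D (k : nat) x : R := 2^-1 * (2 ^+ k * normc (S (psi k.+1) x - S (psi k) x) ^+ 2 + 2^-1 ^+ k).
have mD (k : nat) : measurable_fun setT (D k).
  apply: measurable_funM => //; apply: measurable_funD => //; apply: measurable_funM => //.
  by apply: measurable_sqr_normc; apply: in_L2_cmeasurable; apply: in_L2B.
have DS (k : nat) x : normc (S (psi k.+1) x - S (psi k) x) <= D k x.
  rewrite /D; set a := normc _.
  have two0 : 0 < 2 ^+ k :> R by rewrite exprn_gt0.
  rewrite exprVn -(ler_pM2l two0) -subr_ge0.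
  have -> : 2 ^+ k * (2^-1 * (2 ^+ k * a ^+ 2 + (2 ^+ k)^-1)) - 2 ^+ k * a =
      2^-1 * (2 ^+ k * a - 1) ^+ 2.
    by field; rewrite gt_eqF.
  by rewrite mulr_ge0 ?sqr_ge0.
pose C : R := 2^-1 * (1 + fine (mu setT)).
have intD (k : nat) : (\int[mu]_x (D k x)%:E <= (C / 2 ^+ k)%:E)%E.
  have i1 : mu.-integrable setT (EFin \o (fun=> 2^-1 ^+ k : R)).
    by apply: (bounded_integrable mu (K := `|2^-1 ^+ k|)).
  have iS := in_L2_integrable (in_L2B (S2 (psi k.+1)) (S2 (psi k))).
  have iS' := integrable_mulR (2 ^+ k) iS.
  have iD : mu.-integrable setT (EFin \o (D k)).
    by apply: integrable_mulR; exact: integrable_addR.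
  rewrite Rintegral_EFin// lee_fin /D RintegralZl//; last exact: integrable_addR.
  rewrite RintegralD// RintegralZl// Rintegral_cst// /C -exprVn -mulrA ler_wpM2l//.
  rewrite mulrDl mul1r [fine _ * _]mulrC lerD2r.
  have -> : 2^-1 ^+ k = 2 ^+ k * 4^-1 ^+ k :> R.
    by rewrite -exprMn; congr (_ ^+ _); field.
  by rewrite ler_wpM2l ?exprn_ge0//; exact: SB.
have [M [mM M0 subM]] := ae_cvg_of_summable mD DS intD.
have cS x : ~ M x -> cvgn (fun k => Re (S (psi k) x)) /\ cvgn (fun k => Im (S (psi k) x)).
  by move=> Mx; apply: contrapT => H; apply: Mx; exact: subM.
(* The indicator of the complement of the exceptional set makes both sequences converge everywhere,
   so that the limit is measurable. *)
pose gR x := limn (fun k => Re (S (psi k) x) * \1_(~` M) x).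
pose gI x := limn (fun k => Im (S (psi k) x) * \1_(~` M) x).
have cgR x : (fun k => Re (S (psi k) x) * \1_(~` M) x) @ \oo --> gR x.
  rewrite /gR indicE; have [Mx|Mx] := pselect (M x).
    by rewrite memNset//= mulr0n; under eq_fun do rewrite mulr0; exact: is_cvg_cst.
  by rewrite mem_set//= mulr1n; under eq_fun do rewrite mulr1; exact: (cS x Mx).1.
have cgI x : (fun k => Im (S (psi k) x) * \1_(~` M) x) @ \oo --> gI x.
  rewrite /gI indicE; have [Mx|Mx] := pselect (M x).
    by rewrite memNset//= mulr0n; under eq_fun do rewrite mulr0; exact: is_cvg_cst.
  by rewrite mem_set//= mulr1n; under eq_fun do rewrite mulr1; exact: (cS x Mx).2.
pose g x := gR x +i* gI x.
have mMc : measurable (~` M) by exact: measurableC.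
have mg : cmeasurable g.
  split.
    apply: (measurable_fun_cvg _ (fun x _ => cgR x)) => k.
    by apply: measurable_funM; [exact: (in_L2_cmeasurable (S2 _)).1|exact: measurable_indic].
  apply: (measurable_fun_cvg _ (fun x _ => cgI x)) => k.
  by apply: measurable_funM; [exact: (in_L2_cmeasurable (S2 _)).2|exact: measurable_indic].
have cg (h : torus R d -> R[i]) (n : nat) : {ae mu, forall x,
    (fun k => normc (S (psi (k + n)%N) x - h x) ^+ 2) @ \oo --> normc (g x - h x) ^+ 2}.
  exists M; split => // x /= H; apply: contrapT => Mx; apply: H.
  rewrite sqr_normcE; under eq_fun do rewrite sqr_normcE.
  have E1 : \1_(~` M) x = 1 :> R by rewrite indicE mem_set.
  have /= R1 : (fun k => Re (S (psi (k + n)%N) x)) @ \oo --> gR x.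
    rewrite (cvg_shiftn n (fun k => Re (S (psi k) x))).
    by have := cgR x; rewrite E1; under eq_fun do rewrite mulr1.
  have /= I1 : (fun k => Im (S (psi (k + n)%N) x)) @ \oo --> gI x.
    rewrite (cvg_shiftn n (fun k => Im (S (psi k) x))).
    by have := cgI x; rewrite E1; under eq_fun do rewrite mulr1.
  have cB (u : nat -> R) l c : u @ \oo --> l -> (fun k => (u k - c) ^+ 2) @ \oo --> (l - c) ^+ 2.
    move=> ul; under eq_fun do rewrite expr2; rewrite expr2.
    by apply: cvgM; apply: cvgB => //; exact: cvg_cst.
  under eq_fun do rewrite !ReImE; rewrite !ReImE.
  by apply: cvgD; apply: cB.
(* Used twice: with [h] zero for the norm of [g], and with [h] a partial sum for the L^2 distance
   from [g] to it. The shift by n discards the early terms, whose distance to that partial sum is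
   not controlled. *)
have limS (h : torus R d -> R[i]) n (K : R) : in_L2 h ->
    (forall k, sqnorm (fun x => S (psi (k + n)%N) x - h x) <= K) ->
    in_L2 (fun x => g x - h x) /\ sqnorm (fun x => g x - h x) <= K.
  move=> h2 hK; have mgh := cmeasurableB mg (in_L2_cmeasurable h2).
  have iSh k := in_L2_integrable (in_L2B (S2 (psi (k + n)%N)) h2).
  have H : (\int[mu]_x (normc (g x - h x) ^+ 2)%:E <= K%:E)%E.
    apply: (fatou_real (F := fun k x => normc (S (psi (k + n)%N) x - h x) ^+ 2)).
    - by move=> k; apply: measurable_sqr_normc; apply: in_L2_cmeasurable; exact: in_L2B.
    - exact: measurable_sqr_normc.
    - by move=> k x; exact: sqr_ge0.
    - by move=> x; exact: sqr_ge0.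
    - exact: cg.
    - by move=> k; rewrite Rintegral_EFin// lee_fin; exact: hK.
  have ig : mu.-integrable setT (EFin \o (fun x => normc (g x - h x) ^+ 2)).
    apply/integrableP; split; first by apply/measurable_EFinP; exact: measurable_sqr_normc.
    apply: le_lt_trans (ltry K); apply: le_trans H.
    by under eq_integral do rewrite /= ger0_norm ?sqr_ge0//.
  split; first by apply/in_L2P.
  by move: H; rewrite Rintegral_EFin// lee_fin.
have [g2 gB] : in_L2 g /\ sqnorm g <= B ^+ 2.
  have : in_L2 (fun x => g x - 0) /\ sqnorm (fun x => g x - 0) <= B ^+ 2.
    apply: (limS _ 0%N); first exact: in_L2_0.
    move=> k; under eq_fun do rewrite subr0.
    by rewrite sqnorm_trigpoly ?vB'// count_enum_uniq.
  by under eq_fun do rewrite subr0.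
exists g; split => //; apply/funext => j.
have gS (l m : nat) : (N l <= m)%N ->
    in_L2 (fun x => g x - S m x) /\ sqnorm (fun x => g x - S m x) <= 4^-1 ^+ l.
  move=> lm; apply: (limS _ m) => // k; apply: SB => //.
  by rewrite (leq_trans _ (ltnW (psi_ge _)))// leq_addl.
(* Once m exceeds the rank of j, [S m] has coefficient [v j] exactly, so Bessel's inequality at the
   single frequency j bounds the error by the L^2 distance. *)
have bnd (l : nat) : vol * normc (fourier g j - v j) ^+ 2 <= 4^-1 ^+ l.
  pose m := maxn (N l) (pickle j).+1.
  have [gS2 gSl] := gS l m (leq_maxl _ _).
  apply: le_trans gSl; have := bessel_le gS2 (r := [:: j]) isT.
  rewrite big_seq1 fourierB; [|exact: in_L2_cintegrable..].
  rewrite fourier_trigpoly ?count_enum_uniq//.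
  by rewrite mem_count_enum leq_maxr.
have c0 : (fun l : nat => 4^-1 ^+ l : R) @ \oo --> (0 : R).
  by apply: cvg_expr; rewrite ger0_norm//; lra.
have : vol * normc (fourier g j - v j) ^+ 2 <= 0.
  rewrite -(cvg_lim (@Rhausdorff R) c0); apply: limr_ge; first by apply/cvg_ex; exists 0.
  exact: nearW.
rewrite pmulr_rle0 ?vol_gt0// => a0; apply/eqP; rewrite -subr_eq0; apply/eqP.
by apply: Normc.eq0_normc; apply/eqP; rewrite -sqrf_eq0 eq_le a0 sqr_ge0.
Qed.

Lemma l2le_sqnorm f (B : R) : in_L2 f -> l2le (fourier f) B -> sqnorm f <= B ^+ 2.
Proof.
move=> f2 fB; have [g [g2 fg gB]] := riesz_fischer fB.
rewrite (@eq_sqnorm_ae _ _ f g)//.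
by apply: fourier_inj_ae; rewrite ?fg//; exact: in_L2_cintegrable.
Qed.

Lemma L2norm_leP f (B : R) : in_L2 f ->
  (L2norm f <= B%:E)%E <-> l2le (fourier f) B.
Proof.
move=> f2; rewrite L2norm_sqnorm// lee_fin; split=> [fB|fB].
  have B0 : 0 <= B := le_trans (sqrtr_ge0 _) fB.
  apply: l2le_fourier => //.
  by rewrite -(sqr_sqrtr (sqnorm_ge0 f)) ler_sqr ?nnegrE ?sqrtr_ge0.
have [B0 _] := fB; rewrite -(ger0_norm B0) -sqrtr_sqr ler_sqrt ?sqr_ge0//.
exact: l2le_sqnorm.
Qed.

(** The infimum is not assumed to be attained: some representative has norm below B + e, which
    bounds the coefficients by B + e, and e tends to 0 in each finite sum. Conversely the
    Riesz-Fischer function is a competitor. *)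
Lemma distrib_L2norm_leP v (B : R) :
  (distrib_L2norm v <= B%:E)%E <-> l2le v B.
Proof.
split=> [vB|vB]; last first.
  have [g [g2 <- gB]] := riesz_fischer vB.
  apply: ge_ereal_inf; exists (L2norm g); first by exists g.
  by have [B0 _] := vB; apply/L2norm_leP => //; exact: l2le_fourier.
have Bge0 : 0 <= B.
  rewrite -lee_fin (le_trans _ vB)//; apply: le_ereal_inf_tmp => _ [g _ <-].
  exact: Lnorm_ge0.
have H (e : R) : 0 < e -> l2le v (B + e).
  move=> e0; have : (distrib_L2norm v < (B + e)%:E)%E.
    by rewrite (le_lt_trans vB)// lte_fin ltrDl.
  move=> /ereal_inf_lt[_ [g [g2 <-] <-]] /ltW ge.
  exact/L2norm_leP.
split => // r ur.
set X := (X in X <= _).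
have X0 : 0 <= X.
  by rewrite mulr_ge0 ?(ltW vol_gt0)// sumr_ge0// => j _; exact: sqr_ge0.
rewrite -(sqr_sqrtr X0) ler_sqr ?nnegrE ?sqrtr_ge0//.
apply/ler_addgt0Pr => e e0; have Be : 0 <= B + e by rewrite addr_ge0// ltW.
rewrite -(ger0_norm Be) -sqrtr_sqr ler_sqrt ?sqr_ge0//.
by have [_] := H e e0; apply.
Qed.

End RieszFischer.

(** * Convolution inequalities and products *)

Section FiniteInequalities.
Context {R : realType} {T : eqType}.
Implicit Types (r : seq T) (x y a b : T -> R).

Lemma le_sqr_addgt0 (X B : R) : 0 <= B ->
  (forall e, 0 < e -> X <= (B + e) ^+ 2) -> X <= B ^+ 2.
Proof.
move=> B0 XB; have [X0|X0] := leP X 0; first by rewrite (le_trans X0)// sqr_ge0.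
rewrite -(sqr_sqrtr (ltW X0)) ler_sqr ?nnegrE ?sqrtr_ge0//.
apply/ler_addgt0Pr => e e0; have Be : 0 <= B + e by rewrite addr_ge0// ltW.
by rewrite -(ger0_norm Be) -sqrtr_sqr ler_sqrt ?sqr_ge0//; exact: XB.
Qed.

Lemma cauchy_schwarz_sum r a b : (forall j, 0 <= a j) ->
  (\sum_(j <- r) a j * b j) ^+ 2 <=
  (\sum_(j <- r) a j) * (\sum_(j <- r) a j * b j ^+ 2).
Proof.
move=> a0; elim: r => [|i r IH]; first by rewrite !big_nil mul0r expr0n.
rewrite !big_cons.
set A := \sum_(j <- r) a j in IH *; set S := \sum_(j <- r) a j * b j in IH *.
set Q := \sum_(j <- r) _ in IH *.
have A0 : 0 <= A by exact: sumr_ge0.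
have Q0 : 0 <= Q by apply: sumr_ge0 => j _; rewrite mulr_ge0 ?sqr_ge0.
(* A times the bracket equals (A b_i - S)^2 + (A Q - S^2), nonnegative by the induction hypothesis;
   if A = 0, that hypothesis gives S = 0. *)
have key : 0 <= a i * (A * b i ^+ 2 + Q - 2 * b i * S).
  rewrite mulr_ge0//.
  have [Ap|A00] : 0 < A \/ A = 0 by move: A0; rewrite le_eqVlt => /predU1P[<-|]; [right|left].
    rewrite -(pmulr_rge0 _ Ap).
    have : 0 <= (A * b i - S) ^+ 2 by exact: sqr_ge0.
    by rewrite sqrrB; nra.
  have S0 : S = 0 by apply/eqP; rewrite -sqrf_eq0 eq_le sqr_ge0 andbT; rewrite A00 mul0r in IH.
  by rewrite S0 A00; lra.
by rewrite -subr_ge0 in IH; rewrite -subr_ge0; nra.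
Qed.

Lemma cauchy_schwarz_sum2 r x y : (\sum_(j <- r) x j * y j) ^+ 2 <=
  (\sum_(j <- r) x j ^+ 2) * (\sum_(j <- r) y j ^+ 2).
Proof.
(* The weights are x_j^2 and the values y_j / x_j; where x_j = 0 both terms are 0. *)
have -> : \sum_(j <- r) x j * y j = \sum_(j <- r) x j ^+ 2 * (y j / x j).
  apply: eq_bigr => j _; have [->|x0] := eqVneq (x j) 0; first by rewrite expr0n !mul0r.
  by field.
apply: (le_trans (cauchy_schwarz_sum _ _ (fun j => sqr_ge0 (x j)))).
apply: ler_wpM2l; first by apply: sumr_ge0 => j _; exact: sqr_ge0.
apply: ler_sum => j _.
have [->|x0] := eqVneq (x j) 0; first by rewrite expr0n mul0r sqr_ge0.
by rewrite le_eqVlt; apply/orP; left; apply/eqP; field.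
Qed.

Lemma minkowski_sum r x y (B C : R) : 0 <= B -> 0 <= C ->
  \sum_(j <- r) x j ^+ 2 <= B ^+ 2 -> \sum_(j <- r) y j ^+ 2 <= C ^+ 2 ->
  \sum_(j <- r) (x j + y j) ^+ 2 <= (B + C) ^+ 2.
Proof.
move=> B0 C0 xB yC.
have X0 : 0 <= \sum_(j <- r) x j ^+ 2 by apply: sumr_ge0 => j _; exact: sqr_ge0.
have Y0 : 0 <= \sum_(j <- r) y j ^+ 2 by apply: sumr_ge0 => j _; exact: sqr_ge0.
have xy : \sum_(j <- r) x j * y j <= B * C.
  apply: le_trans (ler_norm _) _.
  rewrite -ler_sqr ?nnegrE ?mulr_ge0// real_normK ?num_real//.
  by rewrite (le_trans (cauchy_schwarz_sum2 _ _ _))// exprMn ler_pM.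
have -> : \sum_(j <- r) (x j + y j) ^+ 2 = \sum_(j <- r) x j ^+ 2
    + 2 * (\sum_(j <- r) x j * y j) + \sum_(j <- r) y j ^+ 2.
  by rewrite mulr_sumr -!big_split /=; apply: eq_bigr => j _; ring.
nra.
Qed.

Lemma sum_sqr_le r x : (forall j, 0 <= x j) ->
  \sum_(j <- r) x j ^+ 2 <= (\sum_(j <- r) x j) ^+ 2.
Proof.
move=> x0; elim: r => [|i r IH]; first by rewrite !big_nil expr0n.
rewrite !big_cons sqrrD -addrA lerD2l (le_trans IH)// lerDr mulrn_wge0//.
by rewrite mulr_ge0// sumr_ge0.
Qed.

Definition l1b x (A : R) := forall r, uniq r -> \sum_(j <- r) x j <= A.
Definition l2b x (B : R) := 0 <= B /\ forall r, uniq r -> \sum_(j <- r) x j ^+ 2 <= B ^+ 2.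

Lemma l1b_ge0 x A : l1b x A -> 0 <= A.
Proof. by move=> /(_ [::] isT); rewrite big_nil. Qed.

Lemma l2b_le x y A B : l2b x A -> (forall j, 0 <= y j <= x j) -> A <= B -> l2b y B.
Proof.
move=> [A0 xA] yx AB; split; first exact: le_trans AB.
move=> r ur; apply: (@le_trans _ _ (A ^+ 2)); last by rewrite ler_sqr ?nnegrE// (le_trans A0).
apply: le_trans (xA r ur); apply: ler_sum => j _; have /andP[y0 yx0] := yx j.
by rewrite ler_sqr ?nnegrE// (le_trans y0).
Qed.

Lemma l2bD x y A B : l2b x A -> l2b y B -> l2b (fun j => x j + y j) (A + B).
Proof.
move=> [A0 xA] [B0 yB]; split; first exact: addr_ge0.
by move=> r ur; apply: minkowski_sum => //; [exact: xA|exact: yB].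
Qed.

Lemma l2bZ (c : R) x A : 0 <= c -> l2b x A -> l2b (fun j => c * x j) (c * A).
Proof.
move=> c0 [A0 xA]; split; first exact: mulr_ge0.
move=> r ur; under eq_bigr do rewrite exprMn.
by rewrite -mulr_sumr exprMn ler_wpM2l ?sqr_ge0//; exact: xA.
Qed.

End FiniteInequalities.

Section Convolution.
Context {R : realType} {d : nat}.
Local Notation J := (d.-tuple int).
Implicit Types (r F : seq J) (a b c m : J -> R) (j k : J).

Local Notation sub j k := (freq_add j (freq_opp k)).

Lemma sub_inj_r j : injective (fun k => sub j k).
Proof.
by move=> k k' /=; rewrite !(freq_addC j) => /(congr1 (fun t => freq_add t (freq_opp j)));
  rewrite !freq_addK => /(congr1 freq_opp); rewrite !freq_oppK.
Qed.

Lemma sub_inj_l k : injective (fun j => sub j k).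
Proof.
by move=> j j' /= /(congr1 (fun t => freq_add t k)); rewrite !freq_subK.
Qed.

Lemma sum_shift_l b k F (h : R -> R) : 
  \sum_(j <- F) h (b (sub j k)) = \sum_(i <- [seq sub j k | j <- F]) h (b i).
Proof. by rewrite big_map. Qed.

Lemma l1b_shift_l b B k : l1b b B -> l1b (fun j => b (sub j k)) B.
Proof.
move=> bB F uF; rewrite (sum_shift_l _ _ _ id); apply: bB.
by rewrite map_inj_uniq//; exact: sub_inj_l.
Qed.

Lemma l1b_shift_r b B j : l1b b B -> l1b (fun k => b (sub j k)) B.
Proof.
move=> bB F uF; rewrite -(big_map (fun k => sub j k) xpredT); apply: bB.
by rewrite map_inj_uniq//; exact: sub_inj_r.
Qed.

Lemma l2b_shift_l b B k : l2b b B -> l2b (fun j => b (sub j k)) B.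
Proof.
move=> [B0 bB]; split => // F uF.
rewrite (sum_shift_l _ _ _ (fun t => t ^+ 2)); apply: bB.
by rewrite map_inj_uniq//; exact: sub_inj_l.
Qed.

Lemma conv_l1 a b A B F r : (forall j, 0 <= a j) -> (forall j, 0 <= b j) ->
  l1b a A -> l1b b B -> uniq F -> uniq r ->
  \sum_(j <- F) \sum_(k <- r) a k * b (sub j k) <= A * B.
Proof.
move=> a0 b0 aA bB uF ur; rewrite exchange_big /=.
apply: (@le_trans _ _ (\sum_(k <- r) a k * B)).
  by apply: ler_sum => k _; rewrite -mulr_sumr ler_wpM2l//; exact: l1b_shift_l.
by rewrite -mulr_suml ler_wpM2r//; [exact: l1b_ge0 bB|exact: aA].
Qed.

(** Young's inequality: Cauchy-Schwarz with weights [a k] takes out one factor A, and exchanging the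
    sums gives the other one together with B^2. *)
Lemma conv_l1_l2 a b A B F r : (forall j, 0 <= a j) ->
  l1b a A -> l2b b B -> uniq F -> uniq r ->
  \sum_(j <- F) (\sum_(k <- r) a k * b (sub j k)) ^+ 2 <= (A * B) ^+ 2.
Proof.
move=> a0 aA bB uF ur; have A0 := l1b_ge0 aA.
apply: (@le_trans _ _ (\sum_(j <- F) A * \sum_(k <- r) a k * b (sub j k) ^+ 2)).
  apply: ler_sum => j _; apply: (le_trans (cauchy_schwarz_sum _ _ a0)).
  apply: ler_wpM2r; last exact: aA.
  by apply: sumr_ge0 => k _; rewrite mulr_ge0// sqr_ge0.
rewrite -mulr_sumr exchange_big /= exprMn [A ^+ 2]expr2 -mulrA ler_wpM2l//.
apply: (@le_trans _ _ (\sum_(k <- r) a k * B ^+ 2)).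
  apply: ler_sum => k _; rewrite -mulr_sumr ler_wpM2l//.
  by have [_] := l2b_shift_l k bB; apply.
by rewrite -mulr_suml ler_wpM2r ?sqr_ge0//; exact: aA.
Qed.

Lemma conv_l2_l1 a b A B F r : (forall j, 0 <= b j) ->
  l2b a A -> l1b b B -> uniq F -> uniq r ->
  \sum_(j <- F) (\sum_(k <- r) a k * b (sub j k)) ^+ 2 <= (A * B) ^+ 2.
Proof.
move=> b0 aA bB uF ur; have B0 := l1b_ge0 bB.
apply: (@le_trans _ _ (\sum_(j <- F) B * \sum_(k <- r) b (sub j k) * a k ^+ 2)).
  apply: ler_sum => j _; under eq_bigr do rewrite mulrC.
  apply: (le_trans (cauchy_schwarz_sum _ _ (fun k => b0 (sub j k)))).
  apply: ler_wpM2r; last by apply: (l1b_shift_r j bB).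
  by apply: sumr_ge0 => k _; rewrite mulr_ge0// sqr_ge0.
rewrite -mulr_sumr exchange_big /= exprMn [A ^+ 2 * _]mulrC [B ^+ 2]expr2 -mulrA ler_wpM2l//.
apply: (@le_trans _ _ (\sum_(k <- r) B * a k ^+ 2)).
  apply: ler_sum => k _; rewrite -mulr_suml ler_wpM2r ?sqr_ge0//.
  exact: l1b_shift_l.
by rewrite -mulr_sumr ler_wpM2l//; have [_] := aA; apply.
Qed.

(* [c] is dominated by the convolution of [a] and [b], stated with finite partial
   sums so that no summability is presupposed. *)
Definition convle c a b := forall j (e : R), 0 < e ->
  exists2 r, uniq r & c j <= \sum_(k <- r) a k * b (sub j k) + e.

(** Merging the lists found for the single frequencies only enlarges the partial sums, as their
    terms are nonnegative. *)
Lemma convle_uniform c a b F (e : R) : (forall j, 0 <= a j) -> (forall j, 0 <= b j) ->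
  convle c a b -> 0 < e -> exists2 r, uniq r &
  forall j, j \in F -> c j <= \sum_(k <- r) a k * b (sub j k) + e.
Proof.
move=> a0 b0 cab e0; elim: F => [|i F [r ur rF]]; first by exists [::].
have [r' ur' ci] := cab i e e0.
exists (undup (r ++ r')); first exact: undup_uniq.
have mono s j : uniq s -> {subset s <= r ++ r'} -> \sum_(k <- s) a k * b (sub j k) <=
    \sum_(k <- undup (r ++ r')) a k * b (sub j k).
  move=> us sr; apply: ler_sum_subset => //; first exact: undup_uniq.
    by move=> k /sr; rewrite mem_undup.
  by move=> k; rewrite mulr_ge0.
move=> j; rewrite inE => /predU1P[->|jF].
  rewrite (le_trans ci)// lerD2r mono// => k kr; by rewrite mem_cat kr orbT.
rewrite (le_trans (rF _ jF))// lerD2r mono// => k kr; by rewrite mem_cat kr.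
Qed.

Lemma convle_l1 c a b A B : (forall j, 0 <= a j) -> (forall j, 0 <= b j) ->
  convle c a b -> l1b a A -> l1b b B -> l1b c (A * B).
Proof.
move=> a0 b0 cab aA bB F uF; apply/ler_addgt0Pr => e e0.
(* The error is shared among the frequencies of [F]; the successor covers the empty list. *)
have e'0 : 0 < e / (size F).+1%:R by rewrite divr_gt0.
have [r ur rF] := convle_uniform F a0 b0 cab e'0.
apply: (@le_trans _ _ (\sum_(j <- F) (\sum_(k <- r) a k * b (sub j k) + e / (size F).+1%:R))).
  by rewrite big_seq [leRHS]big_seq; apply: ler_sum => j jF; exact: rF.
rewrite big_split /= lerD//; first exact: conv_l1.
rewrite big_const_seq count_predT iter_addr_0 -[_ *+ _]mulr_natr mulrAC ler_pdivrMr//.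
by rewrite ler_wpM2l ?ler_nat// ltW.
Qed.

Lemma convle_l2 c a b A B : (forall j, 0 <= a j) -> (forall j, 0 <= b j) ->
  (forall j, 0 <= c j) -> convle c a b -> l1b a A -> l2b b B -> l2b c (A * B).
Proof.
move=> a0 b0 c0 cab aA bB; have A0 := l1b_ge0 aA; have [B0 _] := bB.
split=> [|F uF]; first exact: mulr_ge0.
apply: le_sqr_addgt0; first exact: mulr_ge0.
move=> e e0.
have e'0 : 0 < e / (size F).+1%:R by rewrite divr_gt0.
have [r ur rF] := convle_uniform F a0 b0 cab e'0.
apply: (@le_trans _ _ (\sum_(j <- F) (\sum_(k <- r) a k * b (sub j k) + e / (size F).+1%:R) ^+ 2)).
  rewrite big_seq [leRHS]big_seq; apply: ler_sum => j jF.
  by rewrite ler_sqr ?nnegrE ?rF// (le_trans (c0 j))// rF.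
apply: minkowski_sum; [exact: mulr_ge0|exact: ltW|exact: conv_l1_l2|].
apply: (le_trans (sum_sqr_le _ (fun=> ltW e'0))).
rewrite ler_sqr ?nnegrE ?(ltW e0)//; last by apply: sumr_ge0 => j _; exact: ltW.
rewrite big_const_seq count_predT iter_addr_0 -[_ *+ _]mulr_natr mulrAC ler_pdivrMr//.
by rewrite ler_wpM2l ?ler_nat// ltW.
Qed.

(** Evenness is what conjugation asks for, since it reflects frequencies. Quasi-subadditivity covers
    constants and powers of |j| with the same [kappa]. *)
Definition weight (kappa : R) m := [/\ 1 <= kappa, (forall j, 0 <= m j),
  (forall j k, m (freq_add j k) <= kappa * (m j + m k)) & (forall j, m (freq_opp j) = m j)].

Lemma convle_weighted kappa m c a b A B X Y : weight kappa m ->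
  (forall j, 0 <= a j) -> (forall j, 0 <= b j) -> (forall j, 0 <= c j) ->
  convle c a b -> l1b a A -> l1b b B ->
  l2b (fun j => m j * a j) X -> l2b (fun j => m j * b j) Y ->
  l2b (fun j => m j * c j) (kappa * (X * B + A * Y)).
Proof.
move=> [k1 m0 mD _] a0 b0 c0 cab aA bB aX bY.
have A0 := l1b_ge0 aA; have B0 := l1b_ge0 bB; have [X0 _] := aX; have [Y0 _] := bY.
have k0 : 0 <= kappa by rewrite (le_trans _ k1).
have C0 : 0 <= kappa * (X * B + A * Y) by rewrite mulr_ge0// addr_ge0// mulr_ge0.
split=> // F uF; apply: le_sqr_addgt0 => // e e0.
have S0 : 0 < \sum_(j <- F) m j + 1 by rewrite ltr_wpDl// sumr_ge0.
have e'0 : 0 < e / (\sum_(j <- F) m j + 1) by rewrite divr_gt0.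
have [r ur rF] := convle_uniform F a0 b0 cab e'0.
set e' := e / _ in e'0 rF.
pose U j := \sum_(k <- r) (m k * a k) * b (sub j k).
pose V j := \sum_(k <- r) a k * (m (sub j k) * b (sub j k)).
apply: (@le_trans _ _ (\sum_(j <- F) (kappa * (U j + V j) + m j * e') ^+ 2)).
  rewrite big_seq [leRHS]big_seq; apply: ler_sum => j jF.
  have H : m j * c j <= kappa * (U j + V j) + m j * e'.
    apply: (le_trans (ler_wpM2l (m0 j) (rF _ jF))).
    rewrite mulrDr lerD2r mulr_sumr /U /V -big_split /= mulr_sumr.
    apply: ler_sum => k _.
    have := mD k (sub j k); rewrite freq_addC freq_subK.
    move=> /(ler_wpM2r (mulr_ge0 (a0 k) (b0 (sub j k)))).
    by move=> /le_trans -> //; rewrite le_eqVlt; apply/orP; left; apply/eqP; ring.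
  have := mulr_ge0 (m0 j) (c0 j) => mc0.
  by rewrite ler_sqr ?nnegrE// (le_trans mc0).
apply: minkowski_sum => //; first exact: ltW.
  rewrite exprMn; under eq_bigr do rewrite exprMn.
  rewrite -mulr_sumr ler_wpM2l ?sqr_ge0//; apply: minkowski_sum; rewrite ?mulr_ge0//.
    exact: (conv_l2_l1 (a := fun k => m k * a k)).
  exact: (conv_l1_l2 (b := fun k => m k * b k)).
apply: (le_trans (sum_sqr_le _ (fun j => mulr_ge0 (m0 j) (ltW e'0)))).
rewrite ler_sqr ?nnegrE ?(ltW e0)//; last first.
  by apply: sumr_ge0 => j _; rewrite mulr_ge0// ltW.
rewrite -mulr_suml /e' mulrCA ler_piMr ?(ltW e0)// ler_pdivrMr// mul1r.
by rewrite lerDl.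
Qed.

End Convolution.

Section Products.
Context {R : realType} {d : nat}.
Local Notation mu := (torus_measure R d).
Local Notation vol := ((2 * pi : R) ^+ d).
Implicit Types (f g : torus R d -> R[i]) (j k : d.-tuple int) (r : seq (d.-tuple int))
  (v w : d.-tuple int -> R[i]) (m : d.-tuple int -> R).

Definition wl1 v (A : R) := l1b (fun j => normc (v j)) A.
Definition wl2 m v (B : R) := l2b (fun j => m j * normc (v j)) B.

Lemma l2le_wl2 v (B : R) : l2le v B <-> wl2 (fun=> Num.sqrt vol) v B.
Proof.
have E r : \sum_(k <- r) (Num.sqrt vol * normc (v k)) ^+ 2 =
    vol * \sum_(k <- r) normc (v k) ^+ 2.
  rewrite mulr_sumr; apply: eq_bigr => k _.
  by rewrite exprMn sqr_sqrtr// ltW// vol_gt0.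
by split=> -[B0 vB]; split => // r ur; have := vB r ur; rewrite E.
Qed.

Lemma l2le_in_L2 f : in_L2 f -> l2le (fourier f) (Num.sqrt (sqnorm f)).
Proof.
move=> f2; apply: l2le_fourier => //.
by rewrite sqr_sqrtr// sqnorm_ge0.
Qed.

(** Expand the squared norm of f - t conj(g) with t = I / (1 + [sqnorm g]), I being the integral.
    The added 1 avoids a case distinction at g = 0 and costs nothing in the limiting argument where
    the bound is used. *)
Lemma cauchy_schwarz_cintegral f g : in_L2 f -> in_L2 g ->
  normc (cintegral (fun x => f x * g x)) ^+ 2 <= sqnorm f * (1 + sqnorm g).
Proof.
move=> f2 g2; set I := cintegral _; have G0 := sqnorm_ge0 g.
have s0 : 0 < 1 + sqnorm g by rewrite ltr_wpDr.
pose t : R[i] := ((1 + sqnorm g)^-1)%:C * I.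
have h2 : in_L2 (fun x => t * conjc (g x)) by apply: in_L2Z; exact: in_L2_conj.
have := sqnorm_ge0 (fun x => f x - t * conjc (g x)).
rewrite sqnormB//.
rewrite (_ : (fun x => f x * conjc (t * conjc (g x))) =
  (fun x => conjc t * (f x * g x))); last first.
  by apply/funext => x; rewrite conjM conjcK; ring.
rewrite cintegralZ -/I; last exact: cintegrableM.
rewrite (_ : sqnorm (fun x => t * conjc (g x)) = normc t ^+ 2 * sqnorm g); last first.
  rewrite /sqnorm -RintegralZl//; last exact: in_L2_integrable.
  by apply: eq_Rintegral => x _; rewrite Normc.normcM exprMn normc_conj.
have -> : Re (conjc t * I) = (1 + sqnorm g)^-1 * normc I ^+ 2.
  by rewrite sqr_normcE !ReImE /=; ring.
have -> : normc t ^+ 2 = (1 + sqnorm g)^-1 ^+ 2 * normc I ^+ 2.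
  by rewrite Normc.normcM exprMn normc_real ger0_norm// invr_ge0 ltW.
set a := normc I ^+ 2; have a0 : 0 <= a by exact: sqr_ge0.
set S := sqnorm g in G0 s0 *; set q := (1 + S)^-1.
have q0 : 0 < q by rewrite invr_gt0.
have qS : q * S = 1 - q by rewrite /q; field; rewrite gt_eqF.
have -> : sqnorm f - 2 * (q * a) + q ^+ 2 * a * S = sqnorm f - q * a - q ^+ 2 * a.
  have -> : q ^+ 2 * a * S = q * a * (q * S) by ring.
  by rewrite qS; ring.
move=> H; have {H} : q * a <= sqnorm f.
  by have := mulr_ge0 (sqr_ge0 q) a0; lra.
by rewrite /q mulrC -ler_pdivlMr// invrK mulrC mulrC.
Qed.

Lemma normc_fourierM f g j : in_L2 f -> in_L2 g ->
  normc (fourier (fun x => f x * g x) j) ^+ 2 <= vol^-1 ^+ 2 * (sqnorm f * (1 + sqnorm g)).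
Proof.
move=> f2 g2; rewrite fourierE Normc.normcM exprMn normc_real ger0_norm; last first.
  by rewrite invr_ge0 ltW// vol_gt0.
rewrite ler_wpM2l ?sqr_ge0//.
have ge2 : in_L2 (fun x => g x * conjc (char j x)).
  apply: (in_L2_dominated _ (in_L2_integrable g2)).
    apply: cmeasurableM; first exact: in_L2_cmeasurable.
    by apply: cmeasurable_conj; exact: cmeasurable_char.
  by move=> x; rewrite Normc.normcM normc_conj normc_char mulr1.
have -> : sqnorm g = sqnorm (fun x => g x * conjc (char j x)).
  by apply: eq_Rintegral => x _; rewrite Normc.normcM normc_conj normc_char mulr1.
have := cauchy_schwarz_cintegral f2 ge2.
by under eq_fun do rewrite mulrA.
Qed.

(** Replace [f] by its partial sum over a finite list: its product with [g] has exactly a finite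
    convolution as coefficients, and the remainder is controlled by Cauchy-Schwarz for integrals. *)
Lemma fourierM_convle f g : in_L2 f -> in_L2 g ->
  convle (fun j => normc (fourier (fun x => f x * g x) j))
    (fun k => normc (fourier f k)) (fun k => normc (fourier g k)).
Proof.
move=> f2 g2 j e e0; have v0 := vol_gt0 (R := R) (d := d).
(* Tuned so that [normc_fourierM], applied to the remainder, returns e^2. *)
pose e' := e ^+ 2 * vol ^+ 2 / (1 + sqnorm g).
have s0 : 0 < 1 + sqnorm g by rewrite ltr_wpDr// sqnorm_ge0.
have e'0 : 0 < e' by rewrite divr_gt0// mulr_gt0// exprn_gt0.
have [r ur tail] := l2le_tail (l2le_in_L2 f2) e'0.
exists r => //; pose h := trigpoly r (fourier f).
have h2 : in_L2 h by exact: in_L2_trigpoly.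
have fh2 : in_L2 (fun x => f x - h x) by exact: in_L2B.
have fh : sqnorm (fun x => f x - h x) <= e'.
  rewrite -(sqr_sqrtr (ltW e'0)); apply: l2le_sqnorm => //.
  split; first exact: sqrtr_ge0.
  move=> F uF; rewrite sqr_sqrtr ?(ltW e'0)//.
  rewrite (bigID (mem r))/= big1 ?add0r => [|k kr]; last first.
    rewrite fourierB ?fourier_trigpoly ?kr ?subrr ?Normc.normc0 ?expr0n//;
      exact: in_L2_cintegrable.
  rewrite -big_filter.
  apply: le_trans (tail [seq k <- F | k \notin r] (filter_uniq _ uF) _); last first.
    by move=> k; rewrite mem_filter => /andP[].
  rewrite ler_wpM2l ?(ltW v0)// big_filter [leRHS]big_filter.
  apply: ler_sum => k /negPf kr.
  by rewrite fourierB ?fourier_trigpoly ?kr ?subr0//; exact: in_L2_cintegrable.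
have hg : fourier (fun x => h x * g x) j =
    \sum_(k <- r) fourier f k * fourier g (freq_add j (freq_opp k)).
  under eq_fun do rewrite mulr_suml.
  rewrite fourier_sum => [|k]; last first.
    by apply: cintegrableM => //; apply: in_L2Z; exact: in_L2_char.
  apply: eq_bigr => k _; under eq_fun do rewrite -mulrA.
  rewrite fourierZ ?fourier_mul_char//.
  by apply: cintegrableM => //; exact: in_L2_char.
have -> : fourier (fun x => f x * g x) j =
    fourier (fun x => h x * g x) j + fourier (fun x => (f x - h x) * g x) j.
  rewrite -fourierD; [|exact: cintegrableM..].
  by congr fourier; apply/funext => x; rewrite -mulrDl addrC subrK.
apply: (le_trans (le_normcD _ _)); apply: lerD.
  rewrite hg (le_trans (normc_sum _ _))//; apply: ler_sum => k _.
  by rewrite Normc.normcM.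
rewrite -ler_sqr ?nnegrE ?normc_ge0 ?(ltW e0)//.
apply: (le_trans (normc_fourierM _ fh2 g2)).
apply: (@le_trans _ _ (vol^-1 ^+ 2 * (e' * (1 + sqnorm g)))).
  by rewrite ler_wpM2l ?sqr_ge0// ler_wpM2r// ltW.
rewrite /e' divfK ?gt_eqF// exprVn mulrCA mulVf ?mulr1// expf_neq0// gt_eqF//.
Qed.

Lemma in_L2_ae f g : cmeasurable f -> in_L2 g -> {ae mu, forall x, f x = g x} -> in_L2 f.
Proof.
move=> mf /in_L2_integrable ig fg; apply/in_L2P; split => //.
have mfs : measurable_fun setT (EFin \o (fun x => normc (f x) ^+ 2)).
  by apply/measurable_EFinP; exact: measurable_sqr_normc.
have /integrableP[mg lg] := ig; apply/integrableP; split => //.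
rewrite (ae_eq_integral (fun x => `|(normc (g x) ^+ 2)%:E|%E))//.
- exact: measurableT_comp.
- exact: measurableT_comp.
- by apply: filterS fg => x /= -> _.
Qed.

(** A product of two L^2 functions is a priori only integrable. Riesz-Fischer provides an L^2
    function with the same coefficients, and coefficients determine integrable functions almost
    everywhere. *)
Lemma l2le_cintegrable_in_L2 f (B : R) : cintegrable f -> l2le (fourier f) B -> in_L2 f.
Proof.
move=> fi fB; have [g [g2 fg _]] := riesz_fischer fB.
apply: (in_L2_ae (cintegrable_measurable fi) g2).
by apply: fourier_inj_ae => //; [exact: in_L2_cintegrable|rewrite fg].
Qed.

Let coef_ge0 v k : 0 <= normc (v k). Proof. exact: normc_ge0. Qed.

Lemma wl1M f g (A B : R) : in_L2 f -> in_L2 g -> wl1 (fourier f) A -> wl1 (fourier g) B ->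
  wl1 (fourier (fun x => f x * g x)) (A * B).
Proof.
move=> f2 g2 fA gB.
exact: (convle_l1 (coef_ge0 _) (coef_ge0 _) (fourierM_convle f2 g2)).
Qed.

Lemma wl2M (c : R) f g (A B : R) : 0 <= c -> in_L2 f -> in_L2 g -> wl1 (fourier f) A ->
  wl2 (fun=> c) (fourier g) B ->
  wl2 (fun=> c) (fourier (fun x => f x * g x)) (A * B).
Proof.
move=> c0 f2 g2 fA gB; apply: (convle_l2 (coef_ge0 _) _ _ _ fA gB).
- by move=> j; rewrite mulr_ge0.
- by move=> j; rewrite mulr_ge0.
move=> j e e0; have c1 : 0 < c + 1 by rewrite ltr_wpDl.
have [r ur H] := fourierM_convle f2 g2 j (divr_gt0 e0 c1).
exists r => //; apply: (le_trans (ler_wpM2l c0 H)); rewrite mulrDr; apply: lerD.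
  by rewrite mulr_sumr; apply: ler_sum => k _; rewrite mulrCA.
by rewrite mulrCA ler_piMr ?(ltW e0)// ler_pdivrMr// mul1r lerDl.
Qed.

Lemma in_L2M f g (A : R) : in_L2 f -> in_L2 g -> wl1 (fourier f) A ->
  in_L2 (fun x => f x * g x).
Proof.
move=> f2 g2 fA; apply: (@l2le_cintegrable_in_L2 _ (A * Num.sqrt (sqnorm g))).
  exact: cintegrableM.
apply/l2le_wl2; apply: wl2M => //.
by apply/l2le_wl2; exact: l2le_in_L2.
Qed.

Lemma wl2_weightedM kappa m f g (A B X Y : R) : weight kappa m -> in_L2 f -> in_L2 g ->
  wl1 (fourier f) A -> wl1 (fourier g) B -> wl2 m (fourier f) X -> wl2 m (fourier g) Y ->
  wl2 m (fourier (fun x => f x * g x)) (kappa * (X * B + A * Y)).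
Proof.
move=> wm f2 g2 fA gB fX gY.
exact: (convle_weighted wm (coef_ge0 _) (coef_ge0 _) (coef_ge0 _) (fourierM_convle f2 g2)).
Qed.

Lemma freq_opp_inj : injective (@freq_opp d).
Proof. exact: can_inj freq_oppK. Qed.

Lemma wl1_conj f (A : R) : in_L2 f -> wl1 (fourier f) A ->
  wl1 (fourier (fun x => conjc (f x))) A.
Proof.
move=> /in_L2_cintegrable fi fA r ur; under eq_bigr do rewrite fourier_conj ?normc_conj//.
rewrite -(big_map (@freq_opp d) xpredT (fun k => normc (fourier f k))).
by apply: fA; rewrite map_inj_uniq//; exact: freq_opp_inj.
Qed.

Lemma wl2_conj m f (X : R) : (forall j, m (freq_opp j) = m j) -> in_L2 f ->
  wl2 m (fourier f) X -> wl2 m (fourier (fun x => conjc (f x))) X.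
Proof.
move=> mN /in_L2_cintegrable fi [X0 fX]; split => // r ur.
under eq_bigr do rewrite fourier_conj ?normc_conj// -mN.
rewrite -(big_map (@freq_opp d) xpredT (fun k => (m k * normc (fourier f k)) ^+ 2)).
by apply: fX; rewrite map_inj_uniq//; exact: freq_opp_inj.
Qed.

End Products.

(** * The power nonlinearity in weighted norms *)

Section PowerNonlinearity.
Context {R : realType} {d : nat}.
Implicit Types (f g : torus R d -> R[i]) (j k : d.-tuple int) (p : nat)
  (v w : d.-tuple int -> R[i]) (m : d.-tuple int -> R).

Lemma wl2D m v w (X Y : R) : (forall j, 0 <= m j) -> wl2 m v X -> wl2 m w Y ->
  wl2 m (fun j => v j + w j) (X + Y).
Proof.
move=> m0 vX wY; apply: (l2b_le (l2bD vX wY)) => // j.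
by rewrite mulr_ge0 ?normc_ge0//= -mulrDr ler_wpM2l// le_normcD.
Qed.

Lemma wl2N m v (X : R) : wl2 m v X -> wl2 m (fun j => - v j) X.
Proof. by rewrite /wl2; under [X in _ -> l2b X _]eq_fun do rewrite normcN. Qed.

Lemma wl2B m v w (X Y : R) : (forall j, 0 <= m j) -> wl2 m v X -> wl2 m w Y ->
  wl2 m (fun j => v j - w j) (X + Y).
Proof. by move=> m0 vX /wl2N; exact: wl2D. Qed.

Lemma wl2_le m v (X Y : R) : (forall j, 0 <= m j) -> wl2 m v X -> X <= Y -> wl2 m v Y.
Proof.
move=> m0 vX XY; apply: (l2b_le vX) => // j.
by rewrite lexx mulr_ge0// normc_ge0.
Qed.

Lemma power_nonlinearity0 f : power_nonlinearity 0 f = f.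
Proof. by apply/funext => x; rewrite /power_nonlinearity expr0 mul1r. Qed.

(** Writing |f|^2 as f times its conjugate makes the nonlinearity an iterated product, so every
    estimate on it is an induction adding two factors. *)
Lemma power_nonlinearityS p f : power_nonlinearity p.+1 f =
  fun x => f x * (conjc (f x) * power_nonlinearity p f x).
Proof.
apply/funext => x; rewrite /power_nonlinearity [RHS]mulrA mul_conj [RHS]mulrA.
by rewrite -rmorphM /= -exprD mulnS.
Qed.

Lemma power_nonlinearity_wl1 p f (B : R) : in_L2 f -> wl1 (fourier f) B ->
  in_L2 (power_nonlinearity p f) /\
  wl1 (fourier (power_nonlinearity p f)) (B ^+ (2 * p + 1)).
Proof.
move=> f2 fB; elim: p => [|p [IH2 IHB]]; first by rewrite power_nonlinearity0.
have cf2 := in_L2_conj f2; have cfB := wl1_conj f2 fB.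
have h2 := in_L2M cf2 IH2 cfB; have hB := wl1M cf2 IH2 cfB IHB.
rewrite power_nonlinearityS; split; first exact: in_L2M fB.
have -> : (2 * p.+1 + 1 = (2 * p + 1).+2)%N by rewrite mulnS -addnA.
by rewrite !exprS; exact: wl1M.
Qed.

Lemma power_nonlinearity_wl2 kappa m p f (B X : R) : weight kappa m -> in_L2 f ->
  wl1 (fourier f) B -> wl2 m (fourier f) X ->
  wl2 m (fourier (power_nonlinearity p f))
    ((2 * p + 1)%:R * kappa ^+ (2 * p) * B ^+ (2 * p) * X).
Proof.
move=> wm f2 fB fX; have [k1 m0 _ mN] := wm; have B0 : 0 <= B := l1b_ge0 fB.
have [X0 _] := fX; have k0 : 0 <= kappa by rewrite (le_trans _ k1).
elim: p => [|p IH]; first by rewrite power_nonlinearity0 !expr0 !mul1r.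
have cf2 := in_L2_conj f2; have cfB := wl1_conj f2 fB; have cfX := wl2_conj mN f2 fX.
have [g2 gB] := power_nonlinearity_wl1 p f2 fB.
have h2 := in_L2M cf2 g2 cfB; have hB := wl1M cf2 g2 cfB gB.
have hX := wl2_weightedM wm cf2 g2 cfB gB cfX IH.
rewrite power_nonlinearityS.
apply: (wl2_le m0 (wl2_weightedM wm f2 h2 fB hB fX hX)).
rewrite mulnS (exprD kappa 2 (2 * p)) (exprD B 2 (2 * p)) (exprD B (2 * p) 1) expr1.
set Q := B ^+ (2 * p); set K := kappa ^+ (2 * p).
have Q0 : 0 <= Q by rewrite exprn_ge0.
have K1 : 1 <= K by rewrite exprn_ege1.
have -> : (2 + 2 * p + 1)%:R = (2 * p + 1)%:R + 2 :> R by rewrite -addnA addnC natrD.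
set n := (2 * p + 1)%:R.
have T0 : 0 <= X * Q * B ^+ 2 by rewrite !mulr_ge0// sqr_ge0.
(* Up to the common factor X Q B^2, two products give kappa (1 + kappa + n kappa K) against the
   claimed (n + 2) kappa^2 K; the surplus is nonnegative because kappa and K are at least 1. *)
rewrite -subr_ge0.
rewrite [X in 0 <= X](_ : _ =
    kappa * ((K * kappa - 1) + kappa * (K - 1)) * (X * Q * B ^+ 2)); last by ring.
apply: mulr_ge0 => //; apply: mulr_ge0 => //; apply: addr_ge0.
  by rewrite subr_ge0 mulr_ege1.
by rewrite mulr_ge0// subr_ge0.
Qed.

(** Telescoping of the products: first f, then its conjugate, then the lower power is exchanged, the
    other factors staying bounded in [l^1]. The three differences count 1, 1 and 2 p + 1, in total 2
    p + 3. *)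
Lemma power_nonlinearity_lipschitz (c : R) p f g (B D : R) : 0 <= c ->
  in_L2 f -> in_L2 g -> wl1 (fourier f) B -> wl1 (fourier g) B ->
  wl2 (fun=> c) (fourier (fun x => f x - g x)) D ->
  wl2 (fun=> c) (fourier (fun x => power_nonlinearity p f x - power_nonlinearity p g x))
    ((2 * p + 1)%:R * B ^+ (2 * p) * D).
Proof.
move=> c0 f2 g2 fB gB fgD.
elim: p => [|p IH]; first by rewrite !power_nonlinearity0 expr0 !mul1r.
have fg2 := in_L2B f2 g2.
have [F2 FB] := power_nonlinearity_wl1 p f2 fB.
have [G2 GB] := power_nonlinearity_wl1 p g2 gB.
have FG2 := in_L2B F2 G2.
have cf2 := in_L2_conj f2; have cfB := wl1_conj f2 fB.
have cg2 := in_L2_conj g2; have cgB := wl1_conj g2 gB.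
have cfg2 := in_L2_conj fg2.
have cfgD : wl2 (fun=> c) (fourier (fun x => conjc (f x - g x))) D by exact: wl2_conj.
have h1 := wl2M c0 (in_L2M cf2 F2 cfB) fg2 (wl1M cf2 F2 cfB FB) fgD.
have h2 := wl2M c0 g2 (in_L2M F2 cfg2 FB) gB (wl2M c0 F2 cfg2 FB cfgD).
have h3 := wl2M c0 g2 (in_L2M cg2 FG2 cgB) gB (wl2M c0 cg2 FG2 cgB IH).
have i1 := in_L2M (in_L2M cf2 F2 cfB) fg2 (wl1M cf2 F2 cfB FB).
have i2 := in_L2M g2 (in_L2M F2 cfg2 FB) gB.
have i3 := in_L2M g2 (in_L2M cg2 FG2 cgB) gB.
have m0 (j : d.-tuple int) : 0 <= c by [].
have := wl2D m0 (wl2D m0 h1 h2) h3.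
rewrite (_ : (fun j => _) = fourier (fun x =>
   power_nonlinearity p.+1 f x - power_nonlinearity p.+1 g x)); last first.
  apply/funext => j; rewrite -!fourierD; try exact: in_L2_cintegrable; last first.
    by apply: in_L2_cintegrable; exact: in_L2D.
  congr (fourier _ j); apply/funext => x; rewrite !power_nonlinearityS rmorphB /=; ring.
move=> H; apply: (wl2_le m0 H); rewrite le_eqVlt; apply/orP; left; apply/eqP.
rewrite mulnS (exprD B 2 (2 * p)) (exprD B (2 * p) 1) expr1.
have -> : (2 + 2 * p + 1)%:R = (2 * p + 1)%:R + 2 :> R by rewrite -addnA addnC natrD.
ring.
Qed.

End PowerNonlinearity.

Section SobolevWeight.
Context {R : realType} {d : nat}.
Implicit Types (j k : d.-tuple int).
Local Notation freq_norm := (@freq_norm R d).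

Lemma freq_norm_ge0 j : 0 <= freq_norm j.
Proof. exact: sqrtr_ge0. Qed.

Lemma sqr_freq_norm j : freq_norm j ^+ 2 = \sum_(i < d) (tnth j i)%:~R ^+ 2.
Proof. by rewrite sqr_sqrtr// sumr_ge0// => i _; exact: sqr_ge0. Qed.

Lemma freq_norm_opp j : freq_norm (freq_opp j) = freq_norm j.
Proof.
congr Num.sqrt; apply: eq_bigr => i _.
by rewrite tnth_mktuple mulrNz sqrrN.
Qed.

Lemma freq_norm_add j k : freq_norm (freq_add j k) <= freq_norm j + freq_norm k.
Proof.
rewrite -ler_sqr ?nnegrE ?addr_ge0 ?freq_norm_ge0// sqr_freq_norm.
under eq_bigr do rewrite tnth_mktuple intrD.
by apply: minkowski_sum; rewrite ?freq_norm_ge0 ?sqr_freq_norm.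
Qed.

Lemma sobolev_weight (s : R) : 0 <= s ->
  weight (2 `^ s) (fun j => freq_norm j `^ s).
Proof.
move=> s0; split.
- by rewrite -[leLHS](powRr0 2) ler_powR// ler1n.
- by move=> j; exact: powR_ge0.
- move=> j k; set a := freq_norm j; set b := freq_norm k.
  have a0 : 0 <= a := freq_norm_ge0 j.
  apply: (@le_trans _ _ ((2 * Num.max a b) `^ s)).
    apply: ge0_ler_powR => //; rewrite ?nnegrE ?freq_norm_ge0//.
      by rewrite mulr_ge0// le_max a0.
    apply: (le_trans (freq_norm_add j k)).
    by rewrite mulr_natl mulr2n lerD// le_max lexx ?orbT.
  rewrite powRM ?le_max ?a0// ler_wpM2l ?powR_ge0//.
  by case: (leP a b) => _; rewrite ?lerDl ?lerDr powR_ge0.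
- by move=> j; rewrite freq_norm_opp.
Qed.

End SobolevWeight.

Section FrequencySeries.
Context {R : realType}.

(** Replaces comparison with an integral. After y^(-b) is factored out, with x = n and y = n + 1, it
    follows from e^u >= 1 + u and ln (x / y) <= x / y - 1. *)
Lemma powR_telescope (b : R) (n : nat) : 0 < b -> (0 < n)%N ->
  b * n.+1%:R `^ (- b - 1) <= n%:R `^ (- b) - n.+1%:R `^ (- b).
Proof.
move=> b0 n0.
have x0 : 0 < n%:R :> R by rewrite ltr0n.
have y0 : 0 < n.+1%:R :> R by rewrite ltr0n.
set x := n%:R in x0 *; set y := n.+1%:R in y0 *.
have yE : y = x + 1 by rewrite /y -natr1.
have -> : y `^ (- b - 1) = y `^ (- b) / y.
  by rewrite powRD ?(gt_eqF y0) ?implybT// powR_inv1 ?(ltW y0).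
have -> : x `^ (- b) = y `^ (- b) * expR (b * ln (y / x)).
  rewrite !/powR !gt_eqF// -expRD lnM ?posrE ?invr_gt0// lnV ?posrE//.
  by congr expR; ring.
rewrite mulrCA -[X in _ - X]mulr1 -mulrBr ler_wpM2l ?powR_ge0//.
rewrite lerBrDr (le_trans _ (expR_ge1Dx _))// addrC lerD2l ler_wpM2l ?(ltW b0)//.
have : ln (x / y) <= x / y - 1.
  have := expR_ge1Dx (ln (x / y)); rewrite lnK ?posrE ?divr_gt0// => H.
  by rewrite lerBrDr addrC.
rewrite (_ : ln (x / y) = - ln (y / x)); last first.
  by rewrite -lnV ?posrE ?divr_gt0// invf_div.
have -> : x / y - 1 = - y^-1; last by rewrite lerN2.
by rewrite yE; field; rewrite -yE gt_eqF.
Qed.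

Lemma sum_powR_nat (a : R) (n : nat) : 1 < a ->
  \sum_(1 <= k < n.+1) k%:R `^ (- a) <= 1 + (a - 1)^-1.
Proof.
move=> a1; have b0 : 0 < a - 1 by rewrite subr_gt0.
case: n => [|n]; first by rewrite big_geq// addr_ge0// invr_ge0 ltW.
rewrite big_nat_recl// powR1 lerD2l.
suff H : (a - 1) * \sum_(1 <= k < n.+1) k.+1%:R `^ (- a) <= 1 - n.+1%:R `^ (- (a - 1)).
  by rewrite -(ler_pM2l b0) mulfV ?gt_eqF// (le_trans H)// gerBl powR_ge0.
elim: n => [|n IH]; first by rewrite big_geq// mulr0 powR1 subrr.
rewrite big_nat_recr//= mulrDr; have := powR_telescope b0 (ltn0Sn n).
have -> : - (a - 1) - 1 = - a by ring.
by move: IH; lra.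
Qed.

End FrequencySeries.

(** * Embedding of Sobolev spaces into absolutely convergent series *)

Section LatticeSums.
Context {R : realType}.

Lemma ler_sum_undup (T : eqType) (s : seq T) (x : T -> R) : (forall j, 0 <= x j) ->
  \sum_(j <- undup s) x j <= \sum_(j <- s) x j.
Proof.
move=> x0; elim: s => [|i s IH] //=; rewrite big_cons.
case: ifP => _; first by rewrite (le_trans IH)// lerDr.
by rewrite big_cons lerD2l.
Qed.

Definition int_weight (a : R) (k : int) : R := (maxn 1 `|k|)%:R `^ (- a).

Lemma sum_int_weight (a : R) (r : seq int) : 1 < a -> uniq r ->
  \sum_(k <- r) int_weight a k <= 1 + 2 * (1 + (a - 1)^-1).
Proof.
move=> a1 ur; have w0 k : 0 <= int_weight a k by exact: powR_ge0.
pose N := (\max_(k <- r) `|k|%N)%N.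
pose L := 0 :: [seq Posz n | n <- index_iota 1 N.+1] ++ [seq - Posz n | n <- index_iota 1 N.+1].
apply: (@le_trans _ _ (\sum_(k <- L) int_weight a k)).
  apply: le_trans (ler_sum_undup L w0); apply: ler_sum_subset => //.
    exact: undup_uniq.
  move=> k kr; rewrite mem_undup /L.
  have kN : (`|k| <= N)%N by rewrite /N (big_rem k)//= leq_max leqnn.
  rewrite inE; have [//|k0] := eqVneq k 0.
  rewrite /= mem_cat; apply/orP; case: k k0 kr kN => n k0 kr kN.
    left; apply/mapP; exists n => //; rewrite mem_index_iota ltnS kN andbT.
    by rewrite lt0n.
  right; apply/mapP; exists n.+1; last by rewrite NegzE.
  by rewrite mem_index_iota.
rewrite big_cons big_cat /= !big_map /=.
have E : \sum_(1 <= n < N.+1) int_weight a n <= 1 + (a - 1)^-1.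
  apply: le_trans (sum_powR_nat N a1); rewrite !big_nat; apply: ler_sum => n /andP[n1 _].
  by rewrite /int_weight /= (maxn_idPr n1).
have E' : \sum_(1 <= n < N.+1) int_weight a (- n%:Z) <= 1 + (a - 1)^-1.
  by under eq_bigr do rewrite /int_weight abszN -/(int_weight a _).
have -> : int_weight a 0 = 1 by rewrite /int_weight /= powR1.
by move: E E'; lra.
Qed.

(** Any list of tuples lies in a product of a list of first entries and a list of remainders, over
    which the sum factorises; nonnegativity allows the enlargement. *)
Lemma sum_prod_weight (h : int -> R) (W : R) d (r : seq (d.-tuple int)) :
  (forall k, 0 <= h k) -> (forall s, uniq s -> \sum_(k <- s) h k <= W) -> uniq r ->
  \sum_(j <- r) \prod_(i < d) h (tnth j i) <= W ^+ d.
Proof.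
move=> h0 hW.
elim: d r => [|d IH] r ur.
  apply: (@le_trans _ _ (\sum_(j <- [:: [tuple] : 0.-tuple int]) \prod_(i < 0) h (tnth j i))).
    apply: ler_sum_subset => //; first by move=> j _; rewrite tuple0 mem_seq1.
    by move=> j; rewrite big_ord0.
  by rewrite big_seq1 big_ord0 expr0.
pose K := undup [seq thead j | j <- r]; pose 
  S := undup [seq ([tuple of behead j] : d.-tuple int) | j : d.+1.-tuple int <- r].
pose c (k : int) (t : d.-tuple int) : d.+1.-tuple int := [tuple of k :: t].
pose L := [seq c k t | k <- K, t <- S].
have uL : uniq L.
  apply: allpairs_uniq; rewrite ?undup_uniq// => -[k t] [k' t'] _ _ /= E.
  by have := congr1 val E => /= -[-> /val_inj ->].
have P0 n (j : n.-tuple int) : 0 <= \prod_(i < n) h (tnth j i) by exact: prodr_ge0.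
apply: (@le_trans _ _ (\sum_(j <- L) \prod_(i < d.+1) h (tnth j i))).
  apply: ler_sum_subset => //.
  move=> j jr; apply/allpairsP; exists (thead j, [tuple of behead j]) => /=; split.
  - by rewrite mem_undup; apply/mapP; exists j.
  - by rewrite mem_undup; apply/mapP; exists j.
  - by rewrite [LHS]tuple_eta; apply: val_inj.
rewrite big_allpairs_dep /= exprS.
under eq_bigr => k _.
  under eq_bigr => t _.
    rewrite big_ord_recl (tnth0 k t).
    rewrite (_ : \prod_(i < d) _ = \prod_(i < d) h (tnth t i)); last first.
      by apply: eq_bigr => i _; rewrite tnthS.
  over.
  rewrite -mulr_sumr.
over.
rewrite -mulr_suml ler_pM//.
- exact: sumr_ge0.
- exact: sumr_ge0.
- by apply: hW; exact: undup_uniq.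
- by apply: IH; exact: undup_uniq.
Qed.

Lemma prod_powR n (x a : R) : \prod_(i < n) x `^ a = x `^ a ^+ n.
Proof. by rewrite prodr_const card_ord. Qed.

Lemma freq_norm_ge_coord d (j : d.-tuple int) (i : 'I_d) :
  (`|tnth j i|%N)%:R <= freq_norm j :> R.
Proof.
rewrite -ler_sqr ?nnegrE ?freq_norm_ge0// sqr_freq_norm (bigD1 i)//=.
rewrite natr_absz intr_norm real_normK ?num_real// lerDl.
by apply: sumr_ge0 => k _; exact: sqr_ge0.
Qed.

Definition freq_weight d (j : d.-tuple int) : R := Num.max 1 (freq_norm j).

Lemma freq_weight_ge1 d (j : d.-tuple int) : 1 <= freq_weight j.
Proof. by rewrite le_max lexx. Qed.

(** The exponent is shared among the coordinates: max(1, |j|) is at least max(1, |j_i|) for each i,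
    so the sum is dominated by a product of d one-dimensional sums of exponent a = 2 s0 / d, and s0
    > d / 2 says a > 1. *)
Lemma sum_freq_weight d (s0 : R) : (0 < d)%N -> d%:R / 2 < s0 ->
  exists2 C : R, 0 <= C & forall r : seq (d.-tuple int), uniq r ->
    \sum_(j <- r) freq_weight j `^ (- (2 * s0)) <= C.
Proof.
move=> d0 hs0; have dR : 0 < d%:R :> R by rewrite ltr0n.
pose a := 2 * s0 / d%:R.
have a1 : 1 < a.
  by rewrite /a ltr_pdivlMr// mul1r mulrC -ltr_pdivrMr.
pose W := 1 + 2 * (1 + (a - 1)^-1).
have W0 : 0 <= W by rewrite addr_ge0// mulr_ge0// addr_ge0// invr_ge0 subr_ge0 ltW.
exists (W ^+ d); first exact: exprn_ge0.
move=> r ur; apply: le_trans (sum_prod_weight (h := int_weight a) _ _ ur); last 2 first.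
- by move=> k; exact: powR_ge0.
- by move=> s us; exact: sum_int_weight.
apply: ler_sum => j _.
have L0 : 0 < freq_weight j by rewrite (lt_le_trans ltr01)// freq_weight_ge1.
have -> : freq_weight j `^ (- (2 * s0)) = \prod_(i < d) freq_weight j `^ (- a).
  rewrite prod_powR -powR_mulrn ?powR_ge0// -powRrM; congr powR.
  by rewrite /a; field; rewrite gt_eqF.
apply: ler_prod => i _; rewrite powR_ge0 /= /int_weight !powRN lef_pV2 ?posrE ?powR_gt0//.
  apply: ge0_ler_powR; rewrite ?nnegrE ?(ltW L0)//; first by rewrite (le_trans _ (ltW a1)).
  have [_|_] := leqP `|tnth j i|%N 1%N; first exact: freq_weight_ge1.
  by rewrite le_max freq_norm_ge_coord orbT.
Qed.

(** [lam] is (2 M)^(s1 - s0) in the a priori bound, where the gain matters, and 1 in the uniqueness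
    proof, where finiteness is enough. *)
Lemma wl1_of_wl2 d (s0 C lam X : R) (w : d.-tuple int -> R) (v : d.-tuple int -> R[i]) :
  0 <= C -> (forall r : seq (d.-tuple int), uniq r ->
    \sum_(j <- r) freq_weight j `^ (- (2 * s0)) <= C) ->
  0 < lam -> (forall j, lam * freq_weight j `^ s0 <= w j) -> wl2 w v X ->
  wl1 v (Num.sqrt C * X / lam).
Proof.
move=> C0 hC lam0 hw [X0 vX] r ur.
have L0 (j : d.-tuple int) : 0 < freq_weight j by rewrite (lt_le_trans ltr01)// freq_weight_ge1.
have B0 : 0 <= Num.sqrt C * X / lam by rewrite divr_ge0 ?mulr_ge0 ?sqrtr_ge0// ltW.
rewrite -ler_sqr ?nnegrE//; last by apply: sumr_ge0 => j _; exact: normc_ge0.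
have -> : \sum_(j <- r) normc (v j) = \sum_(j <- r) freq_weight j `^ (- (2 * s0)) *
    (freq_weight j `^ (2 * s0) * normc (v j)).
  apply: eq_bigr => j _; rewrite powRN mulrA mulVf ?mul1r// gt_eqF// powR_gt0//.
apply: (le_trans (cauchy_schwarz_sum _ _ (fun j => powR_ge0 _ _))).
rewrite -mulrA exprMn sqr_sqrtr//; apply: ler_pM => //.
- by apply: sumr_ge0 => j _; exact: powR_ge0.
- by apply: sumr_ge0 => j _; rewrite mulr_ge0 ?powR_ge0 ?sqr_ge0.
- exact: hC.
apply: (@le_trans _ _ (lam^-1 ^+ 2 * \sum_(j <- r) (w j * normc (v j)) ^+ 2)).
  rewrite mulr_sumr; apply: ler_sum => j _.
  rewrite [X in X <= _](_ : _ = (freq_weight j `^ s0 * normc (v j)) ^+ 2).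
    rewrite -exprMn ler_sqr ?nnegrE ?mulr_ge0 ?powR_ge0 ?normc_ge0 ?invr_ge0 ?(ltW lam0)//.
      rewrite mulrA ler_wpM2r ?normc_ge0// mulrC ler_pdivlMr// mulrC; exact: hw.
    by rewrite (le_trans _ (hw j))// mulr_ge0 ?powR_ge0// ltW.
  have -> : freq_weight j `^ (2 * s0) = (freq_weight j `^ s0) ^+ 2.
    by rewrite -powR_mulrn ?powR_ge0// -powRrM mulrC.
  rewrite powRN (_ : freq_weight j `^ (2 * s0) = (freq_weight j `^ s0) ^+ 2).
    by field; rewrite gt_eqF// powR_gt0.
  by rewrite -powR_mulrn ?powR_ge0// -powRrM mulrC.
by rewrite exprMn mulrC ler_wpM2r ?sqr_ge0//; exact: vX.
Qed.

End LatticeSums.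

(** * Curves of Fourier coefficients *)

Section RealDerivatives.
Context {R : realType}.
Variable T : R.
Implicit Types (f g : R -> R) (a b t e : R).

(* One-sided at the end points, as the derivatives of a curve on [0, T] are. *)
Definition rderiv_on (f f' : R -> R) := forall t, 0 <= t <= T -> forall e, 0 < e ->
  exists2 de : R, 0 < de & forall t', 0 <= t' <= T -> `|t' - t| < de ->
    `|f t' - f t - (t' - t) * f' t| <= e * `|t' - t|.

(** Continuous induction. A slope e > 0 is conceded so that the estimate at the supremum can be
    pushed a little further to the right. *)
Lemma rderiv_on_nonincreasing (f f' : R -> R) a t : 0 <= a -> a <= t -> t <= T ->
  rderiv_on f f' -> (forall x, a <= x <= t -> f' x <= 0) -> f t <= f a.
Proof.
move=> a0 at_ tT df f'0; rewrite -subr_le0; apply/ler_addgt0Pr => e0 e00.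
have ta1 : 0 < t - a + 1 by rewrite ltr_wpDl// subr_ge0.
pose e := e0 / (t - a + 1); have e_gt0 : 0 < e by rewrite divr_gt0.
suff : f t - f a <= e * (t - a).
  move=> /le_trans; apply; rewrite add0r /e mulrAC ler_pdivrMr// ler_wpM2l ?(ltW e00)//.
  by rewrite lerDl.
(* The supremum c of this set belongs to it by differentiability at c seen from the left; seen from
   the right, the same differentiability contradicts c < t. *)
pose S := [set x | a <= x <= t /\ f x - f a <= e * (x - a)].
have Sa : S a by rewrite /S/= lexx at_ !subrr mulr0.
have hS : has_sup S by split; [exists a|exists t => x [/andP[_ xt] _]].
pose c := sup S.
have ac : a <= c by apply: ub_le_sup => //; case: hS.
have ct : c <= t by apply: ge_sup; [exists a|move=> x [/andP[_ xt] _]].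
have cT : 0 <= c <= T by rewrite (le_trans a0)//= (le_trans ct).
have [de de0 Hde] := df c cT e e_gt0.
have f'c : f' c <= 0 by apply: f'0; rewrite ac ct.
have Sc : f c - f a <= e * (c - a).
  have [x Sx xc] := sup_adherent de0 hS; have [/andP[ax xt] fx] := Sx.
  have xlec : x <= c by apply: ub_le_sup => //; case: hS.
  have xT : 0 <= x <= T by rewrite (le_trans a0)//= (le_trans xt).
  have xde : `|x - c| < de by rewrite ler0_norm ?subr_le0// opprB ltrBlDr addrC -ltrBlDr.
  have := Hde x xT xde; rewrite (@ler0_norm _ (x - c)) ?subr_le0// ler_norml => /andP[H _].
  have : 0 <= (x - c) * f' c by rewrite mulr_le0 ?subr_le0.
  by move: H fx; lra.
have [->//|tc] := eqVneq t c.
have clt : c < t by rewrite lt_neqAle eq_sym tc.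
pose x := Num.min t (c + de / 2).
have cx : c < x by rewrite lt_min clt ltrDl divr_gt0.
have xt : x <= t by rewrite ge_min lexx.
have xT : 0 <= x <= T by rewrite (le_trans _ (ltW cx)) ?(le_trans a0)//= (le_trans xt).
have xde : `|x - c| < de.
  rewrite ger0_norm ?subr_ge0 ?(ltW cx)// ltrBlDl.
  by rewrite (@le_lt_trans _ _ (c + de / 2))// ?ge_min ?lexx ?orbT// ltrD2l; lra.
have := Hde x xT xde; rewrite (@ger0_norm _ (x - c)) ?subr_ge0 ?(ltW cx)// ler_norml.
move=> /andP[_ H]; have Sx : S x.
  split; first by rewrite (le_trans ac (ltW cx)).
  have : (x - c) * f' c <= 0 by rewrite mulr_ge0_le0// subr_ge0 ltW.
  by move: H Sc; lra.
by have : x <= c; [apply: ub_le_sup => //; case: hS|rewrite leNgt cx].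
Qed.

Lemma rderiv_onD (f f' g g' : R -> R) : rderiv_on f f' -> rderiv_on g g' ->
  rderiv_on (fun t => f t + g t) (fun t => f' t + g' t).
Proof.
move=> df dg t tT e e0; have e20 : 0 < e / 2 by rewrite divr_gt0.
have [d1 d10 H1] := df t tT _ e20; have [d2 d20 H2] := dg t tT _ e20.
exists (Num.min d1 d2); first by rewrite lt_min d10.
move=> t' t'T; rewrite lt_min => /andP[l1 l2].
have -> : f t' + g t' - (f t + g t) - (t' - t) * (f' t + g' t) =
   (f t' - f t - (t' - t) * f' t) + (g t' - g t - (t' - t) * g' t) by ring.
apply: (le_trans (ler_normD _ _)).
by have := H1 t' t'T l1; have := H2 t' t'T l2; lra.
Qed.

Lemma rderiv_onZ (c : R) (f f' : R -> R) : rderiv_on f f' ->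
  rderiv_on (fun t => c * f t) (fun t => c * f' t).
Proof.
move=> df t tT e e0; have c1 : 0 < `|c| + 1 by rewrite ltr_wpDl.
have [d1 d10 H1] := df t tT _ (divr_gt0 e0 c1).
exists d1 => // t' t'T l1.
have -> : c * f t' - c * f t - (t' - t) * (c * f' t) = c * (f t' - f t - (t' - t) * f' t).
  by ring.
rewrite normrM; apply: le_trans (ler_wpM2l (normr_ge0 c) (H1 t' t'T l1)) _.
rewrite mulrA ler_wpM2r// mulrCA ler_piMr ?(ltW e0)// ler_pdivrMr// mul1r lerDl//.
Qed.

Lemma rderiv_on_cst (c : R) : rderiv_on (fun=> c) (fun=> 0).
Proof.
move=> t tT e e0; exists 1 => // t' _ _.
by rewrite subrr mulr0 subr0 normr0 mulr_ge0// ltW.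
Qed.

Lemma eq_rderiv_on (f f' g g' : R -> R) : f =1 g -> f' =1 g' ->
  rderiv_on f f' -> rderiv_on g g'.
Proof. by move=> /funext -> /funext ->. Qed.

Lemma rderiv_on_sum I (r : seq I) (f f' : I -> R -> R) :
  (forall i, rderiv_on (f i) (f' i)) ->
  rderiv_on (fun t => \sum_(i <- r) f i t) (fun t => \sum_(i <- r) f' i t).
Proof.
move=> df; elim: r => [|i r IH].
  by apply: eq_rderiv_on (rderiv_on_cst 0) => t; rewrite big_nil.
by apply: eq_rderiv_on (rderiv_onD (df i) IH) => t; rewrite big_cons.
Qed.

Lemma rderiv_on_is_derive (f f' : R -> R) :
  (forall t : R, 0 <= t <= T -> is_derive t 1 f (f' t)) -> rderiv_on f f'.
Proof.
move=> df t tT e e0; have [dfx E] := df t tT.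
have : (fun h => h^-1 *: (f (h *: 1 + t) - f t)) @ 0^' --> f' t.
  by rewrite -E; exact: dfx.
move=> /cvgrPdist_le/(_ e e0); rewrite near_withinE.
move=> /nbhs_ballP[de /= de0 H]; exists de => // t' t'T tt'.
have [->|t't] := eqVneq t' t; first by rewrite !subrr mul0r subr0 normr0 mulr0.
have h0 : t' - t != 0 by rewrite subr_eq0.
have := H (t' - t); rewrite /ball /= sub0r normrN => /(_ tt' h0).
rewrite /GRing.scale /= mulr1 subrK => H1.
have -> : f t' - f t - (t' - t) * f' t =
    - ((f' t - (t' - t)^-1 * (f t' - f t)) * (t' - t)) by field.
by rewrite normrN normrM ler_wpM2r.
Qed.

End RealDerivatives.

Section ComplexDerivatives.
Context {R : realType}.
Variable T : R.

Definition deriv_on (f f' : R -> R[i]) := forall t, 0 <= t <= T -> forall e, 0 < e ->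
  exists2 de : R, 0 < de & forall t', 0 <= t' <= T -> `|t' - t| < de ->
    normc (f t' - f t - (t' - t)%:C * f' t) <= e * `|t' - t|.

Definition cont_on (f : R -> R[i]) := forall t, 0 <= t <= T -> forall e, 0 < e ->
  exists2 de : R, 0 < de & forall t', 0 <= t' <= T -> `|t' - t| < de ->
    normc (f t' - f t) <= e.

Lemma deriv_on_Re (c : R[i]) (f f' : R -> R[i]) : deriv_on f f' ->
  rderiv_on T (fun t => Re (c * f t)) (fun t => Re (c * f' t)).
Proof.
move=> df t tT e e0; have c1 : 0 < normc c + 1 by rewrite ltr_wpDl// normc_ge0.
have [de de0 H] := df t tT _ (divr_gt0 e0 c1); exists de => // t' t'T l.
have -> : Re (c * f t') - Re (c * f t) - (t' - t) * Re (c * f' t) =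
    Re (c * (f t' - f t - (t' - t)%:C * f' t)) by rewrite !ReImE /=; ring.
apply: (le_trans (normr_Re_le _)); rewrite Normc.normcM.
apply: le_trans (ler_wpM2l (normc_ge0 c) (H t' t'T l)) _.
rewrite mulrA ler_wpM2r// mulrCA ler_piMr ?(ltW e0)// ler_pdivrMr// mul1r lerDl//.
Qed.

Lemma deriv_on_ReIm (f f' : R -> R[i]) :
  rderiv_on T (fun t => Re (f t)) (fun t => Re (f' t)) ->
  rderiv_on T (fun t => Im (f t)) (fun t => Im (f' t)) -> deriv_on f f'.
Proof.
move=> dR dI t tT e e0; have e20 : 0 < e / 2 by rewrite divr_gt0.
have [d1 d10 H1] := dR t tT _ e20; have [d2 d20 H2] := dI t tT _ e20.
exists (Num.min d1 d2); first by rewrite lt_min d10.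
move=> t' t'T; rewrite lt_min => /andP[l1 l2].
apply: normc_le; first by rewrite mulr_ge0// ltW.
have {H1} := H1 t' t'T l1; have {H2} := H2 t' t'T l2.
set a := `|t' - t|; have a0 : 0 <= a by exact: normr_ge0.
rewrite !ReImE /= !mul0r subr0 addr0.
set u := (X in `|X| <= _ -> _); set v := (X in _ -> `|X| <= _ -> _).
move=> u1 v1; have ub : u ^+ 2 <= (e / 2 * a) ^+ 2.
  by rewrite -[u ^+ 2]real_normK ?num_real// ler_sqr ?nnegrE// mulr_ge0// ltW.
have vb : v ^+ 2 <= (e / 2 * a) ^+ 2.
  by rewrite -[v ^+ 2]real_normK ?num_real// ler_sqr ?nnegrE// mulr_ge0// ltW.
have ea := mulr_ge0 (sqr_ge0 e) (sqr_ge0 a).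
apply: le_trans (lerD vb ub) _.
have -> : (e / 2 * a) ^+ 2 = (e ^+ 2 * a ^+ 2) / 4 by field.
by rewrite exprMn; lra.
Qed.

Lemma deriv_on_ext (f f' g g' : R -> R[i]) :
  (forall t, 0 <= t <= T -> f t = g t) -> (forall t, 0 <= t <= T -> f' t = g' t) ->
  deriv_on f f' -> deriv_on g g'.
Proof.
move=> fg fg' df t tT e e0; have [de de0 H] := df t tT e e0.
by exists de => // t' t'T l; rewrite -!fg// -fg'//; exact: H.
Qed.

Lemma deriv_onD (f f' g g' : R -> R[i]) : deriv_on f f' -> deriv_on g g' ->
  deriv_on (fun t => f t + g t) (fun t => f' t + g' t).
Proof.
move=> df dg t tT e e0; have e20 : 0 < e / 2 by rewrite divr_gt0.
have [d1 d10 H1] := df t tT _ e20; have [d2 d20 H2] := dg t tT _ e20.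
exists (Num.min d1 d2); first by rewrite lt_min d10.
move=> t' t'T; rewrite lt_min => /andP[l1 l2].
have -> : f t' + g t' - (f t + g t) - (t' - t)%:C * (f' t + g' t) =
   (f t' - f t - (t' - t)%:C * f' t) + (g t' - g t - (t' - t)%:C * g' t) by ring.
apply: (le_trans (le_normcD _ _)).
by have := H1 t' t'T l1; have := H2 t' t'T l2; lra.
Qed.

Lemma deriv_onZ (c : R[i]) (f f' : R -> R[i]) : deriv_on f f' ->
  deriv_on (fun t => c * f t) (fun t => c * f' t).
Proof.
move=> df t tT e e0; have c1 : 0 < normc c + 1 by rewrite ltr_wpDl// normc_ge0.
have [de de0 H] := df t tT _ (divr_gt0 e0 c1); exists de => // t' t'T l.
have -> : c * f t' - c * f t - (t' - t)%:C * (c * f' t) =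
    c * (f t' - f t - (t' - t)%:C * f' t) by ring.
rewrite Normc.normcM; apply: le_trans (ler_wpM2l (normc_ge0 c) (H t' t'T l)) _.
rewrite mulrA ler_wpM2r// mulrCA ler_piMr ?(ltW e0)// ler_pdivrMr// mul1r lerDl//.
Qed.

Lemma deriv_onB (f f' g g' : R -> R[i]) : deriv_on f f' -> deriv_on g g' ->
  deriv_on (fun t => f t - g t) (fun t => f' t - g' t).
Proof.
move=> df /(deriv_onZ (-1)) dg; apply: deriv_on_ext (deriv_onD df dg) => t _;
  by rewrite mulN1r.
Qed.

Lemma deriv_on_cst (c : R[i]) : deriv_on (fun=> c) (fun=> 0).
Proof.
move=> t tT e e0; exists 1 => // t' _ _.
by rewrite subrr mulr0 subr0 Normc.normc0 mulr_ge0// ltW.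
Qed.

Lemma deriv_on_cont (f f' : R -> R[i]) : deriv_on f f' -> cont_on f.
Proof.
move=> df t tT e e0; have [d1 d10 H1] := df t tT 1 ltr01.
have M0 : 0 < normc (f' t) + 1 by rewrite ltr_wpDl// normc_ge0.
exists (Num.min d1 (e / (normc (f' t) + 1))); first by rewrite lt_min d10 divr_gt0.
move=> t' t'T; rewrite lt_min => /andP[l1]; rewrite ltr_pdivlMr// => l2.
have -> : f t' - f t = (f t' - f t - (t' - t)%:C * f' t) + (t' - t)%:C * f' t by ring.
apply: (le_trans (le_normcD _ _)); rewrite Normc.normcM normc_real.
by have := H1 t' t'T l1; lra.
Qed.

Lemma deriv_onM (f f' g g' : R -> R[i]) : deriv_on f f' -> deriv_on g g' ->
  deriv_on (fun t => f t * g t) (fun t => f' t * g t + f t * g' t).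
Proof.
move=> df dg t tT e e0.
set M := normc (f t) + normc (g t) + normc (f' t) + 1.
have F0 := normc_ge0 (f t); have G0 := normc_ge0 (g t); have F'0 := normc_ge0 (f' t).
have M0 : 0 < M by rewrite /M; lra.
pose e1 := e / (3 * (M + 1)); have e10 : 0 < e1 by rewrite divr_gt0// mulr_gt0// addr_gt0.
have [d1 d10 H1] := df t tT _ e10; have [d2 d20 H2] := dg t tT _ e10.
have e20 : 0 < Num.min 1 e1 by rewrite lt_min ltr01.
have [d3 d30 H3] := deriv_on_cont dg tT e20.
exists (Num.min d1 (Num.min d2 d3)); first by rewrite !lt_min d10 d20.
move=> t' t'T; rewrite !lt_min => /andP[l1 /andP[l2 l3]].
have {H1} := H1 t' t'T l1; have {H2} := H2 t' t'T l2; have {H3} := H3 t' t'T l3.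
set a := `|t' - t|; have a0 : 0 <= a by exact: normr_ge0.
have -> : f t' * g t' - f t * g t - (t' - t)%:C * (f' t * g t + f t * g' t) =
   (f t' - f t - (t' - t)%:C * f' t) * g t'
   + (t' - t)%:C * f' t * (g t' - g t)
   + f t * (g t' - g t - (t' - t)%:C * g' t) by ring.
rewrite le_min => /andP[g1 g2] hg hf.
have gt' : normc (g t') <= normc (g t) + 1.
  have -> : g t' = g t + (g t' - g t) by ring.
  by rewrite (le_trans (le_normcD _ _))// lerD2l.
apply: (le_trans (le_normcD _ _)); apply: (@le_trans _ _
   (e1 * a * (normc (g t) + 1) + a * normc (f' t) * e1 + normc (f t) * (e1 * a))).
  apply: lerD; last by rewrite Normc.normcM ler_wpM2l.
  apply: (le_trans (le_normcD _ _)); apply: lerD.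
    by rewrite Normc.normcM ler_pM ?normc_ge0.
  by rewrite !Normc.normcM normc_real ler_wpM2l// mulr_ge0.
have -> : e1 * a * (normc (g t) + 1) + a * normc (f' t) * e1 + normc (f t) * (e1 * a) =
  (e1 * M) * a by rewrite /M; ring.
have M30 : 0 < 3 * (M + 1) by rewrite mulr_gt0// addr_gt0.
rewrite ler_wpM2r// /e1 mulrAC ler_pdivrMr// ler_pM2l//.
by move: M0; lra.
Qed.

Definition phase (w t : R) : R[i] := cos (w * t) +i* sin (w * t).

Lemma normc_phase w t : normc (phase w t) = 1.
Proof. by rewrite /Normc.normc /phase cos2Dsin2 sqrtr1. Qed.

Lemma phase0 w : phase w 0 = 1.
Proof. by rewrite /phase mulr0 cos0 sin0. Qed.

Lemma phaseN w t : phase (- w) t * phase w t = 1.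
Proof.
rewrite /phase mulNr cosN sinN; apply: eq_ReIm; rewrite ?ReImE /=.
  by rewrite -(cos2Dsin2 (w * t)); ring.
ring.
Qed.

Lemma deriv_on_phase w : deriv_on (phase w) (fun t => (w *i) * phase w t).
Proof.
apply: deriv_on_ReIm; apply: rderiv_on_is_derive => t _ /=; apply: is_derive_eq;
  rewrite /GRing.scale /=; ring.
Qed.

(** Conjugation by the free flow removes the multiplier [w *i], which is unbounded over frequencies;
    what is left is driven by the nonlinearity alone. *)
Lemma rotate_deriv_on w (f g : R -> R[i]) :
  deriv_on f (fun t => (w *i) * f t + g t) <->
  deriv_on (fun t => phase (- w) t * f t) (fun t => phase (- w) t * g t).
Proof.
split=> [df|dz].
  have := deriv_onM (deriv_on_phase (- w)) df; apply: deriv_on_ext => // t _.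
  have -> : (- w) *i = - (w *i) :> R[i] by apply: eq_ReIm; rewrite /= ?oppr0.
  ring.
have E t : phase w t * phase (- w) t = 1 by rewrite mulrC phaseN.
have := deriv_onM (deriv_on_phase w) dz; apply: deriv_on_ext => t _.
  by rewrite mulrA E mul1r.
have -> : w *i * phase w t * (phase (- w) t * f t) + phase w t * (phase (- w) t * g t) =
  (phase w t * phase (- w) t) * (w *i * f t + g t) by ring.
by rewrite E mul1r.
Qed.

Lemma deriv_on_shift_cst (c : R[i]) (f f' : R -> R[i]) : deriv_on f f' ->
  deriv_on (fun t => c + f t) f'.
Proof.
move=> df; have := deriv_onD (deriv_on_cst c) df.
by apply: deriv_on_ext => t _ //; rewrite add0r.
Qed.

End ComplexDerivatives.

Section Primitives.
Context {R : realType}.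
Variable T : R.
Hypothesis T0 : 0 <= T.

Lemma real_primitive (f : R -> R) :
  (forall t, 0 <= t <= T -> forall e, 0 < e -> exists2 de : R, 0 < de &
    forall t', 0 <= t' <= T -> `|t' - t| < de -> `|f t' - f t| <= e) ->
  exists F : R -> R, F 0 = 0 /\ rderiv_on T F f.
Proof.
(* Constant extension beyond [0, T] gives a globally continuous function with the same values on the
   segment. *)
move=> cf; pose clamp (t : R) := Num.max 0 (Num.min t T).
have clampT t : 0 <= clamp t <= T by rewrite le_max lexx ge_max T0 /= ge_min lexx orbT.
have clampE t : 0 <= t <= T -> clamp t = t.
  by move=> /andP[t0 tT]; rewrite /clamp (min_idPl tT) (max_idPr t0).
have clampL s t : `|clamp s - clamp t| <= `|s - t|.
  rewrite /clamp; have := ler_norm (s - t); have := ler_norm (t - s); rewrite (distrC t s) => h1 h2.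
  case: (leP s T) => sT; case: (leP t T) => tT; rewrite /Num.max;
    do ![case: ifPn; rewrite -?leNgt => ?]; rewrite ler_norml; lra.
pose g := f \o clamp.
have cg : continuous g.
  move=> t; apply/cvgrPdist_le => e e0.
  have [de de0 H] := cf _ (clampT t) e e0.
  apply/nbhs_ballP; exists de => //= s ts; rewrite distrC.
  by apply: H => //; rewrite (le_lt_trans (clampL _ _))// distrC.
(* Integrating from -1, inside an interval that ends at T + 1, puts all of [0, T] in the interior,
   where the fundamental theorem gives a two-sided derivative. *)
pose F (t : R) := (\int[lebesgue_measure]_(x in `[(-1)%R, t]) g x)%R.
exists (fun t => F t - F 0); split; first by rewrite subrr.
apply: rderiv_on_is_derive => t tT.
have ig : lebesgue_measure.-integrable [set` Interval (BLeft (-1)) (BRight (T + 1))] (EFin \o g).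
  apply: continuous_compact_integrable; first exact: segment_compact.
  exact: continuous_subspaceT.
have tT1 : t < T + 1 by move: tT; lra.
have [dF FE] : derivable F t 1 /\ derive1 F t = g t.
  by apply: (continuous_FTC1 tT1 ig _ (cg t)); rewrite /= lte_fin; move: tT; lra.
have dFt : is_derive t 1 F (f t).
  have : g t = f t by rewrite /g /= clampE.
  by move=> <-; split => //; rewrite -derive1E.
by have := is_deriveB dFt (is_derive_cst (F 0) t 1); rewrite subr0.
Qed.

Lemma complex_primitive (f : R -> R[i]) : cont_on T f ->
  exists F : R -> R[i], F 0 = 0 /\ deriv_on T F f.
Proof.
move=> cf.
have [FR [FR0 dFR]] : exists F : R -> R, F 0 = 0 /\ rderiv_on T F (fun t => Re (f t)).
  apply: real_primitive => t tT e e0; have [de de0 H] := cf t tT e e0.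
  exists de => // t' t'T l; rewrite -ReN -ReD.
  exact: le_trans (normr_Re_le _) (H t' t'T l).
have [FI [FI0 dFI]] : exists F : R -> R, F 0 = 0 /\ rderiv_on T F (fun t => Im (f t)).
  apply: real_primitive => t tT e e0; have [de de0 H] := cf t tT e e0.
  exists de => // t' t'T l; rewrite -ImN -ImD.
  exact: le_trans (normr_Im_le _) (H t' t'T l).
by exists (fun t => FR t +i* FI t); split; [rewrite FR0 FI0|exact: deriv_on_ReIm].
Qed.

End Primitives.

Section WeightedSequences.
Context {R : realType} {d : nat}.
Local Notation J := (d.-tuple int).
Implicit Types (m : J -> R) (v w : J -> R[i]) (r : seq J).

(** Lower semicontinuity of the weighted norm under coefficientwise convergence: each finite sum
    sees only finitely many coefficients. *)
Lemma wl2_closed m v (X : R) : (forall j, 0 <= m j) -> 0 <= X ->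
  (forall r (e : R), 0 < e -> exists2 w, (forall j, j \in r -> normc (v j - w j) <= e) &
     wl2 m w (X + e)) -> wl2 m v X.
Proof.
move=> m0 X0 H; split => // r ur; apply: le_sqr_addgt0 => // e e0.
have S0 : 0 < \sum_(j <- r) m j + 1 by rewrite ltr_wpDl// sumr_ge0.
(* Chosen so that e - e3 equals e3 times the sum of the weights over [r] plus 1, which pays for the
   coefficient errors; one more e3 is the excess in the bound for [w]. *)
pose e3 := e / (\sum_(j <- r) m j + 1 + 1).
have S1 : 0 < \sum_(j <- r) m j + 1 + 1 by rewrite addr_gt0.
have e30 : 0 < e3 by rewrite divr_gt0.
have [w vw [_ wX]] := H r e3 e30.
apply: (@le_trans _ _ (\sum_(j <- r) (m j * normc (w j) + m j * e3) ^+ 2)).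
  rewrite big_seq [leRHS]big_seq; apply: ler_sum => j jr.
  have mv : m j * normc (v j) <= m j * normc (w j) + m j * e3.
    rewrite -mulrDr ler_wpM2l//; have -> : v j = w j + (v j - w j) by ring.
    by rewrite (le_trans (le_normcD _ _))// lerD2l vw.
  have A : 0 <= m j * normc (v j) by rewrite mulr_ge0 ?normc_ge0.
  by rewrite ler_sqr ?nnegrE// (le_trans A).
have -> : X + e = (X + e3) + (e - e3) by ring.
apply: minkowski_sum.
- by rewrite addr_ge0// ltW.
- rewrite subr_ge0 /e3 ler_pdivrMr// -[leLHS]mulr1 ler_pM2l//.
  by move: (ltW S0); lra.
- exact: wX.
apply: (le_trans (sum_sqr_le _ (fun j => mulr_ge0 (m0 j) (ltW e30)))).
have E : e - e3 = (\sum_(j <- r) m j + 1) * e3 by rewrite /e3; field; rewrite gt_eqF.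
have Sm0 : 0 <= \sum_(j <- r) m j by exact: sumr_ge0.
rewrite -mulr_suml E ler_sqr ?nnegrE.
- by rewrite ler_wpM2r ?(ltW e30)// lerDl.
- by rewrite mulr_ge0 ?(ltW e30).
- by rewrite mulr_ge0 ?(ltW e30) ?(ltW S0).
Qed.

Variable T : R.

(** Duality with a finite test vector: pairing z with m^2 times its total increment over [r] gives a
    real function whose increment is S itself and whose derivative is at most sqrt(S) h'.
    Monotonicity yields S <= sqrt(S) (h(t) - h(a)). *)
Lemma wl2_mean_value m (z z' : R -> J -> R[i]) (h h' : R -> R) (a t : R) :
  (forall j, 0 <= m j) -> 0 <= a -> a <= t -> t <= T ->
  (forall j, deriv_on T (z ^~ j) (z' ^~ j)) -> rderiv_on T h h' ->
  (forall x, a <= x <= t -> wl2 m (z' x) (h' x)) ->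
  wl2 m (fun j => z t j - z a j) (h t - h a).
Proof.
move=> m0 a0 at_ tT dz dh zh.
have h'0 x : a <= x <= t -> 0 <= h' x by move=> /zh[].
have hat : 0 <= h t - h a.
  have := rderiv_on_nonincreasing a0 at_ tT (rderiv_onZ (-1) dh).
  rewrite !mulN1r lerN2 subr_ge0; apply => x xat.
  by rewrite mulN1r oppr_le0 h'0.
split => // r ur.
set S := \sum_(j <- r) _; have S0 : 0 <= S by apply: sumr_ge0 => j _; exact: sqr_ge0.
pose D j := z t j - z a j.
pose g x := \sum_(j <- r) Re (((m j) ^+ 2)%:C * conjc (D j) * z x j).
pose g' x := \sum_(j <- r) Re (((m j) ^+ 2)%:C * conjc (D j) * z' x j).
have dg : rderiv_on T g g' by apply: rderiv_on_sum => j; exact: deriv_on_Re.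
have gS : g t - g a = S.
  rewrite /g -sumrB; apply: eq_bigr => j _.
  by rewrite exprMn sqr_normcE /D !ReImE /=; ring.
have g'h x : a <= x <= t -> g' x <= Num.sqrt S * h' x.
  move=> xat; have [hx0 zhx] := zh x xat.
  apply: (@le_trans _ _ (\sum_(j <- r) (m j * normc (D j)) * (m j * normc (z' x j)))).
    apply: ler_sum => j _; apply: (le_trans (Re_le_normc _)).
    by rewrite !Normc.normcM normc_conj normc_real ger0_norm ?sqr_ge0// expr2; lra.
  apply: le_trans (ler_norm _) _.
  rewrite -ler_sqr ?nnegrE ?mulr_ge0 ?sqrtr_ge0// real_normK ?num_real// exprMn sqr_sqrtr//.
  apply: (le_trans (cauchy_schwarz_sum2 _ _ _)).
  by rewrite ler_wpM2l//; exact: zhx.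
have := rderiv_on_nonincreasing a0 at_ tT (rderiv_onD dg (rderiv_onZ (- Num.sqrt S) dh)).
move=> /(_ _)H; have {H} : S <= Num.sqrt S * (h t - h a).
  rewrite -gS; apply: (@le_trans _ _ (g t - g a)) => //.
  have := H _; rewrite !mulNr => H'.
  have : g t - Num.sqrt S * h t <= g a - Num.sqrt S * h a.
    by apply: H' => x xat; have := g'h x xat; lra.
  by rewrite gS; lra.
rewrite -{1}(sqr_sqrtr S0) expr2 => SS.
have [S00|Sn0] := eqVneq (Num.sqrt S) 0.
  by rewrite -(sqr_sqrtr S0) S00 expr0n /= sqr_ge0.
rewrite -(sqr_sqrtr S0) ler_sqr ?nnegrE ?sqrtr_ge0//.
by rewrite -(@ler_pM2l _ (Num.sqrt S))// lt_neqAle eq_sym Sn0 sqrtr_ge0.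
Qed.

End WeightedSequences.

Section GeometricLimits.
Context {R : realType}.

(** Nested intervals of radius 2 C / 2^n around [u n]; the limit is the supremum of the left ends,
    and the error bound comes out explicitly. *)
Lemma real_geometric_limit (u : nat -> R) (C : R) :
  (forall n, `|u n.+1 - u n| <= C / 2 ^+ n) ->
  exists l, forall n, `|l - u n| <= 2 * C / 2 ^+ n.
Proof.
move=> uC; have C0 : 0 <= C.
  by have := uC 0%N; rewrite expr0 divr1; exact: le_trans.
pose a n := u n - 2 * C / 2 ^+ n; pose b n := u n + 2 * C / 2 ^+ n.
have half n : 2 * C / 2 ^+ n.+1 = C / 2 ^+ n.
  by rewrite exprS; field; rewrite expf_neq0.
have half' n : 2 * C / 2 ^+ n = C / 2 ^+ n + C / 2 ^+ n by field; rewrite expf_neq0.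
have aS n : a n <= a n.+1.
  by have := uC n; rewrite ler_norml /a half half'; lra.
have bS n : b n.+1 <= b n.
  by have := uC n; rewrite ler_norml /b half half'; lra.
have a_mono : {homo a : n m / (n <= m)%N >-> n <= m}.
  by apply: homo_leq => // x y z; exact: le_trans.
have b_mono : {homo b : n m / (n <= m)%N >-> m <= n}.
  by apply: (homo_leq (r := fun x y => y <= x)) => // x y z xy yz; exact: le_trans yz xy.
have ab n m : a n <= b m.
  apply: (le_trans (a_mono _ _ (leq_maxl n m))).
  apply: le_trans (b_mono _ _ (leq_maxr n m)).
  by rewrite /a /b lerD2l ge0_cp ?divr_ge0 ?mulr_ge0 ?exprn_ge0.
have hS : has_sup (range a) by split; [exists (a 0%N), 0%N|exists (b 0%N) => _ [n _ <-]].
exists (sup (range a)) => n.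
have h1 : a n <= sup (range a) by apply: ub_le_sup; [case: hS|exists n].
have h2 : sup (range a) <= b n by apply: ge_sup; [case: hS|move=> _ [k _ <-]].
by rewrite ler_norml; move: h1 h2; rewrite /a /b; lra.
Qed.

Lemma complex_geometric_limit (u : nat -> R[i]) (C : R) :
  (forall n, normc (u n.+1 - u n) <= C / 2 ^+ n) ->
  exists l, forall n, normc (l - u n) <= 4 * C / 2 ^+ n.
Proof.
move=> uC.
have [lR HR] : exists l, forall n, `|l - Re (u n)| <= 2 * C / 2 ^+ n.
  apply: real_geometric_limit => n; rewrite -ReN -ReD.
  exact: le_trans (normr_Re_le _) (uC n).
have [lI HI] : exists l, forall n, `|l - Im (u n)| <= 2 * C / 2 ^+ n.
  apply: real_geometric_limit => n; rewrite -ImN -ImD.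
  exact: le_trans (normr_Im_le _) (uC n).
exists (lR +i* lI) => n; have {HR} := HR n; have {HI} := HI n.
set D := 2 * C / 2 ^+ n => iD rD; have D0 : 0 <= D := le_trans (normr_ge0 _) rD.
have -> : 4 * C / 2 ^+ n = 2 * D by rewrite /D; field; rewrite expf_neq0.
apply: normc_le; first by rewrite mulr_ge0.
rewrite !ReImE /= -[(lR - _) ^+ 2]real_normK ?num_real// -[(lI - _) ^+ 2]real_normK ?num_real//.
have rD2 : `|lR - Re (u n)| ^+ 2 <= D ^+ 2 by rewrite ler_sqr ?nnegrE.
have iD2 : `|lI - Im (u n)| ^+ 2 <= D ^+ 2 by rewrite ler_sqr ?nnegrE.
have -> : (2 * D) ^+ 2 = 4 * D ^+ 2 by rewrite exprMn -natrX.
by have DD := sqr_ge0 D; apply: (le_trans (lerD rD2 iD2)); lra.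
Qed.

End GeometricLimits.

(** * The free flow on weighted sequences and the Gronwall step *)

Section Evolution.
Context {R : realType} {d : nat}.
Local Notation J := (d.-tuple int).
Implicit Types (m : J -> R) (v : J -> R[i]) (r : seq J) (c z : R -> J -> R[i]).
Variables (T : R) (w : J -> R).
Hypothesis T0 : 0 <= T.

Definition cont_l2 m c := forall t, 0 <= t <= T -> forall e, 0 < e ->
  exists2 de : R, 0 < de & forall t', 0 <= t' <= T -> `|t' - t| < de ->
    wl2 m (fun j => c t' j - c t j) e.

Lemma wl2_phase m v (X t : R) (a : J -> R) :
  wl2 m (fun j => phase (a j) t * v j) X <-> wl2 m v X.
Proof.
rewrite /wl2; suff -> : (fun j => m j * normc (phase (a j) t * v j)) =
  (fun j => m j * normc (v j)) by [].
by apply/funext => j; rewrite Normc.normcM normc_phase mul1r.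
Qed.

Lemma cont_on_finite (f : J -> R -> R[i]) r t (e : R) : 0 <= t <= T -> 0 < e ->
  (forall j, cont_on T (f j)) ->
  exists2 de : R, 0 < de & forall t', 0 <= t' <= T -> `|t' - t| < de ->
    forall j, j \in r -> normc (f j t' - f j t) <= e.
Proof.
move=> tT e0 cf; elim: r => [|i r [d1 d10 H1]]; first by exists 1.
have [d2 d20 H2] := cf i t tT e e0.
exists (Num.min d1 d2); first by rewrite lt_min d10.
move=> t' t'T; rewrite lt_min => /andP[l1 l2] j; rewrite inE => /predU1P[->|jr].
  exact: H2.
exact: H1.
Qed.

(* Strong continuity of the free group: the tail of [z t] outside a finite set
   of frequencies is small, and on that set the phases are continuous. *)
Lemma cont_l2_phase m z : (forall j, 0 <= m j) ->
  (forall t, 0 <= t <= T -> exists Y, wl2 m (z t) Y) -> cont_l2 m z ->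
  cont_l2 m (fun t j => phase (w j) t * z t j).
Proof.
move=> m0 zY cz t tT e e0; have [Y [Y0 zY']] := zY t tT.
have e20 : 0 < e / 2 by rewrite divr_gt0.
have [d1 d10 H1] := cz t tT _ e20.
(* Two phases differ by at most 2, so the tail enters 4 times and contributes e^2 / 16; the head
   contributes at most (e / 4)^2, and the sum stays below (e / 2)^2. *)
have e640 : 0 < e ^+ 2 / 64 by rewrite divr_gt0 ?exprn_gt0.
have [r0 ur0 tail] := sum_bounded_approx (fun j => sqr_ge0 (m j * normc (z t j))) zY' e640.
pose e1 := e / (4 * (Y + 1)).
have Y1 : 0 < 4 * (Y + 1) by rewrite mulr_gt0// ltr_wpDl.
have e10 : 0 < e1 by rewrite divr_gt0.
have [d2 d20 H2] := cont_on_finite r0 tT e10 (fun j => deriv_on_cont (@deriv_on_phase R T (w j))).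
exists (Num.min d1 d2); first by rewrite lt_min d10.
move=> t' t'T; rewrite lt_min => /andP[l1 l2].
have zz : wl2 m (fun j => phase (w j) t' * (z t' j - z t j)) (e / 2).
  by apply/wl2_phase; exact: H1.
suff pz : wl2 m (fun j => (phase (w j) t' - phase (w j) t) * z t j) (e / 2).
  have := wl2D m0 zz pz; rewrite -splitr.
  by congr wl2; apply/funext => j; ring.
split=> [|r ur]; first exact: ltW.
rewrite (bigID (mem r0))/=.
apply: (@le_trans _ _ (e1 ^+ 2 * Y ^+ 2 + 4 * (e ^+ 2 / 64))).
  apply: lerD.
    apply: (@le_trans _ _ (e1 ^+ 2 * \sum_(j <- r | j \in r0) (m j * normc (z t j)) ^+ 2)).
      rewrite mulr_sumr; apply: ler_sum => j jr0.
      rewrite Normc.normcM mulrCA exprMn ler_wpM2r ?sqr_ge0//.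
      by rewrite ler_sqr ?nnegrE ?normc_ge0 ?(ltW e10)//; exact: H2.
    rewrite ler_wpM2l ?sqr_ge0// -big_filter; apply: zY'; exact: filter_uniq.
  apply: (@le_trans _ _ (4 * \sum_(j <- r | j \notin r0) (m j * normc (z t j)) ^+ 2)).
    rewrite mulr_sumr; apply: ler_sum => j jr0.
    rewrite Normc.normcM mulrCA exprMn ler_wpM2r ?sqr_ge0//.
    have -> : 4 = 2 ^+ 2 :> R by rewrite -natrX.
    rewrite ler_sqr ?nnegrE ?normc_ge0//.
    by rewrite (le_trans (normcB_le _ _))// !normc_phase.
  rewrite ler_wpM2l// -big_filter; apply: tail; first exact: filter_uniq.
  by move=> j; rewrite mem_filter => /andP[].
have eY : e1 * Y <= e / 4.
  have -> : e / 4 = e1 * (Y + 1) by rewrite /e1; field; rewrite gt_eqF// ltr_wpDl.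
  by rewrite ler_wpM2l ?(ltW e10)// lerDl.
have : (e1 * Y) ^+ 2 <= (e / 4) ^+ 2.
  have e1Y0 : 0 <= e1 * Y by rewrite mulr_ge0// ltW.
  by rewrite ler_sqr ?nnegrE// (le_trans e1Y0).
rewrite -exprMn; have -> : (e / 4) ^+ 2 = e ^+ 2 / 16 by field.
have -> : (e / 2) ^+ 2 = e ^+ 2 / 4 by field.
by have := sqr_ge0 e; move: (e ^+ 2) ((e1 * Y) ^+ 2) => E1 E2; lra.
Qed.

(** The 2 in the exponent produces the contraction: L A e^(2 L t) has the primitive (A / 2) e^(2 L
    t). Rotation removes the term with [w] before integrating. *)
Lemma gronwall_step (x q : R -> J -> R[i]) (L A : R) : 0 < L -> 0 <= A ->
  (forall j, x 0 j = 0) ->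
  (forall j, deriv_on T (x ^~ j) (fun t => ((w j) *i) * x t j + q t j)) ->
  (forall t, 0 <= t <= T -> wl2 (fun=> 1) (q t) (L * (A * expR (2 * L * t)))) ->
  forall t, 0 <= t <= T -> wl2 (fun=> 1) (x t) (A / 2 * expR (2 * L * t)).
Proof.
move=> L0 A0 x0 dx qA t tT; have /andP[t0 tT'] := tT.
pose h s := A / 2 * expR (2 * L * s); pose h' s := L * (A * expR (2 * L * s)).
have dh : rderiv_on T h h'.
  apply: rderiv_on_is_derive => s _; apply: is_derive_eq.
  by rewrite /h' /GRing.scale /=; field.
have H : wl2 (fun=> 1) (fun j => phase (- w j) t * x t j - phase (- w j) 0 * x 0 j) (h t - h 0).
  apply: (wl2_mean_value (z := fun s j => phase (- w j) s * x s j)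
    (z' := fun s j => phase (- w j) s * q s j) (fun=> ler01) (lexx 0) t0 tT' _ dh) => [j|s].
    exact/rotate_deriv_on.
  by move=> /andP[s0 st]; apply/wl2_phase; apply: qA; rewrite s0 (le_trans st).
have h0 : 0 <= h 0 by rewrite mulr_ge0 ?divr_ge0 ?expR_ge0.
apply/(@wl2_phase _ _ _ t (fun j => - w j)).
have := wl2_le (fun=> ler01) H (_ : h t - h 0 <= h t); rewrite gerBl => /(_ h0).
by congr wl2; apply/funext => j; rewrite x0 mulr0 subr0.
Qed.

End Evolution.

(** * Picard iteration *)

Lemma expR_ge1 {R : realType} (x : R) : 0 <= x -> 1 <= expR x.
Proof. by move=> x0; rewrite -[leLHS]expR0 ler_expR. Qed.

Lemma geometric_small {R : realType} (M e : R) : 0 < e ->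
  exists n0, forall n, (n0 <= n)%N -> M / 2 ^+ n <= e.
Proof.
move=> e0; have : (fun n => M * 2^-1 ^+ n) @ \oo --> (0 : R).
  rewrite -[X in _ --> X](mulr0 M); apply: cvgMr; apply: cvg_expr.
  by rewrite ger0_norm//; lra.
move=> /cvgrPdist_le/(_ e e0)[n0 _ H]; exists n0 => n /H /=.
rewrite sub0r normrN exprVn; exact: le_trans (ler_norm _).
Qed.

Section Picard.
Context {R : realType} {d : nat}.
Local Notation J := (d.-tuple int).
Implicit Types (m : J -> R) (v : J -> R[i]) (r : seq J) (c h : R -> J -> R[i]).
Variables (T : R) (w : J -> R) (N : (J -> R[i]) -> J -> R[i]) (ball : (J -> R[i]) -> Prop)
  (L : R) (u0 : J -> R[i]).
Hypothesis T0 : 0 <= T.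
Hypothesis L0 : 0 < L.
Hypothesis N_lipschitz : forall v v' D, ball v -> ball v' ->
  wl2 (fun=> 1) (fun j => v j - v' j) D -> wl2 (fun=> 1) (fun j => N v j - N v' j) (L * D).

Definition growth m (K : R) := [/\ (forall j, 0 <= m j), 0 <= K &
  forall v X, ball v -> wl2 m v X -> wl2 m (N v) (K * X)].

(* The bound that Gronwall's inequality gives for a solution, in every weighted
   norm at once: the iteration stays in this class, and so does its limit. *)
Definition grows_as t v := forall m K X, growth m K -> wl2 m u0 X ->
  wl2 m v (X * expR (K * t)).

(** Smallness of the data and shortness of the interval enter the iteration only here; for the
    equation this is provided by [grows_as_l1ball]. *)
Hypothesis grows_as_ball : forall t v, 0 <= t <= T -> grows_as t v -> ball v.
Hypothesis growth1 : exists2 K, growth (fun=> 1) K & exists X, wl2 (fun=> 1) u0 X.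

Definition admissible c := (forall t, 0 <= t <= T -> grows_as t (c t)) /\
  cont_l2 T (fun=> 1) c.

(** The nonlinearity is evaluated along a given curve [h], so this is a linear problem for [c];
    solutions of the equation are the case c = h. *)
Definition solves c h := c 0 = u0 /\ forall j, deriv_on T (c ^~ j)
  (fun t => ((w j) *i) * c t j + N (h t) j).

Lemma wl2_normc v (X : R) j : wl2 (fun=> 1) v X -> normc (v j) <= X.
Proof.
move=> [X0 /(_ [:: j] isT)]; rewrite big_seq1 mul1r.
by rewrite ler_sqr ?nnegrE ?normc_ge0.
Qed.

Lemma admissible_ball c t : admissible c -> 0 <= t <= T -> ball (c t).
Proof. by move=> [gc _] tT; apply: (grows_as_ball tT); exact: gc. Qed.

Lemma N_cont h j : admissible h -> cont_on T (fun t => N (h t) j).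
Proof.
move=> ah t tT e e0; have [_ ch] := ah.
have [de de0 H] := ch t tT (e / L) (divr_gt0 e0 L0).
exists de => // t' t'T l; have := H t' t'T l.
move=> /(N_lipschitz (admissible_ball ah t'T) (admissible_ball ah tT)).
by rewrite mulrCA divff ?gt_eqF// mulr1 => /(wl2_normc j).
Qed.

Lemma deriv_on_expR (K X : R) :
  rderiv_on T (fun t => X * expR (K * t)) (fun t => K * (X * expR (K * t))).
Proof.
apply: rderiv_on_is_derive => s _; apply: is_derive_eq.
by rewrite /GRing.scale /=; ring.
Qed.

(** In rotated coefficients only N remains, and K X e^(K t) is both its bound along [h] and the
    derivative of X e^(K t). With s = 0 this gives the growth bound; with s close to t,
    continuity. *)
Lemma solves_increment c h m K X s t : admissible h -> solves c h -> growth m K ->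
  wl2 m u0 X -> 0 <= s -> s <= t -> t <= T ->
  wl2 m (fun j => phase (- w j) t * c t j - phase (- w j) s * c s j)
    (X * expR (K * t) - X * expR (K * s)).
Proof.
move=> ah [c0 dc] gm uX s0 st tT; have [m0 K0 gN] := gm.
apply: (wl2_mean_value (z := fun s j => phase (- w j) s * c s j)
  (z' := fun s j => phase (- w j) s * N (h s) j) m0 s0 st tT _ (deriv_on_expR K X)) => [j|x].
  exact/rotate_deriv_on.
move=> /andP[sx xt]; have xT : 0 <= x <= T by rewrite (le_trans s0)//= (le_trans xt).
apply/wl2_phase; apply: gN; first exact: admissible_ball.
by have [gh _] := ah; exact: gh.
Qed.

(** Invariance of the class: K X e^(K t) integrates to X (e^(K t) - 1) and the datum adds X, so the
    bound does not deteriorate from one iterate to the next. *)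
Lemma solves_grows_as c h t : admissible h -> solves c h -> 0 <= t <= T -> grows_as t (c t).
Proof.
move=> ah sc /andP[t0 tT] m K X gm uX; have [m0 _ _] := gm.
have H := solves_increment ah sc gm uX (lexx 0) t0 tT.
apply/(@wl2_phase _ _ _ _ _ t (fun j => - w j)).
have := wl2D m0 H uX; rewrite mulr0 expR0 mulr1 subrK.
congr wl2; apply/funext => j; have [-> _] := sc.
by rewrite phase0 mul1r subrK.
Qed.

Lemma solves_cont_l2 c h m K X : admissible h -> solves c h -> growth m K ->
  wl2 m u0 X -> cont_l2 T m c.
Proof.
move=> ah sc gm uX; have [m0 K0 _] := gm; have [X0 _] := uX.
pose z t j := phase (- w j) t * c t j.
have -> : c = fun t j => phase (w j) t * z t j.
  apply/funext => t; apply/funext => j; rewrite /z mulrA -[w j in X in _ = X * _ * _]opprK.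
  by rewrite phaseN mul1r.
apply: cont_l2_phase => //.
  move=> t tT; exists (X * expR (K * t)); apply/wl2_phase.
  exact: (solves_grows_as ah sc tT gm uX).
move=> t tT e e0; pose h' s := X * expR (K * s).
have [de de0 H] : exists2 de : R, 0 < de & forall t', 0 <= t' <= T -> `|t' - t| < de ->
    `|h' t' - h' t| <= e.
  have [d1 d10 H1] := deriv_on_expR K X tT ltr01.
  pose M := `|K * (X * expR (K * t))| + 1; have M0 : 0 < M by rewrite ltr_wpDl.
  exists (Num.min d1 (e / M)); first by rewrite lt_min d10 divr_gt0.
  move=> t' t'T; rewrite lt_min => /andP[l1]; rewrite ltr_pdivlMr// => l2.
  have {H1} := H1 t' t'T l1; rewrite mul1r => H1.
  have -> : h' t' - h' t = (h' t' - h' t - (t' - t) * (K * (X * expR (K * t)))) +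
    (t' - t) * (K * (X * expR (K * t))) by ring.
  rewrite (le_trans (ler_normD _ _))// normrM; move: l2 H1; rewrite /M; lra.
exists de => // t' t'T l; have {H} := H t' t'T l.
rewrite ler_norml => /andP[H1 H2].
have /andP[t0 tT'] := tT; have /andP[t'0 t'T'] := t'T.
have [tt'|t't] := leP t t'.
  exact: wl2_le (solves_increment ah sc gm uX t0 tt' t'T') H2.
have := wl2N (wl2_le m0 (solves_increment ah sc gm uX t'0 (ltW t't) tT') (_ : _ <= e)).
rewrite -[_ - _ <= e]lerN2 opprB => /(_ H1).
by congr wl2; apply/funext => j; rewrite opprB.
Qed.

(** Duhamel's formula: the rotated coefficient is the datum plus a primitive of the rotated
    nonlinearity along [h], found separately at each frequency. *)
Lemma solve_linear h : admissible h -> exists c, solves c h /\ admissible c.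
Proof.
move=> ah.
have /choice[P HP] : forall j, exists P : R -> R[i], P 0 = 0 /\
    deriv_on T P (fun t => phase (- w j) t * N (h t) j).
  move=> j; apply: complex_primitive => //.
  move=> t tT e e0; have e20 : 0 < e / 2 by rewrite divr_gt0.
  have [d1 d10 H1] := N_cont j ah tT e20.
  have M0 : 0 < normc (N (h t) j) + 1 by rewrite ltr_wpDl// normc_ge0.
  have [d2 d20 H2] := deriv_on_cont (@deriv_on_phase R T (- w j)) tT (divr_gt0 e20 M0).
  exists (Num.min d1 d2); first by rewrite lt_min d10.
  move=> t' t'T; rewrite lt_min => /andP[l1 l2].
  have -> : phase (- w j) t' * N (h t') j - phase (- w j) t * N (h t) j =
     phase (- w j) t' * (N (h t') j - N (h t) j) +
     (phase (- w j) t' - phase (- w j) t) * N (h t) j by ring.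
  rewrite (le_trans (le_normcD _ _))// !Normc.normcM normc_phase mul1r [leRHS]splitr lerD//.
    exact: H1.
  apply: le_trans (ler_wpM2r (normc_ge0 _) (H2 t' t'T l2)) _.
  by rewrite -mulrA ler_piMr ?(ltW e20)// mulrC ler_pdivrMr// mul1r lerDl.
pose c t j := phase (w j) t * (u0 j + P j t).
have sc : solves c h.
  split; first by apply/funext => j; rewrite /c phase0 mul1r (HP j).1 addr0.
  move=> j; apply/rotate_deriv_on.
  have := deriv_on_shift_cst (u0 j) (HP j).2; apply: deriv_on_ext => // t _.
  by rewrite /c mulrA phaseN mul1r.
exists c; split => //; split; first by move=> t tT; exact: solves_grows_as ah sc tT.
by have [K gK [X uX]] := growth1; exact: (solves_cont_l2 ah sc gK uX).
Qed.

Lemma solves_difference c c' h h' (A : R) : solves c h -> solves c' h' -> 0 <= A ->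
  (forall t, 0 <= t <= T -> ball (h t)) -> (forall t, 0 <= t <= T -> ball (h' t)) ->
  (forall t, 0 <= t <= T -> wl2 (fun=> 1) (fun j => h t j - h' t j) (A * expR (2 * L * t))) ->
  forall t, 0 <= t <= T ->
    wl2 (fun=> 1) (fun j => c t j - c' t j) (A / 2 * expR (2 * L * t)).
Proof.
move=> [c0 dc] [c'0 dc'] A0 bh bh' hA.
apply: (gronwall_step (w := w) (x := fun t j => c t j - c' t j)
  (q := fun t j => N (h t) j - N (h' t) j)) => //.
- by move=> j; rewrite c0 c'0 subrr.
- move=> j; have := deriv_onB (dc j) (dc' j); apply: deriv_on_ext => // t _; ring.
- by move=> t tT; apply: N_lipschitz; [exact: bh|exact: bh'|exact: hA].
Qed.

Lemma admissible_free : admissible (fun t j => phase (w j) t * u0 j).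
Proof.
split.
  move=> t /andP[t0 _] m K X [m0 K0 _] uX; apply/wl2_phase.
  have [X0 _] := uX; apply: (wl2_le m0 uX); rewrite ler_peMr//.
  by apply: expR_ge1; exact: mulr_ge0.
have [K [m0 _ _] [X uX]] := growth1; apply: cont_l2_phase => //.
  by move=> t _; exists X.
move=> t tT e e0; exists 1 => // t' _ _; split; first exact: ltW.
move=> r ur; rewrite big1 ?sqr_ge0// => j _.
by rewrite subrr Normc.normc0 mulr0 expr0n.
Qed.

(** Successive iterates differ in l^2 by geometrically decreasing amounts, uniformly in time, so
    every coefficient converges; [wl2_closed] hands the growth bounds in all weights to the
    limit. *)
Theorem picard : exists c, solves c c /\ admissible c.
Proof.
(* The solution operator is made total by returning [h] itself outside the admissible curves, so
   that it can be iterated. *)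
have /choice[Phi HPhi] : forall h, exists c, admissible h -> solves c h /\ admissible c.
  move=> h; have [ah|nah] := pselect (admissible h); last by exists h.
  by have [c Hc] := solve_linear ah; exists c.
pose c n := iter n Phi (fun t j => phase (w j) t * u0 j).
have ac n : admissible (c n).
  by elim: n => [|n IH]; [exact: admissible_free|have [] := HPhi _ IH].
have sc n : solves (c n.+1) (c n) by have [] := HPhi _ (ac n).
have [K gK [X uX]] := growth1; have [m0 K0 _] := gK; have [X0 _] := uX.
(* The first two iterates are each bounded by X e^(K T), whence the factor 2. *)
pose A := 2 * (X * expR (K * T)).
have A0 : 0 <= A by rewrite !mulr_ge0// expR_ge0.
have eL t : 0 <= t -> 1 <= expR (2 * L * t) by move=> t0; apply: expR_ge1; rewrite !mulr_ge0// ltW.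
have step n t : 0 <= t <= T ->
    wl2 (fun=> 1) (fun j => c n.+1 t j - c n t j) (A / 2 ^+ n * expR (2 * L * t)).
  elim: n t => [|n IH] t tT; have /andP[t0 tT'] := tT.
    rewrite expr0 divr1; have [g1 _] := ac 1%N; have [g0 _] := ac 0%N.
    have := wl2B m0 (g1 t tT _ _ _ gK uX) (g0 t tT _ _ _ gK uX).
    move=> /wl2_le; apply => //; apply: (@le_trans _ _ A).
      by rewrite /A mulr_natl mulr2n lerD// ler_wpM2l// ler_expR ler_wpM2l.
    by rewrite ler_peMr// eL.
  have -> : A / 2 ^+ n.+1 = A / 2 ^+ n / 2 by rewrite exprSr invfM mulrA.
  apply: (solves_difference (sc n.+1) (sc n)) => //.
  - by rewrite divr_ge0// exprn_ge0.
  - by move=> s sT; exact: admissible_ball.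
  - by move=> s sT; exact: admissible_ball.
pose A' := A * expR (2 * L * T).
have step' n t : 0 <= t <= T ->
    wl2 (fun=> 1) (fun j => c n.+1 t j - c n t j) (A' / 2 ^+ n).
  move=> tT; apply: wl2_le (step n t tT) _ => //.
  rewrite /A' [leRHS]mulrAC ler_wpM2l ?divr_ge0 ?exprn_ge0// ler_expR.
  by have /andP[t0 tT'] := tT; rewrite ler_wpM2l// mulr_ge0// ltW.
have diff n k t : 0 <= t <= T ->
    wl2 (fun=> 1) (fun j => c (n + k)%N t j - c n t j) (2 * A' / 2 ^+ n).
  move=> tT; suff H : wl2 (fun=> 1) (fun j => c (n + k)%N t j - c n t j)
      (2 * A' / 2 ^+ n - 2 * A' / 2 ^+ (n + k)).
    by apply: wl2_le H _ => //; rewrite gerBl divr_ge0 ?mulr_ge0 ?exprn_ge0.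
  elim: k => [|k IH].
    rewrite addn0 subrr; split => // r ur; rewrite big1 ?sqr_ge0// => j _.
    by rewrite subrr Normc.normc0 mulr0 expr0n.
  have := wl2D m0 (step' (n + k)%N t tT) IH; rewrite addnS.
  have -> : A' / 2 ^+ (n + k) + (2 * A' / 2 ^+ n - 2 * A' / 2 ^+ (n + k)) =
     2 * A' / 2 ^+ n - 2 * A' / 2 ^+ (n + k).+1.
    by rewrite exprS; field; rewrite !expf_neq0.
  by congr wl2; apply/funext => j; rewrite subrKA.
have /choice[cl Hcl] : forall p : R * J, exists l, 0 <= p.1 <= T ->
    forall n, normc (l - c n p.1 p.2) <= 4 * A' / 2 ^+ n.
  move=> [t j] /=; have [tT|ntT] := boolP (0 <= t <= T); last by exists 0.
  have [l Hl] := complex_geometric_limit (fun n => wl2_normc j (step' n t tT)).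
  by exists l.
pose cl' t j := cl (t, j).
have small := @geometric_small R.
have lim_close m v (Y t : R) : (forall j, 0 <= m j) -> 0 <= Y -> 0 <= t <= T ->
   (exists n0, forall n, (n0 <= n)%N -> wl2 m (fun j => c n t j - v j) Y) ->
   wl2 m (fun j => cl' t j - v j) Y.
  move=> m0' Y0 tT [n0 H]; apply: wl2_closed => // r e e0.
  have [n1 H1] := small (4 * A') e e0; pose n := maxn n0 n1.
  exists (fun j => c n t j - v j); last first.
    by apply: (wl2_le m0' (H n (leq_maxl _ _))); rewrite lerDl ltW.
  move=> j _; have := Hcl (t, j) tT n; rewrite /cl' /= => Hn.
  have -> : cl (t, j) - v j - (c n t j - v j) = cl (t, j) - c n t j by ring.
  by rewrite (le_trans Hn)// H1// leq_maxr.
have cl_diff n t : 0 <= t <= T -> wl2 (fun=> 1) (fun j => cl' t j - c n t j) (2 * A' / 2 ^+ n).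
  move=> tT; apply: lim_close => //; first by rewrite divr_ge0 ?mulr_ge0 ?exprn_ge0.
  by exists n => k nk; rewrite -(subnKC nk); exact: diff.
have acl : admissible cl'.
  split.
    move=> t tT m K' Y gm uY; have [m0' _ _] := gm; have [Y0 _] := uY.
    have := @lim_close m (fun=> 0) (Y * expR (K' * t)) t m0'.
    rewrite (_ : (fun j => cl' t j - 0) = cl' t); last by apply/funext => j; rewrite subr0.
    apply => //; first by rewrite mulr_ge0// expR_ge0.
    exists 0%N => n _; rewrite (_ : (fun j => c n t j - 0) = c n t); last first.
      by apply/funext => j; rewrite subr0.
    by have [gc _] := ac n; exact: gc.
  move=> t tT e e0; have e30 : 0 < e / 3 by rewrite divr_gt0.
  have [n H] := small (2 * A') (e / 3) e30; have {}H := H n (leqnn n).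
  have [_ cc] := ac n; have [de de0 Hde] := cc t tT _ e30.
  exists de => // t' t'T l.
  have h1 := wl2_le m0 (cl_diff n t' t'T) H; have h2 := wl2_le m0 (cl_diff n t tT) H.
  have := wl2B m0 (wl2D m0 h1 (Hde t' t'T l)) h2.
  have -> : e / 3 + e / 3 + e / 3 = e by field.
  by congr wl2; apply/funext => j; ring.
(* The limit is not yet known to be differentiable. Solving once more with [cl'] in the nonlinearity
   produces a differentiable curve, and the contraction shows that it equals the limit on [0, T]. *)
have [c' [sc' ac']] := solve_linear acl.
have ceq t : 0 <= t <= T -> c' t = cl' t.
  move=> tT; apply/funext => j.
  have dist n : normc (c' t j - cl' t j) <= 2 * A' * expR (2 * L * T) / 2 ^+ n.
    have D0 : 0 <= 2 * A' / 2 ^+ n by rewrite divr_ge0 ?mulr_ge0 ?exprn_ge0.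
    have h1 : wl2 (fun=> 1) (fun j => c' t j - c n.+1 t j)
        (2 * A' / 2 ^+ n / 2 * expR (2 * L * t)).
      apply: (solves_difference sc' (sc n) D0) => //.
      - by move=> s sT; exact: admissible_ball.
      - by move=> s sT; exact: admissible_ball.
      - move=> s sT; apply: (wl2_le m0 (cl_diff n s sT)).
        by rewrite ler_peMr// eL//; case/andP: sT.
    have h2 := cl_diff n.+1 t tT.
    have := wl2_normc j (wl2B m0 h1 h2).
    have -> : c' t j - c n.+1 t j - (cl' t j - c n.+1 t j) = c' t j - cl' t j by ring.
    move=> /le_trans; apply.
    have /andP[t0 tT'] := tT; have T1 := eL T T0.
    have eT : expR (2 * L * t) <= expR (2 * L * T).
      by rewrite ler_expR ler_wpM2l// mulr_ge0// ltW.
    have -> : 2 * A' / 2 ^+ n.+1 = 2 * A' / 2 ^+ n / 2 by rewrite exprSr invfM mulrA.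
    have -> : 2 * A' * expR (2 * L * T) / 2 ^+ n =
       2 * A' / 2 ^+ n / 2 * (expR (2 * L * T) + expR (2 * L * T)).
      by field; rewrite expf_neq0.
    apply: (@le_trans _ _ (2 * A' / 2 ^+ n / 2 * (expR (2 * L * t) + 1))).
      by rewrite mulrDr mulr1.
    by apply: ler_wpM2l; [exact: divr_ge0|exact: lerD].
  apply/eqP; rewrite -subr_eq0; apply/eqP/Normc.eq0_normc/eqP.
  rewrite eq_le normc_ge0 andbT; apply/ler_addgt0Pr => e e0; rewrite add0r.
  have [n H] := small (2 * A' * expR (2 * L * T)) e e0.
  exact: le_trans (dist n) (H n (leqnn n)).
exists c'; split => //; have [c'0 dc'] := sc'; split => // j.
by apply: deriv_on_ext (dc' j) => // t tT; rewrite (ceq t tT).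
Qed.

End Picard.

(** * Sobolev norms as weighted sequence norms *)

Section SegmentFilters.
Context {R : realType}.
Variable T : R.

Lemma in_segment t : (t \in `[0, T]) = (0 <= t <= T).
Proof. by rewrite in_itv. Qed.

Lemma near_segmentP t (P : R -> Prop) :
  (\forall t' \near within `[0, T]%classic (nbhs t), P t') <->
  exists2 de : R, 0 < de & forall t', 0 <= t' <= T -> `|t' - t| < de -> P t'.
Proof.
split.
  rewrite near_withinE => /nbhs_ballP[de /= de0 H]; exists de => // t' t'T l.
  by apply: H; rewrite /ball /= ?in_itv//= distrC.
move=> [de de0 H]; rewrite near_withinE; apply/nbhs_ballP; exists de => //= t' l.
by rewrite /= in_itv /= => t'T; apply: H => //; rewrite distrC.
Qed.

Lemma near_punctured_segmentP t (P : R -> Prop) :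
  (\forall t' \near within `[0, T]%classic t^', P t') <->
  exists2 de : R, 0 < de &
    forall t', 0 <= t' <= T -> `|t' - t| < de -> t' != t -> P t'.
Proof.
split.
  rewrite near_withinE near_withinE => /nbhs_ballP[de /= de0 H]; exists de => // t' t'T l t't.
  by apply: (H t') => //; rewrite /ball /= ?in_itv//= distrC.
move=> [de de0 H]; rewrite near_withinE near_withinE; apply/nbhs_ballP; exists de => //= t' l t't.
by rewrite /= in_itv /= => t'T; apply: H => //; rewrite distrC.
Qed.

Lemma ereal_cvg0P (F : set_system R) (FF : Filter F) (f : R -> \bar R) :
  (forall t, 0 <= f t)%E ->
  (f t @[t --> F] --> 0%E) <-> (forall e : R, 0 < e -> \forall t \near F, (f t <= e%:E)%E).
Proof.
move=> f0; split=> [cf e e0|H].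
  have nb : nbhs (0%E : \bar R) [set x | (x < e%:E)%E].
    by apply: open_nbhs_nbhs; split => //; exact: open_ereal_lt_ereal.
  by apply: (@filterS _ F _ (fun t => (f t < e%:E)%E)) => [t /ltW|]; last exact: (cf _ nb).
apply/fine_cvgP; split.
  have := H 1 ltr01; apply: filterS => t ft.
  by rewrite ge0_fin_numE// (le_lt_trans ft)// ltry.
apply/cvgrPdist_le => e e0; have := H e e0; apply: filterS => t ft.
rewrite sub0r normrN ger0_norm ?fine_ge0// -lee_fin fineK//.
by rewrite ge0_fin_numE// (le_lt_trans ft)// ltry.
Qed.

(** Compactness of [0, T] by a supremum argument, for bounds given as a predicate monotone in the
    bound, as [wl2] is, rather than as values of a function. *)
Lemma locally_bounded_segment (P : R -> R -> Prop) : 0 <= T ->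
  (forall t X Y, P t X -> X <= Y -> P t Y) ->
  (forall t, 0 <= t <= T -> exists2 de : R, 0 < de & exists X,
    forall t', 0 <= t' <= T -> `|t' - t| < de -> P t' X) ->
  exists X, forall t, 0 <= t <= T -> P t X.
Proof.
move=> T0 mP lP.
pose S := [set x | 0 <= x <= T /\ exists X, forall t, 0 <= t <= x -> P t X].
have S0 : S 0.
  have h0 : 0 <= (0 : R) <= T by rewrite lexx.
  split=> //; have [de de0 [X HX]] := lP 0 h0.
  by exists X => t t0; apply: HX; move: t0 => /le_anti <-; rewrite ?lexx ?subrr ?normr0.
have hS : has_sup S by split; [exists 0|exists T => x [/andP[]]].
pose c := sup S.
have c0 : 0 <= c by apply: ub_le_sup => //; case: hS.
have cT : c <= T by apply: ge_sup; [exists 0|move=> x [/andP[]]].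
have cT' : 0 <= c <= T by rewrite c0.
have [de de0 [X HX]] := lP c cT'.
have [x Sx xc] := sup_adherent de0 hS; have [/andP[x0 xT] [Y HY]] := Sx.
pose y := Num.min T (c + de / 2).
have Sy : S y.
  split.
    by rewrite le_min T0 ge_min lexx addr_ge0// divr_ge0// ltW.
  exists (Num.max X Y) => t /andP[t0]; rewrite le_min => /andP[tT ty].
  have [tx|tx] := leP t x.
    by apply: mP (HY t _) _; rewrite ?t0// le_max lexx orbT.
  apply: mP (HX t _ _) _; rewrite ?t0 ?le_max ?lexx//.
  by rewrite ltr_norml; move: xc tx ty de0; rewrite -/c; lra.
have yc : y <= c by apply: ub_le_sup => //; case: hS.
have yT : y = T.
  move: yc; rewrite /y; case: (leP T (c + de / 2)) => // _; move: de0; lra.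
by have [_ [Z HZ]] := Sy; exists Z => t; rewrite -yT; exact: HZ.
Qed.

End SegmentFilters.

Section SobolevNorms.
Context {R : realType} {d : nat}.
Local Notation J := (d.-tuple int).
Local Notation vol := ((2 * pi : R) ^+ d).
Local Notation sv := (Num.sqrt vol).
Implicit Types (f g : torus R d -> R[i]) (v : J -> R[i]) (m : J -> R) (s r : R) (j : J).

(* Weights such that [Hnorm s] and [distrib_Hnorm r] (with [r] possibly negative)
   are, up to a factor 2, the l^2 norms with weights [hsw s] and [sv * bw r]. *)
Definition hsw s (j : J) : R := sv * (1 + freq_norm j `^ s).
Definition bw r (j : J) : R := (1 + freq_norm j ^+ 2) `^ (r / 2).

Lemma sv_ge0 : 0 <= sv. Proof. exact: sqrtr_ge0. Qed.

Lemma sv_ge1 : 1 <= sv.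
Proof.
rewrite -[leLHS]sqrtr1 ler_wsqrtr// exprn_ege1//.
by have := pi_ge2 R; lra.
Qed.

Lemma hsw_ge0 s j : 0 <= hsw s j.
Proof. by rewrite mulr_ge0 ?sv_ge0// addr_ge0// powR_ge0. Qed.

Lemma hswE s : hsw s = fun j => sv + sv * freq_norm j `^ s.
Proof. by apply/funext => j; rewrite /hsw mulrDr mulr1. Qed.

Lemma l2le_multiplier m v (X : R) : (forall j, 0 <= m j) ->
  l2le (multiplier m v) X <-> wl2 (fun j => sv * m j) v X.
Proof.
move=> m0; rewrite l2le_wl2 /wl2.
suff -> : (fun j => sv * normc (multiplier m v j)) = (fun j => sv * m j * normc (v j)) by [].
by apply/funext => j; rewrite /multiplier Normc.normcM normc_real ger0_norm// mulrA.
Qed.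

Lemma wl2_mono m m' v (X : R) : (forall j, 0 <= m' j <= m j) -> wl2 m v X -> wl2 m' v X.
Proof.
move=> mm vX; apply: (l2b_le vX) => // j; have /andP[m'0 m'm] := mm j.
by rewrite mulr_ge0 ?normc_ge0//= ler_wpM2r ?normc_ge0.
Qed.

Lemma wl2_addw m m' v (X Y : R) : wl2 m v X -> wl2 m' v Y ->
  wl2 (fun j => m j + m' j) v (X + Y).
Proof.
move=> vX vY; have := l2bD vX vY; rewrite /wl2.
by under [X in l2b X _]eq_fun do rewrite -mulrDl.
Qed.

Lemma wl2_scalew m v (c X : R) : 0 <= c -> wl2 m v X -> wl2 (fun j => c * m j) v (c * X).
Proof.
move=> c0 vX; have := l2bZ c0 vX; rewrite /wl2.
by under [X in l2b X _]eq_fun do rewrite mulrA.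
Qed.

Lemma distrib_L2norm_ge0 v : (0 <= distrib_L2norm v)%E.
Proof. by apply: le_ereal_inf_tmp => _ [g _ <-]; exact: Lnorm_ge0. Qed.

Lemma Hnorm_ge0 s f : (0 <= Hnorm s f)%E.
Proof. by rewrite adde_ge0 ?distrib_L2norm_ge0// Lnorm_ge0. Qed.

Lemma Hnorm_le s f (a b : R) : in_L2 f -> wl2 (fun=> sv) (fourier f) a ->
  wl2 (fun j => sv * freq_norm j `^ s) (fourier f) b -> (Hnorm s f <= (a + b)%:E)%E.
Proof.
move=> f2 fa fb; rewrite EFinD; apply: leeD.
  by apply/L2norm_leP => //; exact/l2le_wl2.
by apply/distrib_L2norm_leP/l2le_multiplier => // j; exact: powR_ge0.
Qed.

(** The two parts of the norm are recorded separately, and exactly, because the factor (2 M)^s of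
    the theorem is attached to the L^2 part alone. *)
Lemma in_HP s f : in_H s f -> exists a b, [/\ L2norm f = a%:E, Hnorm s f = (a + b)%:E,
  wl2 (fun=> sv) (fourier f) a & wl2 (fun j => sv * freq_norm j `^ s) (fourier f) b].
Proof.
move=> [f2]; rewrite /Hnorm => Hf.
have La : L2norm f \is a fin_num.
  by rewrite ge0_fin_numE ?Lnorm_ge0// (le_lt_trans _ Hf)// leeDl// distrib_L2norm_ge0.
have Db : distrib_L2norm (frac_laplacian s (fourier f)) \is a fin_num.
  by rewrite ge0_fin_numE ?distrib_L2norm_ge0// (le_lt_trans _ Hf)// leeDr// Lnorm_ge0.
exists (fine (L2norm f)), (fine (distrib_L2norm (frac_laplacian s (fourier f)))).
split; first by rewrite fineK.
- by rewrite EFinD !fineK.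
- by apply/l2le_wl2/L2norm_leP => //; rewrite fineK.
- apply/l2le_multiplier; first by move=> j; exact: powR_ge0.
  by apply/distrib_L2norm_leP; rewrite fineK.
Qed.

Lemma Hnorm_le_wl2 s f (e : R) : in_L2 f -> (Hnorm s f <= e%:E)%E -> wl2 (hsw s) (fourier f) e.
Proof.
move=> f2 He; have Hf : in_H s f by split => //; rewrite (le_lt_trans He)// ltry.
have [a [b [_ E fa fb]]] := in_HP Hf.
rewrite hswE; apply: wl2_le (wl2_addw fa fb) _; last by rewrite -lee_fin -E.
by move=> j; rewrite addr_ge0 ?mulr_ge0 ?sv_ge0 ?powR_ge0.
Qed.

Lemma wl2_hsw s v (X : R) : wl2 (hsw s) v X ->
  wl2 (fun=> sv) v X /\ wl2 (fun j => sv * freq_norm j `^ s) v X.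
Proof.
move=> vX; split; apply: wl2_mono vX => j; rewrite ?mulr_ge0 ?sv_ge0 ?powR_ge0//=.
  by rewrite ler_peMr ?sv_ge0// lerDl powR_ge0.
by rewrite ler_wpM2l ?sv_ge0// lerDr.
Qed.

Lemma wl2_Hnorm_le s f (X : R) : in_L2 f -> wl2 (hsw s) (fourier f) X ->
  (Hnorm s f <= (2 * X)%:E)%E.
Proof. by move=> f2 /wl2_hsw[fa fb]; rewrite mulr_natl mulr2n; exact: Hnorm_le. Qed.

Variable T : R.

Lemma C0_H_intro s (u : R -> torus R d -> R[i]) :
  (forall t, 0 <= t <= T -> in_L2 (u t)) ->
  (forall t, 0 <= t <= T -> exists X, wl2 (hsw s) (fourier (u t)) X) ->
  cont_l2 T (hsw s) (fun t => fourier (u t)) -> C0_H s T u.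
Proof.
move=> u2 uX cu t; rewrite in_segment => tT; split.
  split; first exact: u2.
  have [X HX] := uX t tT; rewrite (le_lt_trans (wl2_Hnorm_le (u2 t tT) HX))// ltry//.
apply/ereal_cvg0P; first by move=> t'; exact: Hnorm_ge0.
move=> e e0; apply/near_segmentP; have e20 : 0 < e / 2 by rewrite divr_gt0.
have [de de0 H] := cu t tT _ e20; exists de => // t' t'T l.
rewrite (_ : e = 2 * (e / 2)); last by field.
apply: wl2_Hnorm_le; first by apply: in_L2B; exact: u2.
rewrite (_ : fourier _ = fun j => fourier (u t') j - fourier (u t) j); first exact: H.
by apply/funext => j; rewrite fourierB//; apply: in_L2_cintegrable; exact: u2.
Qed.

Lemma C0_H_elim s (u : R -> torus R d -> R[i]) : C0_H s T u ->
  [/\ forall t, 0 <= t <= T -> in_L2 (u t),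
   forall t, 0 <= t <= T -> exists X, wl2 (hsw s) (fourier (u t)) X &
   cont_l2 T (hsw s) (fun t => fourier (u t))].
Proof.
move=> cu; have u2 t : 0 <= t <= T -> in_L2 (u t).
  by move=> tT; have [|[]] := cu t; rewrite ?in_segment.
split => // t tT; have [|uH] := cu t; rewrite ?in_segment//.
  have [a [b [_ E _ _]]] := in_HP uH; exists (a + b).
  by apply: Hnorm_le_wl2; [exact: u2|rewrite E].
move=> /ereal_cvg0P H e e0.
have /near_segmentP[de de0 He] := H (fun t' => Hnorm_ge0 s _) e e0.
exists de => // t' t'T l; have := Hnorm_le_wl2 (in_L2B (u2 t' t'T) (u2 t tT)) (He t' t'T l).
congr wl2; apply/funext => j.
by rewrite fourierB//; apply: in_L2_cintegrable; exact: u2.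
Qed.

Lemma bw_ge0 r j : 0 <= bw r j. Proof. exact: powR_ge0. Qed.

Lemma one_le_freq j : 1 <= 1 + freq_norm j ^+ 2 :> R.
Proof. by rewrite lerDl sqr_ge0. Qed.

Lemma distrib_Hnorm_ge0 r v : (0 <= distrib_Hnorm r v)%E.
Proof.
by rewrite /distrib_Hnorm; case: ifP => _; rewrite ?adde_ge0 ?distrib_L2norm_ge0.
Qed.

Lemma freq_powE r j : freq_norm j `^ r = (freq_norm j ^+ 2) `^ (r / 2) :> R.
Proof.
by rewrite -powR_mulrn ?freq_norm_ge0// -powRrM mulrC divfK.
Qed.

Lemma freq_powR_le_bw r j : 0 <= r -> freq_norm j `^ r <= bw r j.
Proof.
move=> r0; rewrite freq_powE /bw ge0_ler_powR ?nnegrE ?divr_ge0 ?sqr_ge0//.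
  by rewrite (le_trans ler01)// one_le_freq.
by rewrite lerDr.
Qed.

Lemma one_le_bw r j : 0 <= r -> 1 <= bw r j.
Proof.
move=> r0; have -> : 1 = 1 `^ (r / 2) :> R by rewrite powR1.
rewrite /bw ge0_ler_powR ?nnegrE ?divr_ge0//.
  by rewrite (le_trans ler01)// one_le_freq.
exact: one_le_freq.
Qed.

Lemma bw_le_hsw s j : 0 <= s -> sv * bw s j <= 2 `^ (s / 2) * hsw s j.
Proof.
move=> s0; rewrite /hsw mulrCA ler_wpM2l ?sv_ge0// /bw freq_powE.
have x0 : 0 <= freq_norm j ^+ 2 :> R by exact: sqr_ge0.
move: (freq_norm j ^+ 2) x0 => x x0.
apply: (@le_trans _ _ (2 `^ (s / 2) * (Num.max 1 x) `^ (s / 2))).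
  rewrite -powRM//; last by rewrite le_max ler01.
  rewrite ge0_ler_powR ?nnegrE ?addr_ge0 ?mulr_ge0 ?le_max ?ler01//.
  by case: (leP 1 x); lra.
rewrite ler_wpM2l//; case: (leP 1 x) => _; rewrite ?powR1 ?lerDl ?lerDr ?powR_ge0//.
Qed.

Lemma bwE s j : bw s j = bw (s - 2) j * (1 + freq_norm j ^+ 2).
Proof.
have h := one_le_freq j; have h0 : 0 < 1 + freq_norm j ^+ 2 :> R by apply: lt_le_trans h.
rewrite /bw -[X in _ = _ * X]powRr1 ?(ltW h0)// -powRD; last by rewrite (gt_eqF h0) implybT.
by congr (_ `^ _); field.
Qed.

Lemma sqr_freq_bw s j : freq_norm j ^+ 2 * bw (s - 2) j <= bw s j.
Proof. by rewrite [leRHS]bwE mulrC ler_wpM2l ?bw_ge0// lerDr. Qed.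

Lemma bw_sub2_le s j : bw (s - 2) j <= bw s j.
Proof. by rewrite [leRHS]bwE ler_peMr ?bw_ge0// one_le_freq. Qed.

(** Split at 1 + |j|^2 = 1 / eta: above, two derivatives are worth a factor eta; below, the weight
    is at most (1 / eta)^(s/2). Thus l^2 continuity and a uniform H^s bound give continuity in
    H^(s-2). *)
Lemma bw_interpolation s (eta : R) : 0 <= s -> 0 < eta ->
  exists2 C : R, 0 <= C & forall j, bw (s - 2) j <= C + eta * bw s j.
Proof.
move=> s0 eta0; exists (eta^-1 `^ (s / 2)); first exact: powR_ge0.
move=> j; have h := one_le_freq j.
have [l|l] := leP (1 + freq_norm j ^+ 2) (eta^-1).
  apply: (@le_trans _ _ (bw s j)); first exact: bw_sub2_le.
  rewrite (@le_trans _ _ (eta^-1 `^ (s / 2)))//; last by rewrite lerDl mulr_ge0 ?bw_ge0// ltW.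
  rewrite /bw ge0_ler_powR ?nnegrE ?divr_ge0// ?(le_trans ler01 h)//.
  by rewrite invr_ge0 ltW.
rewrite (@le_trans _ _ (eta * bw s j))//; last by rewrite lerDr powR_ge0.
rewrite (bwE s) mulrCA ler_peMr ?bw_ge0// mulrC -ler_pdivrMr// div1r ltW//.
Qed.

Lemma distrib_Hnorm_le r v (X : R) : wl2 (fun j => sv * bw r j) v X ->
  (distrib_Hnorm r v <= (2 * X)%:E)%E.
Proof.
move=> vX; rewrite /distrib_Hnorm; case: (leP 0 r) => r0.
  rewrite mulr_natl mulr2n EFinD; apply: leeD.
    apply/distrib_L2norm_leP/l2le_wl2; apply: wl2_mono vX => j.
    by rewrite sv_ge0 ler_peMr ?sv_ge0// one_le_bw.
  apply/distrib_L2norm_leP/l2le_multiplier; first by move=> j; exact: powR_ge0.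
  apply: wl2_mono vX => j; rewrite mulr_ge0 ?sv_ge0 ?powR_ge0//=.
  by rewrite ler_wpM2l ?sv_ge0// freq_powR_le_bw.
apply: (@le_trans _ _ X%:E).
  by apply/distrib_L2norm_leP/l2le_multiplier => // j; exact: bw_ge0.
by have [X0 _] := vX; rewrite lee_fin mulr_natl mulr2n lerDl.
Qed.

Lemma wl2_coef m v (X : R) j : wl2 m v X -> 0 <= m j -> m j * normc (v j) <= X.
Proof.
move=> [X0 /(_ [:: j] isT)]; rewrite big_seq1 => h m0.
by move: h; rewrite ler_sqr ?nnegrE ?mulr_ge0 ?normc_ge0.
Qed.

Lemma distrib_Hnorm_coef r j : exists2 a : R, 0 < a &
  forall v (e : R), (distrib_Hnorm r v <= e%:E)%E -> a * normc (v j) <= e.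
Proof.
rewrite /distrib_Hnorm; case: (leP 0 r) => r0.
  exists sv; first by rewrite (lt_le_trans ltr01)// sv_ge1.
  move=> v e H; have /l2le_wl2/wl2_coef : l2le v e.
    by apply/distrib_L2norm_leP; rewrite (le_trans _ H)// leeDl// distrib_L2norm_ge0.
  by apply; exact: sv_ge0.
exists (sv * bw r j).
  rewrite mulr_gt0//; first by rewrite (lt_le_trans ltr01)// sv_ge1.
  by rewrite powR_gt0// (lt_le_trans ltr01)// one_le_freq.
move=> v e /distrib_L2norm_leP/l2le_multiplier => /(_ (bw_ge0 r)) /wl2_coef; apply.
by rewrite mulr_ge0 ?sv_ge0 ?bw_ge0.
Qed.

Lemma C0_distrib_H_intro r (w : R -> J -> R[i]) :
  (forall t, 0 <= t <= T -> exists X, wl2 (fun j => sv * bw r j) (w t) X) ->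
  cont_l2 T (fun j => sv * bw r j) w -> C0_distrib_H r T w.
Proof.
move=> wX cw t; rewrite in_segment => tT; split.
  have [X HX] := wX t tT; rewrite /in_distrib_H (le_lt_trans (distrib_Hnorm_le HX))// ltry//.
apply/ereal_cvg0P; first by move=> t'; exact: distrib_Hnorm_ge0.
move=> e e0; apply/near_segmentP; have e20 : 0 < e / 2 by rewrite divr_gt0.
have [de de0 H] := cw t tT _ e20; exists de => // t' t'T l.
rewrite (_ : e = 2 * (e / 2)); last by field.
by apply: distrib_Hnorm_le; exact: H.
Qed.

Lemma wl2_scale m v (a : R[i]) (X : R) : wl2 m v X -> wl2 m (fun j => a * v j) (normc a * X).
Proof.
move=> vX; have := l2bZ (normc_ge0 a) vX; rewrite /wl2.
suff -> : (fun j => normc a * (m j * normc (v j))) = (fun j => m j * normc (a * v j)) by [].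
by apply/funext => j; rewrite Normc.normcM mulrCA.
Qed.

Lemma deriv_on_affine (K : R[i]) t : deriv_on T (fun x => (x - t)%:C * K) (fun=> K).
Proof.
move=> x xT e e0; exists 1 => // x' _ _.
rewrite (_ : _ - _ - _ = 0) ?Normc.normc0 ?mulr_ge0 ?(ltW e0)//.
by rewrite !rmorphB /=; ring.
Qed.

(** The mean value inequality for [w] minus the affine curve of slope [w' t]: the derivative of this
    difference is [w' x] - [w' t], bounded by [e] between the two times. *)
Lemma wl2_difference_quotient m (w w' : R -> J -> R[i]) (t t' e : R) :
  (forall j, 0 <= m j) -> 0 <= t <= T -> 0 <= t' <= T ->
  (forall j, deriv_on T (w ^~ j) (w' ^~ j)) ->
  (forall x, Num.min t t' <= x <= Num.max t t' -> wl2 m (fun j => w' x j - w' t j) e) ->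
  t' != t -> wl2 m (fun j => ((t' - t)^-1)%:C * (w t' j - w t j) - w' t j) e.
Proof.
move=> m0 /andP[t0 tT] /andP[t'0 t'T] dw we t't.
pose z x j := w x j - (x - t)%:C * w' t j.
have dz j : deriv_on T (z ^~ j) (fun x => w' x j - w' t j).
  by apply: deriv_onB => //; exact: deriv_on_affine.
have dh : rderiv_on T (fun x => e * x) (fun=> e).
  by apply: rderiv_on_is_derive => x _; apply: is_derive_eq; rewrite /GRing.scale /=; ring.
have tt0 : t' - t != 0 by rewrite subr_eq0.
have key : wl2 m (fun j => w t' j - w t j - (t' - t)%:C * w' t j) (`|t' - t| * e).
  have zE : z t' = fun j => w t' j - (t' - t)%:C * w' t j by [].
  have zE0 : z t = w t by apply/funext => j; rewrite /z subrr mul0r subr0.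
  move: we; case: (leP t t') => tt' we.
    rewrite ger0_norm ?subr_ge0// mulrC mulrBr.
    have := wl2_mean_value m0 t0 tt' t'T dz dh we; rewrite zE zE0.
    by congr wl2; apply/funext => j; rewrite addrAC.
  rewrite distrC ger0_norm ?subr_ge0 ?(ltW tt')// mulrC mulrBr.
  have := wl2N (wl2_mean_value m0 t'0 (ltW tt') tT dz dh we); rewrite zE zE0.
  by congr wl2; apply/funext => j; rewrite opprB addrAC.
have := wl2_scale ((t' - t)^-1)%:C key.
rewrite normc_real mulrA -normrM mulVf// normr1 mul1r.
congr wl2; apply/funext => j; rewrite mulrBr mulrA -rmorphM /= mulVf// mul1r//.
Qed.


Lemma C1_distrib_H_intro r (w w' : R -> J -> R[i]) :
  (forall t, 0 <= t <= T -> exists X, wl2 (fun j => sv * bw r j) (w t) X) ->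
  cont_l2 T (fun j => sv * bw r j) w ->
  (forall t, 0 <= t <= T -> exists X, wl2 (fun j => sv * bw r j) (w' t) X) ->
  cont_l2 T (fun j => sv * bw r j) w' ->
  (forall j, deriv_on T (w ^~ j) (w' ^~ j)) -> C1_distrib_H r T w w'.
Proof.
move=> wX cw wX' cw' dw; split; [exact: C0_distrib_H_intro..|].
move=> t; rewrite in_segment => tT.
apply/ereal_cvg0P; first by move=> t'; exact: distrib_Hnorm_ge0.
move=> e e0; apply/near_punctured_segmentP; have e20 : 0 < e / 2 by rewrite divr_gt0.
have [de de0 H] := cw' t tT _ e20; exists de => // t' t'T l t't.
rewrite (_ : e = 2 * (e / 2)); last by field.
apply: distrib_Hnorm_le; apply: wl2_difference_quotient => // [j|x].
  by rewrite mulr_ge0 ?sv_ge0 ?bw_ge0.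
have /andP[t0 tT'] := tT; have /andP[t'0 t'T'] := t'T.
move=> xtt; apply: H; first by move: xtt; case: (leP t t'); lra.
by move: l xtt; rewrite !ltr_norml; case: (leP t t'); lra.
Qed.

Lemma C1_distrib_H_elim r (w w' : R -> J -> R[i]) j : C1_distrib_H r T w w' ->
  deriv_on T (w ^~ j) (w' ^~ j).
Proof.
move=> [_ _ dw] t tT e e0; have [a a0 Ha] := distrib_Hnorm_coef r j.
have := dw t; rewrite in_segment => /(_ tT) /ereal_cvg0P => /(_ (fun=> distrib_Hnorm_ge0 r _)).
move=> /(_ _ (mulr_gt0 a0 e0)) /near_punctured_segmentP[de de0 H]; exists de => // t' t'T l.
have [->|t't] := eqVneq t' t.
  by rewrite !subrr normr0 mulr0 mul0r subrr Normc.normc0.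
have tt0 : t' - t != 0 by rewrite subr_eq0.
have := Ha _ _ (H t' t'T l t't); rewrite ler_pM2l// => {}H.
have -> : w t' j - w t j - (t' - t)%:C * w' t j =
    (t' - t)%:C * (((t' - t)^-1)%:C * (w t' j - w t j) - w' t j).
  by rewrite mulrBr mulrA -rmorphM /= divff// mul1r.
by rewrite Normc.normcM normc_real mulrC ler_wpM2r.
Qed.

End SobolevNorms.

(** * The nonlinear Schrodinger evolution *)

Section Nonlinearity.
Context {R : realType} {d : nat}.
Local Notation J := (d.-tuple int).
Local Notation vol := ((2 * pi : R) ^+ d).
Local Notation sv := (Num.sqrt vol).
Implicit Types (f g : torus R d -> R[i]) (v : J -> R[i]) (m : J -> R) (s r : R) (j : J).
Variables (p : nat) (sgn : bool).

(** The power nonlinearity acts pointwise, so coefficients must be turned back into a function.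
    Representatives agree almost everywhere; the default 0 is for families that are not square
    summable. *)
Definition synthesis v : torus R d -> R[i] := xget (fun=> 0) [set g | in_L2 g /\ fourier g = v].

Lemma synthesisP v (X : R) : l2le v X -> in_L2 (synthesis v) /\ fourier (synthesis v) = v.
Proof. by move=> /riesz_fischer[g [g2 gv _]]; rewrite /synthesis; case: xgetP => // /(_ g)[]. Qed.

(* The equation reads [c_j' = i |j|^2 c_j + (nonlin c)_j]. *)
Definition nonlin v : J -> R[i] :=
  fun j => ('i)%C * (-1) ^+ sgn * fourier (power_nonlinearity p (synthesis v)) j.

(** Square summability comes without a bound of its own: it makes [synthesis] meaningful, while the
    [l^1] radius controls the nonlinearity. *)
Definition l1ball (B : R) v := (exists X, l2le v X) /\ wl1 v B.

Lemma normc_isgn : normc (('i)%C * (-1) ^+ sgn : R[i]) = 1.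
Proof.
rewrite Normc.normcM; have -> : normc ('i)%C = 1 :> R.
  by rewrite /Normc.normc expr0n /= add0r expr1n sqrtr1.
have -> : (-1) ^+ sgn = ((-1) ^+ sgn)%:C :> R[i] by rewrite rmorphXn rmorphN1.
by rewrite mul1r normc_real normrX normrN1 expr1n.
Qed.

Lemma l1ball_synthesis (B : R) v : l1ball B v ->
  [/\ in_L2 (synthesis v), fourier (synthesis v) = v & wl1 (fourier (synthesis v)) B].
Proof. by move=> [[X /synthesisP[h E]] vB]; split => //; rewrite E. Qed.

Lemma wl2_isgn m v (X : R) : wl2 m v X -> wl2 m (fun j => ('i)%C * (-1) ^+ sgn * v j) X.
Proof. by move=> /(wl2_scale (('i)%C * (-1) ^+ sgn)); rewrite normc_isgn mul1r. Qed.

Lemma nonlin_lipschitz (B D : R) v v' : l1ball B v -> l1ball B v' ->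
  wl2 (fun=> 1) (fun j => v j - v' j) D ->
  wl2 (fun=> 1) (fun j => nonlin v j - nonlin v' j) ((2 * p + 1)%:R * B ^+ (2 * p) * D).
Proof.
move=> /l1ball_synthesis[v2 vE vB] /l1ball_synthesis[v'2 v'E v'B] vv'.
have [pv _] := power_nonlinearity_wl1 p v2 vB.
have [pv' _] := power_nonlinearity_wl1 p v'2 v'B.
have := power_nonlinearity_lipschitz (D := D) p ler01 v2 v'2 vB v'B.
rewrite (_ : fourier (fun x => synthesis v x - synthesis v' x) = fun j => v j - v' j); last first.
  by apply/funext => j; rewrite fourierB ?vE ?v'E//; exact: in_L2_cintegrable.
move=> /(_ vv') /wl2_isgn; congr wl2; apply/funext => j.
by rewrite /nonlin fourierB -?mulrBr//; exact: in_L2_cintegrable.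
Qed.

Lemma nonlin_growth (B kappa : R) m : 0 <= B -> weight kappa m ->
  growth nonlin (l1ball B) m ((2 * p + 1)%:R * kappa ^+ (2 * p) * B ^+ (2 * p)).
Proof.
move=> B0 wm; have [k1 m0 _ _] := wm; split => //.
  by rewrite !mulr_ge0// exprn_ge0// (le_trans ler01).
move=> v X /l1ball_synthesis[v2 vE vB] vX; apply: wl2_isgn.
by apply: power_nonlinearity_wl2 => //; rewrite vE.
Qed.

Lemma weight_scale (c kappa : R) m : 0 <= c -> weight kappa m -> weight kappa (fun j => c * m j).
Proof.
move=> c0 [k1 m0 mD mN]; split => // [j|j k|j]; first exact: mulr_ge0.
  by rewrite -mulrDr mulrCA ler_wpM2l.
by rewrite mN.
Qed.

Lemma weight_cst (c kappa : R) : 0 <= c -> 1 <= kappa -> weight kappa (fun _ : J => c).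
Proof.
move=> c0 k1; split => // _ _.
by rewrite (@le_trans _ _ (c + c))// ?lerDl// ler_peMl// addr_ge0.
Qed.

(** The factor 2^s of the Sobolev weight is used for constant weights too, so that the L^2 part and
    the homogeneous part of a norm grow at one common rate. *)
Definition growth_rate (B s : R) := (2 * p + 1)%:R * (2 `^ s) ^+ (2 * p) * B ^+ (2 * p).

Lemma two_powR_ge1 s : 0 <= s -> 1 <= 2 `^ s :> R.
Proof. by move=> s0; rewrite -[leLHS](powRr0 2) ler_powR// ler1n. Qed.

Lemma growth_cst (B s c : R) : 0 <= B -> 0 <= c -> 0 <= s ->
  growth nonlin (l1ball B) (fun=> c) (growth_rate B s).
Proof.
by move=> B0 c0 s0; apply: nonlin_growth => //; apply: weight_cst => //; exact: two_powR_ge1.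
Qed.

Lemma growth_sobolev (B s : R) : 0 <= B -> 0 <= s ->
  growth nonlin (l1ball B) (fun j => sv * freq_norm j `^ s) (growth_rate B s).
Proof.
move=> B0 s0; apply: nonlin_growth => //; apply: weight_scale; first exact: sv_ge0.
exact: sobolev_weight.
Qed.

Lemma weight_add (kappa : R) m m' : weight kappa m -> weight kappa m' ->
  weight kappa (fun j => m j + m' j).
Proof.
move=> [k1 m0 mD mN] [_ m'0 m'D m'N]; split => // [j|j k|j]; first exact: addr_ge0.
  by rewrite addrACA mulrDr lerD.
by rewrite mN m'N.
Qed.

Lemma growth_hsw (B s : R) : 0 <= B -> 0 <= s ->
  growth nonlin (l1ball B) (hsw s) (growth_rate B s).
Proof.
move=> B0 s0; apply: nonlin_growth => //; rewrite hswE; apply: weight_add.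
  by apply: weight_cst (sv_ge0) (two_powR_ge1 s0).
by apply: weight_scale; [exact: sv_ge0|exact: sobolev_weight].
Qed.

End Nonlinearity.

Section ContinuousCurves.
Context {R : realType} {d : nat}.
Local Notation J := (d.-tuple int).
Implicit Types (m : J -> R) (c : R -> J -> R[i]).
Variable T : R.

Lemma cont_l2_ext m c c' : (forall t, 0 <= t <= T -> c t = c' t) ->
  cont_l2 T m c -> cont_l2 T m c'.
Proof.
move=> cc' cc t tT e e0; have [de de0 H] := cc t tT e e0; exists de => // t' t'T l.
by rewrite -!cc'//; exact: H.
Qed.

Lemma cont_l2_mono m m' c (a : R) : 0 < a -> (forall j, 0 <= m' j <= a * m j) ->
  cont_l2 T m c -> cont_l2 T m' c.
Proof.
move=> a0 mm cc t tT e e0; have [de de0 H] := cc t tT _ (divr_gt0 e0 a0).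
exists de => // t' t'T l; have := wl2_scalew (ltW a0) (H t' t'T l).
by rewrite mulrC divfK ?gt_eqF// => /wl2_mono; apply.
Qed.

Lemma cont_l2D m c c' : (forall j, 0 <= m j) -> cont_l2 T m c -> cont_l2 T m c' ->
  cont_l2 T m (fun t j => c t j + c' t j).
Proof.
move=> m0 cm cm' t tT e e0; have e20 : 0 < e / 2 by rewrite divr_gt0.
have [d1 d10 H1] := cm t tT _ e20; have [d2 d20 H2] := cm' t tT _ e20.
exists (Num.min d1 d2); first by rewrite lt_min d10.
move=> t' t'T; rewrite lt_min => /andP[l1 l2].
have := wl2D m0 (H1 t' t'T l1) (H2 t' t'T l2); rewrite -splitr.
by congr wl2; apply/funext => j; rewrite opprD addrACA.
Qed.

(** The constant part of the weight is handled by l^2 continuity and the part eta m' by the bound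
    [X]; eta is chosen so that 2 eta X <= e / 2. *)
Lemma cont_l2_interpolate m m' c (X : R) : 0 <= X -> (forall j, 0 <= m j) ->
  (forall j, 0 <= m' j) ->
  (forall eta : R, 0 < eta -> exists2 C : R, 0 <= C & forall j, m j <= C + eta * m' j) ->
  cont_l2 T (fun=> 1) c -> (forall t, 0 <= t <= T -> wl2 m' (c t) X) -> cont_l2 T m c.
Proof.
move=> X0 m0 m'0 mm' c1 cX t tT e e0; have X1 : 0 < 4 * (X + 1) by rewrite mulr_gt0// ltr_wpDl.
pose eta := e / (4 * (X + 1)); have eta0 : 0 < eta by rewrite divr_gt0.
have [C C0 mC] := mm' _ eta0; have C1 : 0 < C + 1 by rewrite ltr_wpDl.
pose e1 := e / 2 / (C + 1); have e10 : 0 < e1 by rewrite !divr_gt0.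
have [de de0 H] := c1 t tT _ e10; exists de => // t' t'T l.
have h1 := wl2_scalew C0 (H t' t'T l).
have h2 := wl2_scalew (ltW eta0) (wl2B m'0 (cX t' t'T) (cX t tT)).
have h : wl2 m (fun j => c t' j - c t j) (C * e1 + eta * (X + X)).
  by apply: wl2_mono (wl2_addw h1 h2) => j; rewrite m0 mulr1 mC.
apply: (wl2_le m0 h).
have : C * e1 <= e / 2.
  by rewrite /e1 mulrCA ler_piMr ?divr_ge0 ?(ltW e0)// ler_pdivrMr// mul1r lerDl.
have -> : eta * (X + X) = e / 2 * (X / (X + 1)).
  by rewrite /eta; field; rewrite gt_eqF// ltr_wpDl.
have : e / 2 * (X / (X + 1)) <= e / 2.
  by rewrite ler_piMr ?divr_ge0 ?(ltW e0)// ler_pdivrMr ?ltr_wpDl// mul1r lerDl.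
move: (C * e1) (_ * (_ / _)) => a b; lra.
Qed.

End ContinuousCurves.

Section Evolution.
Context {R : realType} {d : nat}.
Local Notation J := (d.-tuple int).
Local Notation vol := ((2 * pi : R) ^+ d).
Local Notation sv := (Num.sqrt vol).
Implicit Types (s r t : R) (j : J).
Variables (p : nat) (sgn : bool) (B T : R) (u0 : torus R d -> R[i]).
Local Notation N := (nonlin p sgn).
Local Notation ball := (l1ball B).
Local Notation w := (fun j : J => freq_norm j ^+ 2 : R).
Local Notation K := (growth_rate p B).
Hypothesis T0 : 0 <= T.
Hypothesis B0 : 0 <= B.
Hypothesis u02 : in_L2 u0.

Hypothesis gb : forall t v, 0 <= t <= T -> grows_as N ball (fourier u0) t v -> ball v.

Lemma evolution_exists :
  exists c, solves T w N (fourier u0) c c /\ admissible T N ball (fourier u0) c.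
Proof.
have L0 : 0 <= (2 * p + 1)%:R * B ^+ (2 * p) :> R by rewrite mulr_ge0// exprn_ge0.
(* [picard] wants a positive Lipschitz constant while [B] may be 0, hence the added 1. *)
apply: (@picard _ _ T w N ball ((2 * p + 1)%:R * B ^+ (2 * p) + 1) (fourier u0) T0 _ _ gb) => //.
- by rewrite ltr_wpDl.
- move=> v v' D bv bv' vv'; apply: (wl2_le (fun=> ler01) (nonlin_lipschitz p sgn bv bv' vv')).
  by have [D0 _] := vv'; rewrite mulrDl lerDl mul1r.
- exists (K 0); first exact: growth_cst.
  exists (Num.sqrt (sqnorm u0)); apply: (@wl2_mono _ _ (fun=> sv)) => [j|].
    by rewrite ler01 sv_ge1.
  by apply/l2le_wl2; apply: l2le_fourier => //; rewrite sqr_sqrtr // sqnorm_ge0.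
Qed.

Variable c : R -> J -> R[i].
Hypothesis sc : solves T w N (fourier u0) c c.
Hypothesis ac : admissible T N ball (fourier u0) c.

Let cb t : 0 <= t <= T -> ball (c t).
Proof. exact: (admissible_ball gb ac). Qed.

Local Notation u := (fun t => synthesis (c t)).
Local Notation ut := (fun t j => ((w j) *i) * c t j + N (c t) j).

Lemma evolution_synthesis t : 0 <= t <= T -> in_L2 (u t) /\ fourier (u t) = c t.
Proof. by move=> tT; have [] := l1ball_synthesis (cb tT). Qed.

Lemma evolution_wl2 s (a b t : R) : 0 <= s -> 0 <= t <= T ->
  wl2 (fun=> sv) (fourier u0) a -> wl2 (fun j => sv * freq_norm j `^ s) (fourier u0) b ->
  wl2 (fun=> sv) (c t) (a * expR (K s * t)) /\
  wl2 (fun j => sv * freq_norm j `^ s) (c t) (b * expR (K s * t)).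
Proof.
move=> s0 tT ua ub; have [gc _] := ac; split; apply: (gc t tT) => //.
  by apply: growth_cst => //; exact: sv_ge0.
exact: growth_sobolev.
Qed.

Lemma evolution_Hnorm_le s (a b t : R) : 0 <= s -> 0 <= t <= T ->
  wl2 (fun=> sv) (fourier u0) a -> wl2 (fun j => sv * freq_norm j `^ s) (fourier u0) b ->
  (Hnorm s (u t) <= ((a + b) * expR (K s * t))%:E)%E.
Proof.
move=> s0 tT ua ub; have [u2 uE] := evolution_synthesis tT.
by have [ha hb] := evolution_wl2 s0 tT ua ub; rewrite mulrDl; apply: Hnorm_le; rewrite ?uE.
Qed.

(** The Laplacian part of the derivative loses exactly two orders and inherits continuity from [c].
    The nonlinear part is controlled by differences only in l^2, but it is bounded in H^s, and
    interpolation between the two makes it continuous in H^(s-2). *)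
Lemma evolution_solution_class s : 0 <= s -> in_H s u0 -> solution_class s T u ut.
Proof.
move=> s0 /in_HP[a [b [_ _ ua ub]]].
have ge0 r j : 0 <= sv * bw r j by rewrite mulr_ge0 ?sv_ge0 ?bw_ge0.
pose Y := (a + b) * expR (K s * T).
have gH := growth_hsw p sgn (d := d) B0 s0; have [h0 K0 gN] := gH.
have uab : wl2 (hsw s) (fourier u0) (a + b) by rewrite hswE; exact: wl2_addw.
have cY t : 0 <= t <= T -> wl2 (hsw s) (c t) Y.
  move=> tT; have [gc _] := ac; apply: (wl2_le h0 (gc t tT _ _ _ gH uab)).
  have [ab0 _] := uab; rewrite ler_wpM2l// ler_expR ler_wpM2l//.
  by case/andP: tT.
have cc : cont_l2 T (hsw s) c := solves_cont_l2 gb ac sc gH uab.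
have NY t : 0 <= t <= T -> wl2 (hsw s) (N (c t)) (K s * Y).
  by move=> tT; apply: gN; [exact: cb|exact: cY].
have p2 : 0 < 2 `^ (s / 2) :> R by rewrite powR_gt0.
have bwh v X : wl2 (hsw s) v X -> wl2 (fun j => sv * bw s j) v (2 `^ (s / 2) * X).
  move=> /(wl2_scalew (ltW p2)) /wl2_mono; apply => j.
  by rewrite ge0 bw_le_hsw.
have bwh2 v X : wl2 (fun j => sv * bw s j) v X -> wl2 (fun j => sv * bw (s - 2) j) v X.
  by move=> /wl2_mono; apply => j; rewrite ge0 ler_wpM2l ?sv_ge0// bw_sub2_le.
have cbw : cont_l2 T (fun j => sv * bw s j) c.
  by apply: cont_l2_mono p2 _ cc => j; rewrite ge0 bw_le_hsw.
have cbw2 : cont_l2 T (fun j => sv * bw (s - 2) j) c.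
  apply: cont_l2_mono ltr01 _ cbw => j.
  by rewrite mul1r ge0 ler_wpM2l ?sv_ge0// bw_sub2_le.
have lapl v X : wl2 (fun j => sv * bw s j) v X ->
    wl2 (fun j => sv * bw (s - 2) j) (fun j => ((w j) *i) * v j) X.
  move=> vX; apply: (l2b_le vX) => // j.
  rewrite mulr_ge0 ?ge0 ?normc_ge0//= Normc.normcM mulrA ler_wpM2r ?normc_ge0//.
  have -> : normc ((w j) *i) = freq_norm j ^+ 2.
    by rewrite /Normc.normc /= expr0n add0r sqrtr_sqr ger0_norm ?sqr_ge0.
  by rewrite -mulrA ler_wpM2l ?sv_ge0// mulrC sqr_freq_bw.
have [_ dc] := sc.
have uE t : 0 <= t <= T -> c t = fourier (u t) by move=> /evolution_synthesis[].
split.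
  apply: C0_H_intro => [t /evolution_synthesis[]//|t tT|].
    by exists Y; rewrite -uE//; exact: cY.
  exact: cont_l2_ext cc.
apply: C1_distrib_H_intro => [t tT|||| j].
- by exists (2 `^ (s / 2) * Y); rewrite -uE//; apply/bwh2/bwh/cY.
- exact: cont_l2_ext cbw2.
- move=> t tT; exists (2 `^ (s / 2) * Y + 2 `^ (s / 2) * (K s * Y)); apply: wl2D => //.
    exact/lapl/bwh/cY.
  exact/bwh2/bwh/NY.
- apply: cont_l2D => //.
    move=> t tT e e0; have [de de0 H] := cbw t tT e e0; exists de => // t' t'T l.
    by have := lapl _ _ (H t' t'T l); congr wl2; apply/funext => j; rewrite mulrBr.
  apply: (cont_l2_interpolate (m' := fun j => sv * bw s j) (X := 2 `^ (s / 2) * (K s * Y))) => //.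
  + have h00 : 0 <= (0 : R) <= T by rewrite lexx.
    by have [] := bwh _ _ (NY 0 h00).
  + move=> eta /(bw_interpolation (d := d) s0)[C C0 HC].
    exists (sv * C); first by rewrite mulr_ge0 ?sv_ge0.
    by move=> j; rewrite mulrCA -mulrDr ler_wpM2l ?sv_ge0.
  + have [_ c1] := ac; pose L := (2 * p + 1)%:R * B ^+ (2 * p) : R.
    have L0 : 0 <= L by rewrite mulr_ge0// exprn_ge0.
    move=> t tT e e0; have L1 : 0 < L + 1 by rewrite ltr_wpDl.
    have [de de0 H] := c1 t tT _ (divr_gt0 e0 L1); exists de => // t' t'T l.
    apply: (wl2_le (fun=> ler01) (nonlin_lipschitz p sgn (cb t'T) (cb tT) (H t' t'T l))).
    by rewrite mulrCA ler_piMr ?(ltW e0)// ler_pdivrMr// mul1r lerDl.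
  + by move=> t tT; apply/bwh/NY.
- apply: deriv_on_ext (dc j) => // t tT; by rewrite -uE.
Qed.

Lemma evolution_NLS_solution s : 0 <= s -> in_H s u0 -> NLS_solution p sgn s T u0 u.
Proof.
move=> s0 Hu; have [c0 _] := sc; split.
  have h0 : 0 <= (0 : R) <= T by rewrite lexx.
  have [u2 uE] := evolution_synthesis h0.
  apply: fourier_inj_ae; [exact: in_L2_cintegrable..|].
  by move=> j; rewrite uE c0.
exists ut; first exact: evolution_solution_class.
move=> t; rewrite in_segment => tT j; have [_ uE] := evolution_synthesis tT.
rewrite uE /laplacian /multiplier /nonlin.
have ii : ('i)%C * ('i)%C = -1 :> R[i] by rewrite -expr2 sqr_i.
have -> : (w j) *i = ('i)%C * (w j)%:C by apply: eq_ReIm; rewrite !ReImE /=; ring.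
rewrite rmorphN /=; move: (fourier _ _) ((w j)%:C) ((-1) ^+ sgn) ('i)%C ii => F W S I II.
have -> : I * (I * W * c t j + I * S * F) - - W * c t j + S * F =
  (I * I + 1) * (W * c t j + S * F) by ring.
by rewrite II addNr mul0r.
Qed.

End Evolution.

(** * Uniqueness in the solution class *)

Section Uniqueness.
Context {R : realType} {d : nat}.
Local Notation J := (d.-tuple int).
Local Notation vol := ((2 * pi : R) ^+ d).
Local Notation sv := (Num.sqrt vol).
Implicit Types (s r t : R) (j : J) (u v : R -> torus R d -> R[i]).
Variables (p : nat) (sgn : bool) (s0 s1 T : R) (u0 : torus R d -> R[i]).
Local Notation N := (nonlin p sgn).
Local Notation w := (fun j : J => freq_norm j ^+ 2 : R).
Hypothesis d0 : (0 < d)%N.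
Hypothesis ds0 : d%:R / 2 < s0.
Hypothesis s01 : s0 <= s1.
Hypothesis T0 : 0 <= T.
Hypothesis u02 : in_L2 u0.

Lemma freq_weight_le_hsw j : 1 * freq_weight j `^ s0 <= hsw s1 j.
Proof.
rewrite mul1r /hsw (@le_trans _ _ (1 + freq_norm j `^ s1))//; last first.
  by rewrite ler_peMl ?sv_ge1// addr_ge0 ?powR_ge0.
rewrite /freq_weight; case: (leP 1 (freq_norm j)) => h; last by rewrite powR1 lerDl powR_ge0.
by rewrite (@le_trans _ _ (freq_norm j `^ s1)) ?lerDr// ler_powR.
Qed.

(** A given solution is a function, while [nonlin] uses the function rebuilt from coefficients; the
    two coincide almost everywhere, hence so do their powers. *)
Lemma power_nonlinearity_synthesis v t (B : R) : in_L2 (v t) -> l1ball B (fourier (v t)) ->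
  fourier (power_nonlinearity p (v t)) =
  fourier (power_nonlinearity p (synthesis (fourier (v t)))).
Proof.
move=> v2 bv; have [g2 gE gB] := l1ball_synthesis bv; have [_ vB] := bv.
have [pv _] := power_nonlinearity_wl1 p v2 vB.
have [pg _] := power_nonlinearity_wl1 p g2 gB.
apply: eq_fourier_ae; [exact: in_L2_cintegrable..|].
have := fourier_inj_ae (in_L2_cintegrable v2) (in_L2_cintegrable g2).
rewrite gE => /(_ (fun=> erefl)); apply: filterS => x vx.
by rewrite /power_nonlinearity vx.
Qed.

(** Brings any solution of the class into the setting of [solves]. Continuity in H^s1 on a compact
    interval gives one bound for all times, and s1 >= s0 > d / 2 turns it into an [l^1] radius. *)
Lemma NLS_solution_curve v : NLS_solution p sgn s1 T u0 v ->
  [/\ (forall t, 0 <= t <= T -> in_L2 (v t)),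
      (exists B : R, 0 <= B /\ forall t, 0 <= t <= T -> l1ball B (fourier (v t))),
      (exists X : R, forall t, 0 <= t <= T -> wl2 (fun=> 1) (fourier (v t)) X) &
      solves T w N (fourier u0) (fun t => fourier (v t)) (fun t => fourier (v t))].
Proof.
move=> [v0 [ut [cv dv] eq]]; have [v2 vX cvh] := C0_H_elim cv.
have h00 : 0 <= (0 : R) <= T by rewrite lexx.
have [X HX] : exists X, forall t, 0 <= t <= T -> wl2 (hsw s1) (fourier (v t)) X.
  apply: (locally_bounded_segment (P := fun t X => wl2 (hsw s1) (fourier (v t)) X)) => //.
    by move=> t X Y; apply: wl2_le => j; exact: hsw_ge0.
  move=> t tT; have [de de0 H] := cvh t tT 1 ltr01; have [X HX] := vX t tT.
  exists de => //; exists (1 + X) => t' t'T l.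
  have := wl2D (@hsw_ge0 _ _ s1) (H t' t'T l) HX.
  by congr wl2; apply/funext => j; rewrite subrK.
have [C C0 HC] := sum_freq_weight d0 ds0.
have vB t : 0 <= t <= T -> l1ball (Num.sqrt C * X / 1) (fourier (v t)).
  move=> tT; split.
    by exists X; apply/l2le_wl2; have [] := wl2_hsw (HX t tT).
  exact: (wl1_of_wl2 C0 HC ltr01 freq_weight_le_hsw (HX t tT)).
have [X0 _] := HX 0 h00.
split => //.
- by exists (Num.sqrt C * X / 1); split => //; rewrite divr_ge0// mulr_ge0// sqrtr_ge0.
- exists X => t tT; have [h _] := wl2_hsw (HX t tT).
  by apply: wl2_mono h => j; rewrite ler01 sv_ge1.
split.
  by apply: eq_fourier_ae => //; apply: in_L2_cintegrable => //; exact: v2.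
move=> j; apply: deriv_on_ext (C1_distrib_H_elim j dv) => // t tT.
have := eq t; rewrite in_segment => /(_ tT j).
rewrite (power_nonlinearity_synthesis (v2 t tT) (vB t tT)) /laplacian /multiplier /nonlin.
have ii : ('i)%C * ('i)%C = -1 :> R[i] by rewrite -expr2 sqr_i.
have -> : (w j) *i = ('i)%C * (w j)%:C by apply: eq_ReIm; rewrite !ReImE /=; ring.
rewrite rmorphN /=.
move: (fourier (power_nonlinearity _ _) _) ((w j)%:C) ((-1) ^+ sgn) ('i)%C ii => F W S I II E.
apply/eqP; rewrite -subr_eq0; apply/eqP.
have -> : ut t j - (I * W * fourier (v t) j + I * S * F) =
  (I * I + 1) * ut t j - I * (I * ut t j - - W * fourier (v t) j + S * F) by ring.
by rewrite II E addNr mul0r mulr0 subr0.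
Qed.

(** Each solution is its own frozen curve, so [solves_difference] applies to the pair again and
    again, halving the bound each time. The radius may be large: the exponential weight makes the
    contraction work on any interval. *)
Lemma NLS_unique u v : NLS_solution p sgn s1 T u0 u -> NLS_solution p sgn s1 T u0 v ->
  forall t, 0 <= t <= T -> {ae torus_measure R d, forall x, v t x = u t x}.
Proof.
move=> /NLS_solution_curve[u2 [B1 [B10 uB]] [X uX] su].
move=> /NLS_solution_curve[v2 [B2 [B20 vB]] [Y vY] sv'] t tT.
apply: fourier_inj_ae; [by apply: in_L2_cintegrable; auto..|] => j.
have h00 : 0 <= (0 : R) <= T by rewrite lexx.
have [X0 _] := uX 0 h00; have [Y0 _] := vY 0 h00.
pose B := Num.max B1 B2; have B0 : 0 <= B by rewrite le_max B10.
pose L := (2 * p + 1)%:R * B ^+ (2 * p) + 1.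
have L0 : 0 < L by rewrite ltr_wpDl// mulr_ge0// exprn_ge0.
have ball_mono (B' : R) c : B' <= B -> l1ball B' c -> l1ball B c.
  by move=> BB [h cB]; split => // r ur; rewrite (le_trans (cB r ur)).
have NL c c' D : l1ball B c -> l1ball B c' -> wl2 (fun=> 1) (fun j => c j - c' j) D ->
    wl2 (fun=> 1) (fun j => N c j - N c' j) (L * D).
  move=> bc bc' cc'; apply: (wl2_le (fun=> ler01) (nonlin_lipschitz p sgn bc bc' cc')).
  by have [D0 _] := cc'; rewrite mulrDl lerDl mul1r.
have bu s : 0 <= s <= T -> l1ball B (fourier (u s)).
  by move=> sT; apply: ball_mono (uB s sT); rewrite le_max lexx.
have bv s : 0 <= s <= T -> l1ball B (fourier (v s)).
  by move=> sT; apply: ball_mono (vB s sT); rewrite le_max lexx orbT.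
have eL s : 0 <= s -> 1 <= expR (2 * L * s) by move=> s00; apply: expR_ge1; rewrite !mulr_ge0// ltW.
have it n s : 0 <= s <= T -> wl2 (fun=> 1) (fun j => fourier (v s) j - fourier (u s) j)
    ((Y + X) / 2 ^+ n * expR (2 * L * s)).
  elim: n s => [|n IH] s sT.
    apply: (wl2_le (fun=> ler01) (wl2B (fun=> ler01) (vY s sT) (uX s sT))).
    by rewrite expr0 divr1 ler_peMr ?addr_ge0// eL//; case/andP: sT.
  have -> : (Y + X) / 2 ^+ n.+1 = (Y + X) / 2 ^+ n / 2 by rewrite exprSr invfM mulrA.
  apply: (solves_difference L0 NL sv' su) => //.
  by rewrite divr_ge0 ?addr_ge0// exprn_ge0.
apply/eqP; rewrite -subr_eq0; apply/eqP/Normc.eq0_normc/eqP.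
rewrite eq_le normc_ge0 andbT; apply/ler_addgt0Pr => e e0; rewrite add0r.
have [n H] := geometric_small ((Y + X) * expR (2 * L * t)) e0.
apply: le_trans (H n (leqnn n)); rewrite mulrAC.
exact: wl2_normc (it n t tT).
Qed.

End Uniqueness.

(** * Constants *)

Local Close Scope complex_scope.

Section Constants.
Context {R : realType}.
Implicit Types (s r : R).

Lemma expR_le2 (x : R) : x <= 1 / 2 -> expR x <= 2.
Proof.
move=> x2; have := expR_ge1Dx (- x); rewrite expRN => h.
have x1 : 1 / 2 <= (expR x)^-1 by apply: le_trans h; lra.
by rewrite -[expR x]invrK -[2 in leRHS]invrK lef_pV2 ?posrE ?invr_gt0 ?expR_gt0 ?ltr0n// -div1r.
Qed.

Lemma powR_natM (a r : R) n : 0 <= a -> a `^ (n%:R * r) = (a `^ r) ^+ n.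
Proof. by move=> a0; rewrite mulrC powRrM powR_mulrn// powR_ge0. Qed.

Definition energy_rate (p : nat) (s0 s1 eps M s : R) :=
  M `^ ((2 * p)%:R * (s - s1)) *
  (2 ^+ (4 * p + 1) * M `^ ((2 * p)%:R * s0) / 2 `^ ((2 * p)%:R * (s1 - s0))) *
  eps ^+ (2 * p).

(** The powers of eps, of M to the 2 p s0 and of 2 cancel, since 4 (2 p + 2) = (4 p + 1) + (4 p +
    7); for s = s1 a constant below 1/2 remains. *)
Lemma energy_rate_T_good p s0 s1 eps M s : 0 < eps -> 0 < M ->
  energy_rate p s0 s1 eps M s * T_good p s0 s1 eps M =
  M `^ ((2 * p)%:R * (s - s1)) * (2 ^+ (4 * p + 7))^-1.
Proof.
move=> e0 M0; rewrite /energy_rate /T_good.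
have -> : 2 ^+ (4 * (2 * p + 2)) = 2 ^+ (4 * p + 1) * 2 ^+ (4 * p + 7) :> R.
  by rewrite -exprD; congr (_ ^+ _); ring.
have h2 n : 2 ^+ n != 0 :> R by rewrite expf_neq0.
have hM r : M `^ r != 0 by rewrite gt_eqF// powR_gt0.
have h2' r : 2 `^ r != 0 :> R by rewrite gt_eqF// powR_gt0.
have he : eps ^+ (2 * p) != 0 by rewrite expf_neq0// gt_eqF.
move: (h2 (4 * p + 1)%N) (h2 (4 * p + 7)%N) (hM ((2 * p)%:R * s0))
  (h2' ((2 * p)%:R * (s1 - s0))) he.
move: (2 ^+ (4 * p + 1)) (2 ^+ (4 * p + 7)) (M `^ ((2 * p)%:R * s0))
  (2 `^ ((2 * p)%:R * (s1 - s0))) (eps ^+ (2 * p)) => a b c e f *.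
by field; apply/and5P.
Qed.

(* With [M = 2 M1] this reduces to [2^s * 4 sqrt C <= M^s]. *)
Lemma growth_rate_le p s0 s1 eps (M1 C s : R) : 0 <= s0 -> s0 <= s -> 0 < eps ->
  1 <= M1 -> 4 * Num.sqrt C <= M1 `^ s0 ->
  growth_rate p (Num.sqrt C * (4 * eps) / (2 * (2 * M1)) `^ (s1 - s0)) s <=
  energy_rate p s0 s1 eps (2 * M1) s.
Proof.
move=> s00 s0s e0 M11 CM; have M10 : 0 < M1 by rewrite (lt_le_trans ltr01).
have M0 : 0 < 2 * M1 by rewrite mulr_gt0.
rewrite /growth_rate /energy_rate !powR_natM ?(ltW M0)//.
set M := 2 * M1; set Q := (2 `^ (s1 - s0)).
have Q0 : 0 < Q by rewrite powR_gt0.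
have -> : (M `^ (s - s1)) ^+ (2 * p) *
   (2 ^+ (4 * p + 1) * (M `^ s0) ^+ (2 * p) / Q ^+ (2 * p)) * eps ^+ (2 * p) =
   2 ^+ (4 * p + 1) * ((M `^ (s - s1) * M `^ s0 / Q) * eps) ^+ (2 * p).
  by rewrite !exprMn exprVn; ring.
rewrite -mulrA -exprMn; apply: ler_pM => //.
- by rewrite exprn_ge0// !mulr_ge0 ?sqrtr_ge0 ?invr_ge0 ?powR_ge0// ltW.
- rewrite -natrX ler_nat (@leq_trans (2 ^ (2 * p + 1)))//; first by rewrite ltnW// ltn_expl.
  by rewrite leq_exp2l// leq_add2r leq_mul2r orbT.
rewrite lerXn2r ?nnegrE ?mulr_ge0 ?sqrtr_ge0 ?invr_ge0 ?powR_ge0 ?(ltW e0) ?(ltW Q0)//.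
have -> : (2 * M) `^ (s1 - s0) = Q * M `^ (s1 - s0) by rewrite powRM// ltW.
have Ms : M `^ (s1 - s0) * (M `^ (s - s1) * M `^ s0) = M `^ s.
  rewrite -!powRD; try by rewrite (gt_eqF M0) implybT.
  by congr (_ `^ _); ring.
have P0 : 0 < M `^ (s1 - s0) by rewrite powR_gt0.
rewrite -(ler_pM2l P0) -(ler_pM2l Q0).
have -> : Q * (M `^ (s1 - s0) * (M `^ (s - s1) * M `^ s0 / Q * eps)) = M `^ s * eps.
  by rewrite -Ms; field; rewrite gt_eqF.
have -> : Q * (M `^ (s1 - s0) * (2 `^ s * (Num.sqrt C * (4 * eps) / (Q * M `^ (s1 - s0))))) =
   2 `^ s * (4 * Num.sqrt C) * eps by field; rewrite !gt_eqF.
rewrite ler_pM2r// /M powRM ?(ltW M10)// ler_wpM2l ?powR_ge0// (le_trans CM)//.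
by rewrite ler_powR.
Qed.

End Constants.

(** * The a priori bound and the choice of constants *)

Section LargeFrequencies.
Context {R : realType} {d : nat}.
Implicit Types (j : d.-tuple int).

(** Split at |j| = A: below, the weight is at most A and the constant A^s1 pays; above, |j| exceeds
    A >= 1 and |j|^s1 pays. *)
Lemma freq_weight_le_cutoff (s0 s1 A : R) j : 0 <= s0 -> s0 <= s1 -> 1 <= A ->
  A `^ (s1 - s0) * freq_weight j `^ s0 <= A `^ s1 + freq_norm j `^ s1.
Proof.
move=> s00 s01 A1; have A0 : 0 < A by rewrite (lt_le_trans ltr01).
have E (x : R) : 0 < x -> x `^ (s1 - s0) * x `^ s0 = x `^ s1.
  by move=> x0; rewrite -powRD ?subrK// (gt_eqF x0) implybT.
have [jA|Aj] := leP (freq_norm j) A.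
  rewrite (@le_trans _ _ (A `^ s1))//; last by rewrite lerDl powR_ge0.
  rewrite -(E A)// ler_wpM2l ?powR_ge0// ge0_ler_powR ?nnegrE ?(ltW A0)//.
    by rewrite (le_trans ler01)// freq_weight_ge1.
  by rewrite /freq_weight ge_max A1.
have j1 : 1 <= freq_norm j :> R by rewrite (le_trans A1)// ltW.
rewrite (@le_trans _ _ (freq_norm j `^ s1))//; last by rewrite lerDr powR_ge0.
rewrite /freq_weight; move/max_idPr: (j1) => ->.
rewrite -(E (freq_norm j)) ?(lt_trans A0)// ler_wpM2r ?powR_ge0//.
by rewrite ge0_ler_powR ?nnegrE ?subr_ge0 ?(ltW A0) ?freq_norm_ge0// ltW.
Qed.

End LargeFrequencies.

Lemma T_good_gt0 {R : realType} (p : nat) (s0 s1 eps M : R) : 0 < eps -> 0 < M ->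
  0 < T_good p s0 s1 eps M.
Proof. by move=> e0 M0; rewrite /T_good !mulr_gt0 ?invr_gt0 ?exprn_gt0 ?powR_gt0. Qed.

(** The circle closes here: the rate in the condition on [T] is computed with the very radius [B]
    that the conclusion recovers. The two parts of the norm are followed separately, so that (2
    M)^s1 is attached to the L^2 part only. *)
Lemma grows_as_l1ball {R : realType} {d : nat} (p : nat) (sgn : bool)
    (s0 s1 eps M C : R) (u0 : torus R d -> R[i]) (T : R) :
  let B := Num.sqrt C * (4 * eps) / (2 * M) `^ (s1 - s0) in
  0 <= C -> (forall r : seq (d.-tuple int), uniq r ->
    \sum_(j <- r) freq_weight j `^ (- (2 * s0)) <= C) ->
  0 <= s0 -> s0 <= s1 -> 0 < eps -> 1 <= M -> growth_rate p B s1 * T <= 1 / 2 ->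
  in_H s1 u0 -> (Hnorm s1 u0 <= eps%:E)%E -> (((2 * M) `^ s1)%:E * L2norm u0 <= eps%:E)%E ->
  forall t v, 0 <= t <= T ->
    grows_as (nonlin p sgn) (l1ball B) (fourier u0) t v -> l1ball B v.
Proof.
move=> B C0 HC s00 s01 e0 M1 KT Hu He Le t v /andP[t0 tT] gv.
have B0 : 0 <= B by rewrite divr_ge0 ?powR_ge0// mulr_ge0 ?sqrtr_ge0 ?mulr_ge0 ?(ltW e0).
have s10 : 0 <= s1 := le_trans s00 s01.
have [a [b [La Hab ua ub]]] := in_HP Hu.
move: He Le; rewrite La Hab -EFinM !lee_fin => abe ae.
have [a0 _] := ua; have [b0 _] := ub.
have va := gv _ _ _ (growth_cst p sgn B0 (sv_ge0 (R := R) (d := d)) s10) ua.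
have vb := gv _ _ _ (growth_sobolev p sgn (d := d) B0 s10) ub.
have [_ K0 _] := growth_sobolev p sgn (d := d) B0 s10.
have E2 : expR (growth_rate p B s1 * t) <= 2.
  by apply: expR_le2; apply: le_trans KT; rewrite ler_wpM2l.
have A0 : 0 <= (2 * M) `^ s1 by exact: powR_ge0.
split.
  by exists (a * expR (growth_rate p B s1 * t)); apply/l2le_wl2.
have A1 : 1 <= 2 * M by lra.
apply: (wl1_of_wl2 C0 HC _ (w := fun j => (2 * M) `^ s1 * Num.sqrt ((2 * pi) ^+ d) +
    Num.sqrt ((2 * pi) ^+ d) * freq_norm j `^ s1)).
- by rewrite powR_gt0// (lt_le_trans ltr01).
- move=> j; rewrite [_ * Num.sqrt _]mulrC -mulrDr.
  apply: le_trans (freq_weight_le_cutoff j s00 s01 A1) _.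
  by rewrite ler_peMl ?sv_ge1// addr_ge0 ?powR_ge0.
- apply: (wl2_le _ (wl2_addw (wl2_scalew A0 va) vb)) => [j|].
    by rewrite addr_ge0 ?mulr_ge0 ?sv_ge0 ?powR_ge0.
  (* The weighted L^2 part and the homogeneous part start at most at eps, and each at most doubles:
     this is the 4 in [B]. *)
  rewrite mulrA -mulrDl (_ : 4 * eps = (eps + eps) * 2); last by ring.
  apply: ler_pM => //; rewrite ?expR_ge0 ?addr_ge0 ?mulr_ge0//.
  by rewrite lerD// (le_trans _ abe)// lerDr.
Qed.

Theorem theorem1p2 (R : realType) (d : nat) (s0 : R)
    (hd : (1 <= d)%N) (hs0 : d%:R / 2 < s0) :
  exists eps0 M : R, [/\ 0 < eps0, eps0 < 1, 0 < M &
    forall (p : nat) (sgn : bool) (s1 eps : R) (u0 : torus R d -> R[i]),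
      (1 <= p)%N -> s0 <= s1 -> 0 < eps -> eps <= eps0 ->
      in_H s1 u0 ->
      (Hnorm s1 u0 <= eps%:E)%E ->
      (((2 * M) `^ s1)%:E * L2norm u0 <= eps%:E)%E ->
      exists (T : R) (u : R -> torus R d -> R[i]),
      [/\ 0 < T /\ T_good p s0 s1 eps M <= T,
          NLS_solution p sgn s1 T u0 u,
          (forall v : R -> torus R d -> R[i], NLS_solution p sgn s1 T u0 v ->
            forall t, t \in `[0, T] ->
              {ae torus_measure R d, forall x, v t x = u t x}),
          (ereal_sup [set Hnorm s1 (u t) | t in `[0, T]%classic%R] <=
            6%:E * (Hnorm s1 u0 + ((2 * M) `^ s1)%:E * L2norm u0))%E &
          forall s : R, s1 <= s -> in_H s u0 ->
          [/\ exists ut, solution_class s T u ut,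
              (forall t, t \in `[0, T] ->
                (Hnorm s (u t) <=
                  3%:E * (Hnorm s u0 + ((2 * M) `^ s)%:E * L2norm u0) *
                  (expR (M `^ ((2 * p)%:R * (s - s1)) *
                         (2 ^+ (4 * p + 1) * M `^ ((2 * p)%:R * s0) /
                          2 `^ ((2 * p)%:R * (s1 - s0))) *
                         eps ^+ (2 * p) * t))%:E)%E) &
              forall T' : R, T' <= T_good p s0 s1 eps M ->
                (ereal_sup [set Hnorm s (u t) | t in `[0, T']%classic%R] <=
                  3%:E * (Hnorm s u0 + ((2 * M) `^ s)%:E * L2norm u0) *
                  (expR (M `^ ((2 * p)%:R * (s - s1))))%:E)%E]]].
Proof.
have s00 : 0 < s0 by apply: le_lt_trans hs0; rewrite divr_ge0.
have [C C0 HC] := sum_freq_weight hd hs0.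
(* The root makes M1^s0 exceed 4 sqrt C, the 1 ensures M1 >= 1, and the doubling absorbs the factor
   2^s of the product estimates. *)
pose M1 := (1 + 4 * Num.sqrt C) `^ s0^-1; pose M := 2 * M1.
have C41 : 1 <= 1 + 4 * Num.sqrt C by rewrite lerDl mulr_ge0 ?sqrtr_ge0.
have M11 : 1 <= M1.
  by rewrite -[leLHS](powRr0 (1 + 4 * Num.sqrt C)) ler_powR// invr_ge0 ltW.
have CM : 4 * Num.sqrt C <= M1 `^ s0.
  by rewrite /M1 -powRrM mulVf ?gt_eqF// powRr1 ?lerDr// (le_trans ler01).
have M1' : 1 <= M by rewrite /M mulr_natl mulr2n (le_trans M11)// lerDl (le_trans ler01).
have M0 : 0 < M by rewrite (lt_le_trans ltr01).
exists (1 / 2), M; split => //; first by lra.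
move=> p sgn s1 eps u0 p1 s01 e0 _ Hu He Le; have [u02 _] := Hu.
have s10 : 0 <= s1 := le_trans (ltW s00) s01.
(* [T_good] itself serves as existence time, so the last claim concerns only times at which [u] is
   controlled. *)
pose T := T_good p s0 s1 eps M; have T0 : 0 < T by exact: T_good_gt0.
pose B := Num.sqrt C * (4 * eps) / (2 * M) `^ (s1 - s0).
have B0 : 0 <= B by rewrite divr_ge0 ?powR_ge0// mulr_ge0 ?sqrtr_ge0 ?mulr_ge0 ?(ltW e0).
have KE s : s1 <= s -> growth_rate p B s <= energy_rate p s0 s1 eps M s.
  by move=> s1s; apply: growth_rate_le => //; [exact: ltW|exact: le_trans s1s].
have K0 s : 0 <= s -> 0 <= growth_rate p B s.
  by move=> sge0; have [] := growth_sobolev p sgn (d := d) B0 sge0.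
have ET s : energy_rate p s0 s1 eps M s * T <= M `^ ((2 * p)%:R * (s - s1)) / 2.
  rewrite energy_rate_T_good// ler_wpM2l ?powR_ge0// lef_pV2 ?posrE ?exprn_gt0//.
  by rewrite addnS exprS ler_peMr// exprn_ege1// ler1n.
(* The value 1/2 is what [expR_le2] asks for in order that norms at most double. *)
have KT : growth_rate p B s1 * T <= 1 / 2.
  apply: le_trans (ler_wpM2r (ltW T0) (KE s1 (lexx _))) (le_trans (ET s1) _).
  by rewrite subrr mulr0 powRr0.
have gb := grows_as_l1ball (sgn := sgn) C0 HC (ltW s00) s01 e0 M1' KT Hu He Le.
have [c [sc ac]] := evolution_exists (ltW T0) B0 u02 gb.
pose u t := synthesis (c t).
have Hs s a b t : 0 <= s -> 0 <= t <= T -> wl2 (fun=> Num.sqrt ((2 * pi) ^+ d)) (fourier u0) a ->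
  wl2 (fun j => Num.sqrt ((2 * pi) ^+ d) * freq_norm j `^ s) (fourier u0) b ->
  (Hnorm s (u t) <= ((a + b) * expR (growth_rate p B s * t))%:E)%E.
  by move=> ? ? ? ?; apply: (evolution_Hnorm_le B0 gb ac).
have uNLS := evolution_NLS_solution (ltW T0) B0 u02 gb sc ac s10 Hu.
exists T, u; split.
- by split.
- exact: uNLS.
- move=> v Hv t; rewrite in_segment => tT.
  exact: (NLS_unique hd hs0 s01 (ltW T0) u02 uNLS Hv tT).
- have [a [b [La Hab ua ub]]] := in_HP Hu; have [a0 _] := ua; have [b0 _] := ub.
  apply: ge_ereal_sup => _ [t /= + <-]; rewrite in_segment => tT.
  apply: le_trans (Hs s1 a b t s10 tT ua ub) _; rewrite La Hab -(EFinM _ a) -EFinD -EFinM lee_fin.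
  have E2 : expR (growth_rate p B s1 * t) <= 2.
    apply: expR_le2; apply: le_trans KT; have /andP[_ tT'] := tT.
    by rewrite ler_wpM2l// K0.
  apply: le_trans (ler_wpM2l (addr_ge0 a0 b0) E2) _.
  have A0 : 0 <= (2 * M) `^ s1 * a by rewrite mulr_ge0 ?powR_ge0.
  by move: a0 b0 A0; move: (_ * a) => A; lra.
move=> s s1s Hus; have sge0 : 0 <= s := le_trans s10 s1s.
have [a [b [La Hab ua ub]]] := in_HP Hus; have [a0 _] := ua; have [b0 _] := ub.
have A0 : 0 <= (2 * M) `^ s * a by rewrite mulr_ge0 ?powR_ge0.
have bound (t x : R) : 0 <= t <= T -> growth_rate p B s * t <= x ->
    (Hnorm s (u t) <= 3%:E * (Hnorm s u0 + ((2 * M) `^ s)%:E * L2norm u0) * (expR x)%:E)%E.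
  move=> tT gx; apply: le_trans (Hs s a b t sge0 tT ua ub) _.
  rewrite La Hab -(EFinM _ a) -EFinD -!EFinM lee_fin; apply: ler_pM; rewrite ?expR_ge0 ?addr_ge0//.
    by move: a0 b0 A0; move: (_ * a) => A; lra.
  by rewrite ler_expR.
split.
- by eexists; exact: (evolution_solution_class (ltW T0) B0 gb sc ac sge0 Hus).
- move=> t; rewrite in_segment => tT; apply: bound => //.
  by rewrite ler_wpM2r ?KE//; case/andP: tT.
(* For negative T' the set of times is empty and the supremum is minus infinity; otherwise every t
   in it lies in [0, T]. *)
- move=> T' T'T; apply: ge_ereal_sup => _ [t /= + <-]; rewrite in_segment => /andP[t0 tT'].
  have tT : t <= T := le_trans tT' T'T.
  apply: bound; first by rewrite t0.
  apply: le_trans (ler_wpM2l (K0 s sge0) tT) _.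
  apply: le_trans (ler_wpM2r (ltW T0) (KE s s1s)) (le_trans (ET s) _).
  by rewrite ler_pdivrMr// ler_peMr ?powR_ge0// ler1n.
Qed.
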